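(* Let $\theta\in(0,1)$ and let $X$ be a Markov process associated with a generator $\mathcal{I}\in\mathfrak{L}^{\mathsf{sym}}_{\alpha}(\lambda)\cup\mathfrak{I}_{\alpha}(\theta,\lambda)$. Suppose that the Lyapunov stability condition holds and that, for some constant $K_0$, the growth condition $$x\cdot b(x)\,\vee\,|x|\,k(x,z)\le K_0(1+|x|^2)\qquad\forall x,z\in\mathbb{R}^d$$ holds. Then $X$ has an invariant probability measure.
   Context: Fix $\alpha\in(1,2)$ and a nondecreasing function $\lambda:[0,\infty)\to(0,\infty)$; for a bounded domain $D$ put $\lambda_D=\inf\{\lambda(R):D\subset B_{R+1}\}$, where $B_R$ is the open ball of radius $R$ centered at $0$. $\mathfrak{L}_\alpha(\lambda)$ is the class of operators $$\mathcal{I}f(x)=b(x)\cdot\nabla f(x)+\int_{\mathbb{R}^d}\bigl(f(x+z)-f(x)-\mathbf{1}_{\{|z|\le1\}}\nabla f(x)\cdot z\bigr)\frac{k(x,z)}{|z|^{d+\alpha}}\,dz,$$ with $b:\mathbb{R}^d\to\mathbb{R}^d$, $k:\mathbb{R}^d\times\mathbb{R}^d\to(0,\infty)$ Borel measurable, such that for every bounded domain $D$: $|b(x)|\le\lambda_D$ and $\lambda_D^{-1}\le k(x,z)\le\lambda_D$ for all $x\in D$, $z\in\mathbb{R}^d$. $\mathfrak{L}^{\mathsf{sym}}_\alpha(\lambda)$ is the subclass with $k(x,z)=k(x,-z)$. $\mathfrak{I}_\alpha(\theta,\lambda)$ is the subclass of $\mathfrak{L}_\alpha(\lambda)$ such that,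 for every bounded domain $D$, $\int_{\mathbb{R}^d}(|z|^{\alpha-\theta}\wedge1)\frac{|k(x,z)-k(x,0)|}{|z|^{d+\alpha}}\,dz\le\lambda_D$ for all $x\in D$. Lyapunov stability condition: there exist $\mathcal{V}\in C^2(\mathbb{R}^d)$ with $\inf_{\mathbb{R}^d}\mathcal{V}>-\infty$, a compact set $\mathcal{K}\subset\mathbb{R}^d$ and $\varepsilon>0$ such that $\mathcal{I}\mathcal{V}(x)\le-\varepsilon$ for all $x\in\mathcal{K}^c$. Standing assumption: for every initial distribution $\nu_0$ there is a strong Markov process $(X,\mathbb{P}_{\nu_0})$ with càdlàg paths associated with $\mathcal{I}$, i.e., $X_0\sim\nu_0$ and $f(X_t)-f(X_0)-\int_0^t\mathcal{I}f(X_s)\,ds$ is a martingale (with respect to the right-continuous filtration generated by $X$) for every $f\in C_b^2(\mathbb{R}^d)$; $\mathbb{P}_x,\mathbb{E}_x$ correspond to $\nu_0=\delta_x$. *)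

(* Defs.v *)
From HB Require Import structures.
From mathcomp Require Import all_boot all_order all_algebra.
From mathcomp Require Import all_classical all_reals all_analysis.
From mathcomp Require Import measurable_realfun.

Set Implicit Arguments.
Unset Strict Implicit.
Unset Printing Implicit Defensive.

Import Order.TTheory GRing.Theory Num.Theory.
Import numFieldNormedType.Exports.

Local Open Scope classical_set_scope.
Local Open Scope ring_scope.

HB.instance Definition _ (R : realType) (m n : nat) :=
  Measurable.copy 'M[R]_(m, n) (g_sigma_algebraType (@open 'M[R]_(m, n))).

Section lebesgue_measure_rV.
Variable R : realType.

Lemma measurable_coord n (i : 'I_n) :
  measurable_fun [set: 'rV[R]_n] (fun x : 'rV[R]_n => x 0 i : R).
Proof.
apply: (measurability (@RGenOpens.G R)); first exact: RGenOpens.measurableE.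
move=> _ [_ [a [b ->]] <-]; rewrite setTI; apply: sub_sigma_algebra.
apply: open_comp; last exact: interval_open.
by move=> x _; exact: coord_continuous.
Qed.

Lemma measurable_rV d (T : measurableType d) n (f : T -> 'rV[R]_n) :
  (forall i, measurable_fun [set: T] (fun t => f t 0 i : R)) ->
  measurable_fun [set: T] f.
Proof.
move=> mf; apply: (@measurability _ _ _ _ _ _ (@open 'rV[R]_n)) => //.
move=> _ [U oU <-]; rewrite setTI.
pose box (p : 'rV[rat]_n * rat) :=
  [set y : 'rV[R]_n | forall i, `|y 0 i - ratr (p.1 0 i)| < ratr p.2].
have -> : f @^-1` U = \bigcup_(p in [set p | box p `<=` U]) (f @^-1` box p).
  rewrite -preimage_bigcup; congr (_ @^-1` _).
  rewrite eqEsubset; split; last by move=> x [p /= pU] /pU.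
  move=> x Ux; have /nbhs_ballP[e /= e0 eU] := open_nbhs_nbhs (conj oU Ux).
  have /rat_in_itvoo[q] : 0 < e / 2 by rewrite divr_gt0.
  rewrite in_itv/= => /andP[q0 qe].
  have c_ (i : 'I_n) : {c : rat | `|x 0 i - ratr c| < ratr q :> R}.
    have /rat_in_itvoo/cid[c] : x 0 i - ratr q < x 0 i + ratr q.
      by rewrite ltrD2l gtrN.
    by rewrite in_itv/= => xc; exists c; rewrite distrC ltr_distl.
  exists (\row_i sval (c_ i), q) => /=; last first.
    by move=> i; rewrite /= mxE; case: (c_ i).
  move=> y /= yc; apply: eU; split=> // i j; rewrite ord1.
  rewrite /ball /= (le_lt_trans (ler_distD (ratr (sval (c_ j))) _ _))//.
  rewrite [ltRHS]splitr ltrD// (lt_trans _ qe)//; first by case: (c_ j).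
  by have := yc j; rewrite /= mxE distrC.
rewrite bigcup_mkcond; apply: countable_bigcupT_measurable => // p.
case: ifP => // _.
rewrite (_ : _ @^-1` _ = \bigcap_(i in [set: 'I_n])
    [set t | `|f t 0 i - ratr (p.1 0 i)| < ratr p.2]); last first.
  by rewrite eqEsubset; split=> [t /= + i _|t /= + i]; exact.
apply: fin_bigcap_measurable => // i _.
rewrite -[X in measurable X]setTI.
apply: measurable_fun_ltr => //.
by apply: measurableT_comp => //; apply: measurable_funB.
Qed.

Definition rV_cons n (p : R * 'rV[R]_n) : 'rV[R]_n.+1 :=
  \row_i (if unlift ord0 i is Some j then p.2 0 j else p.1).

Definition rV_uncons n (x : 'rV[R]_n.+1) : R * 'rV[R]_n :=
  (x 0 ord0, \row_j x 0 (lift ord0 j)).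

Lemma rV_consK n : cancel (@rV_cons n) (@rV_uncons n).
Proof.
move=> [a x]; rewrite /rV_uncons /rV_cons mxE unlift_none; congr pair.
by apply/rowP => j; rewrite !mxE liftK.
Qed.

Lemma measurable_rV_cons n : measurable_fun setT (@rV_cons n).
Proof.
apply: measurable_rV => i.
under eq_fun do rewrite mxE.
case: unliftP => [j _|_]; last exact: measurable_fst.
by apply: (measurableT_comp (measurable_coord j)); exact: measurable_snd.
Qed.

Lemma measurable_rV_uncons n : measurable_fun setT (@rV_uncons n).
Proof.
apply/measurable_fun_pair; first exact: measurable_coord.
by apply: measurable_rV => i; under eq_fun do rewrite mxE; exact: measurable_coord.
Qed.

Section step.
Local Open Scope ereal_scope.
Variables (n : nat) (mu : {sigma_finite_measure set 'rV[R]_n -> \bar R}).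

Definition rV_cons_measure : set 'rV[R]_n.+1 -> \bar R :=
  pushforward (@lebesgue_measure R \x mu) (@rV_cons n).

Let mu0 : rV_cons_measure set0 = 0.
Proof. by rewrite /rV_cons_measure /pushforward preimage_set0 measure0. Qed.

Let mu_ge0 A : 0 <= rV_cons_measure A.
Proof. by apply: measure_ge0; exact: measurable_rV_cons. Qed.

Let mu_sigma_additive : semi_sigma_additive rV_cons_measure.
Proof. by apply: measure_semi_sigma_additive; exact: measurable_rV_cons. Qed.

HB.instance Definition _ := isMeasure.Build _ _ _ rV_cons_measure
  mu0 mu_ge0 mu_sigma_additive.

Let mu_sigma_finite : sigma_finite setT rV_cons_measure.
Proof.
have /sigma_finiteP[F [TF ndF Foo]] := sigma_finiteT (@lebesgue_measure R).
have /sigma_finiteP[G [TG ndG Goo]] := sigma_finiteT mu.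
exists (fun k => @rV_uncons n @^-1` (F k `*` G k)).
  rewrite -preimage_bigcup (_ : \bigcup_k _ = setT) ?preimage_setT//.
  rewrite -setXTT TF TG predeqE => -[x y]; split.
    by move=> [k _ [Fkx Gky]]; split; exists k.
  move=> [/= [k _ Fkx] [l _ Gly]]; exists (maxn k l) => //; split.
  - by move: x Fkx; exact/subsetPset/ndF/leq_maxl.
  - by move: y Gly; exact/subsetPset/ndG/leq_maxr.
move=> k; have [mFk Fkoo] := Foo k; have [mGk Gkoo] := Goo k; split.
  rewrite -[X in measurable X]setTI.
  by apply: measurable_rV_uncons => //; exact: measurableX.
rewrite /rV_cons_measure /pushforward -comp_preimage.
rewrite (_ : _ \o _ = id); last by apply/funext => p; exact: rV_consK.
by rewrite preimage_id product_measure1E// lte_mul_pinfty// ge0_fin_numE.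
Qed.

HB.instance Definition _ := Measure_isSigmaFinite.Build _ _ _ rV_cons_measure
  mu_sigma_finite.

End step.

Fixpoint lebesgue_rV n : {sigma_finite_measure set 'rV[R]_n -> \bar R} :=
  match n with
  | 0 => \d_(0 : 'rV[R]_0)
  | n'.+1 => rV_cons_measure (lebesgue_rV n')
  end.

Lemma lebesgue_rV_box n (A : 'I_n -> set R) :
  (forall i, measurable (A i)) ->
  lebesgue_rV n [set x | forall i, A i (x 0 i)] =
  (\prod_(i < n) lebesgue_measure (A i))%E.
Proof.
elim: n A => [|n IH] A mA.
  rewrite big_ord0 /= diracE mem_set// => -[].
  by [].
rewrite big_ord_recl -IH; last by move=> i; exact: mA.
have mB : measurable [set x : 'rV[R]_n | forall i, A (lift ord0 i) (x 0 i)].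
  rewrite (_ : mkset _ = \bigcap_(i in [set: 'I_n])
      ((fun x : 'rV[R]_n => x 0 i) @^-1` A (lift ord0 i))); last first.
    by rewrite eqEsubset; split=> x /= xA i; move: (xA i); exact.
  apply: fin_bigcap_measurable => // i _.
  rewrite -[X in measurable X]setTI.
  by apply: measurable_coord => //; exact: mA.
rewrite -product_measure1E//; last exact: mA.
rewrite /= /rV_cons_measure /pushforward.
congr (_ _); rewrite eqEsubset; split=> -[a x] /=.
  move=> xA; split=> /=; first by have := xA ord0; rewrite mxE unlift_none.
  by move=> i; have := xA (lift ord0 i); rewrite mxE liftK.
by move=> [/= aA xA] i; rewrite mxE; case: unliftP => [j ->|->] //=.
Qed.

End lebesgue_measure_rV.

Section euclidean.
Variables (R : realType) (d : nat).
Implicit Types (x y : 'rV[R]_d) (f : 'rV[R]_d -> R).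

Definition dot x y : R := \sum_i x 0 i * y 0 i.

(* The library norm on 'rV[R]_d is the sup norm; the Euclidean norm induces the
   same topology but different balls. *)
Definition enorm x : R := Num.sqrt (dot x x).

Definition eball (r : R) : set 'rV[R]_d := [set x | enorm x < r].

Definition bounded_domain (D : set 'rV[R]_d) : Prop :=
  [/\ open D, connected D, D !=set0 & exists r, D `<=` eball r].

Definition partial (i : 'I_d) f : 'rV[R]_d -> R :=
  fun x => 'D_(delta_mx 0 i) f x.

Definition grad f x : 'rV[R]_d := \row_i partial i f x.

Definition C1 f : Prop :=
  continuous f /\
  forall i, (forall x, derivable f x (delta_mx 0 i)) /\ continuous (partial i f).

Definition C2 f : Prop := C1 f /\ forall i, C1 (partial i f).

Definition bounded_func f : Prop := exists M, forall x, `|f x| <= M.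

Definition C2b f : Prop :=
  [/\ C2 f, bounded_func f, forall i, bounded_func (partial i f) &
      forall i j, bounded_func (partial i (partial j f))].

End euclidean.

Section stable_like_operators.
Variables (R : realType) (d : nat) (alpha theta : R) (lam : R -> R).
Variables (b : 'rV[R]_d -> 'rV[R]_d) (k : 'rV[R]_d -> 'rV[R]_d -> R).
Implicit Types (x z : 'rV[R]_d) (f V : 'rV[R]_d -> R).

(* The kernel |z| ^ (- d - alpha) takes the value 0 at z = 0. *)
Definition stable_kernel z : R := (enorm z `^ (d%:R + alpha))^-1.

(* Extended-real valued, since f need not be bounded.  For f of class C2 and
   bounded below, and for coefficients in [class_L], the negative part of the
   integrand is integrable, so that the integral is never of the form
   +oo - +oo. *)
Definition generator f x : \bar R :=
  ((dot (b x) (grad f x))%:E +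
   \int[lebesgue_rV R d]_z
     ((f (x + z) - f x - \1_[set w | enorm w <= 1] z * dot (grad f x) z) *
      (k x z * stable_kernel z))%:E)%E.

Definition lambda_dom (D : set 'rV[R]_d) : R :=
  inf [set lam r | r in [set r | 0 <= r /\ D `<=` eball (r + 1)]].

Definition class_L : Prop :=
  [/\ measurable_fun setT b,
      measurable_fun setT (fun p : 'rV[R]_d * 'rV[R]_d => k p.1 p.2),
      forall x z, 0 < k x z &
      forall D, bounded_domain D -> forall x, D x ->
        enorm (b x) <= lambda_dom D /\
        forall z, (lambda_dom D)^-1 <= k x z <= lambda_dom D].

Definition class_L_sym : Prop :=
  class_L /\ forall x z, k x z = k x (- z).

Definition class_I : Prop :=
  class_L /\
  forall D, bounded_domain D -> forall x, D x ->
    (\int[lebesgue_rV R d]_z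
       (Num.min (enorm z `^ (alpha - theta)) 1 *
        (`|k x z - k x 0| * stable_kernel z))%:E <= (lambda_dom D)%:E)%E.

Definition lyapunov_stable : Prop :=
  exists V, exists K : set 'rV[R]_d, exists eps : R,
    [/\ C2 V, has_lbound (range V), compact K, 0 < eps &
        forall x, ~ K x -> (generator V x <= (- eps)%:E)%E].

Definition growth_condition (K0 : R) : Prop :=
  forall x z,
    Num.max (dot x (b x)) (enorm x * k x z) <= K0 * (1 + enorm x ^+ 2).

End stable_like_operators.

Section processes.
Variables (R : realType) (d : nat) (dO : measure_display).
Variable (Omega : measurableType dO).

Section conditional_expectation.
Variable P : probability Omega R.

(* Z is a version of the conditional expectation of Y given the
   sigma-algebra G. *)
Definition is_cond_expectation (G : set_system Omega) (Y Z : Omega -> R) :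
    Prop :=
  [/\ P.-integrable setT (EFin \o Y),
      P.-integrable setT (EFin \o Z),
      forall B, measurable B -> G (Z @^-1` B) &
      forall A, G A ->
        (\int[P]_(w in A) (Y w)%:E = \int[P]_(w in A) (Z w)%:E)%E].

Definition martingale (F : R -> set_system Omega) (M : R -> Omega -> R) :
    Prop :=
  forall s t, 0 <= s -> s <= t -> is_cond_expectation (F s) (M t) (M s).

End conditional_expectation.

(* A process is indexed by R, but only its values at times t >= 0 matter. *)
Variable X : R -> Omega -> 'rV[R]_d.

Definition cadlag (w : Omega) : Prop :=
  (forall t, 0 <= t -> X ^~ w @ t^'+ --> X t w) /\
  (forall t, 0 < t -> cvg (X ^~ w @ t^'-)).

Definition raw_filtration (t : R) : set_system Omega :=
  <<s [set A | exists s B, [/\ 0 <= s, s <= t, measurable B &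
                               A = X s @^-1` B]] >>.

Definition filtration (t : R) : set_system Omega :=
  \bigcap_(s in [set s | t < s]) raw_filtration s.

Definition filtration_infty : set_system Omega :=
  <<s \bigcup_(t in [set t | 0 <= t]) raw_filtration t >>.

Definition stopping_time (tau : Omega -> \bar R) : Prop :=
  (forall w, 0 <= tau w)%E /\
  forall t, 0 <= t -> filtration t [set w | (tau w <= t%:E)%E].

Definition stopped_filtration (tau : Omega -> \bar R) : set_system Omega :=
  [set A | filtration_infty A /\
    forall t, 0 <= t -> filtration t (A `&` [set w | (tau w <= t%:E)%E])].

(* P nu is the law under the initial distribution nu. *)
Variable P : probability 'rV[R]_d R -> probability Omega R.

Definition P_at (x : 'rV[R]_d) : probability Omega R := P \d_x.

(* On the event tau < +oo, the conditional expectation of f (X (tau + t))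
   given F_tau under P nu is E_y[f (X t)] at y = X tau. *)
Definition strong_markov : Prop :=
  forall nu tau, stopping_time tau ->
  forall t, 0 <= t ->
  forall f : 'rV[R]_d -> R, measurable_fun setT f -> bounded_func f ->
    is_cond_expectation (P nu) (stopped_filtration tau)
      (fun w => \1_[set v | (tau v < +oo)%E] w * f (X (fine (tau w) + t) w))
      (fun w => \1_[set v | (tau v < +oo)%E] w *
                fine ('E_(P_at (X (fine (tau w)) w))[f \o X t])%E).

Definition strong_markov_process : Prop :=
  [/\ forall t, 0 <= t -> measurable_fun setT (X t),
      forall w, cadlag w,
      forall nu B, measurable B -> P nu (X 0 @^-1` B) = nu B,
      forall t B, 0 <= t -> measurable B ->
        measurable_fun setT (fun x => P_at x (X t @^-1` B)) &
      strong_markov].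

(* The time integral is finite: for f of class C2b, I f is bounded on bounded
   sets, and cadlag paths are bounded on [0, t]. *)
Definition martingale_problem (I : ('rV[R]_d -> R) -> 'rV[R]_d -> \bar R) :
    Prop :=
  forall nu f, C2b f ->
    martingale (P nu) filtration
      (fun t w => f (X t w) - f (X 0 w) -
         fine (\int[lebesgue_measure]_(s in `[0%R, t]) I f (X s w))%E).

Definition associated_process (I : ('rV[R]_d -> R) -> 'rV[R]_d -> \bar R) :
    Prop :=
  strong_markov_process /\ martingale_problem I.

Definition invariant_probability (mu : probability 'rV[R]_d R) : Prop :=
  forall t B, 0 <= t -> measurable B ->
    (\int[mu]_x P_at x (X t @^-1` B) = mu B)%E.

End processes.

(* Main.v *)
(** A chain with a Foster-Lyapunov drift towards a set C on which its kernel Q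
    dominates c nu has the invariant measure sum_n nu (Q - c 1_C nu)^n, which is
    finite by the drift.  This is applied to the resolvent
    Q(x, .) = int_0^oo e^-t P_t(x, .) dt.  For the minorization, Dynkin's formula
    at the time of exit from a ball, for smooth functions supported in a distant
    ball U, bounds the law of the exit position below by a multiple of Lebesgue
    measure on U: only jumps reach U, and their intensity is bounded below.  The
    drift comes from truncations of V in space, the growth condition being what
    makes I f bounded for f of compact support.  Finally, if mu Q = mu, then
    phi(t) = mu P_t(B) satisfies phi(t) = int_0^oo e^-s phi(t + s) ds, which
    forces phi to be constant. *)

Require Import Defs.
From HB Require Import structures.
From mathcomp Require Import all_boot all_order all_algebra.
From mathcomp Require Import all_classical all_reals all_analysis.
From mathcomp Require Import measurable_realfun ring lra.

Set Implicit Arguments.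
Unset Strict Implicit.
Unset Printing Implicit Defensive.

Import Order.TTheory GRing.Theory Num.Theory.
Import numFieldNormedType.Exports.

Local Open Scope classical_set_scope.
Local Open Scope ring_scope.

(** The coefficients are only measurable, so no Feller property is at hand to show that weak limits
    of time averages are invariant; regeneration works with measurable kernels. The resolvent is
    preferred to a single P_t because an exponential clock tolerates random shifts: for a stopping
    time sigma <= 1, the strong Markov property and memorylessness give E_x Q(X_sigma, A) <= e Q(x,
    A). A lower bound on the law of X_sigma thus becomes one on Q itself, with nu(A) = int_W Q(y, A)
    dy for a unit cube W instead of Lebesgue measure on W. This is why exit times are capped at 1;
    Dynkin's formula for a cutoff function bounds their mean below, uniformly on C. The integral of
    V against this nu is finite, since the drift yields Q V <= V + M and V is bounded on W. Another
    obstacle is that the Lyapunov condition is silent about I V inside K, where V might a priori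
    have an infinite integral against the jump kernel. Finiteness of I V at one point off K controls
    the tail integral of V there, and comparing kernels under a translation carries this bound to a
    whole ball. *)

(** * Kernels acting on measures, differences of finite measures *)

Section bind.
Local Open Scope ereal_scope.
Context d d' (X : measurableType d) (Y : measurableType d') (R : realType).
Variables (m : {measure set X -> \bar R}) (Q : R.-ker X ~> Y).

Definition mbind (A : set Y) : \bar R := \int[m]_x Q x A.

Let mbind0 : mbind set0 = 0.
Proof. by rewrite /mbind integral0_eq// => x _; rewrite measure0. Qed.

Let mbind_ge0 A : 0 <= mbind A.
Proof. exact: integral_ge0. Qed.

Let mbind_sigma_additive : semi_sigma_additive mbind.
Proof.
move=> F mF tF mUF; rewrite [X in _ --> X](_ : _ =
    \int[m]_x (\sum_(0 <= k <oo) Q x (F k))); last first.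
  by apply: eq_integral => x _; apply/esym/cvg_lim => //; exact: measure_sigma_additive.
rewrite [X in X @ _](_ : _ =
    (fun n => \int[m]_x (\sum_(0 <= i < n) Q x (F i)))); last first.
  apply/funext => n; rewrite -ge0_integral_sum// => i.
  exact: measurable_kernel.
apply: cvg_monotone_convergence => //.
- by move=> n; apply: emeasurable_sum => i; exact: measurable_kernel.
- by move=> n x _; rewrite sume_ge0.
- by move=> x _ i j ij; exact: ereal_nondecreasing_series.
Qed.

HB.instance Definition _ := isMeasure.Build _ _ _ mbind
  mbind0 mbind_ge0 mbind_sigma_additive.

Import HBNNSimple.

(** Both sides commute with monotone limits of simple functions, and for an indicator the identity
    is the definition of [mbind]. *)
Lemma integral_mbind (f : Y -> \bar R) :
  (forall y, 0 <= f y) -> measurable_fun setT f ->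
  \int[mbind]_y f y = \int[m]_x \int[Q x]_y f y.
Proof.
move=> f0 mf; pose f_ := nnsfun_approx measurableT mf.
have fcvg (nu : {measure set Y -> \bar R}) :
    \int[nu]_y f y = limn (fun n => \int[nu]_y (f_ n y)%:E).
  rewrite -monotone_convergence//.
  - by apply: eq_integral => t _; apply/esym/cvg_lim => //; exact: cvg_nnsfun_approx.
  - by move=> n; exact/measurable_EFinP.
  - by move=> n z _; rewrite lee_fin.
  - by move=> z _ a b ab; rewrite lee_fin; exact/lefP/nd_nnsfun_approx.
have Qm h : (forall y, 0 <= h y) -> measurable_fun setT h ->
    measurable_fun setT (fun x => \int[Q x]_y h y).
  by move=> h0 mh; apply: measurable_fun_integral_kernel => // U mU; exact: measurable_kernel.
rewrite fcvg.
under [RHS]eq_integral do rewrite fcvg.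
rewrite monotone_convergence//; first last.
- move=> x _ a b ab; apply: ge0_le_integral => //.
  + by move=> z _; rewrite lee_fin.
  + exact/measurable_EFinP.
  + exact/measurable_EFinP.
  + by move=> z _; rewrite lee_fin; exact/lefP/nd_nnsfun_approx.
- by move=> n x _; apply: integral_ge0 => z _; rewrite lee_fin.
- by move=> n; apply: Qm; [move=> y; rewrite lee_fin|exact/measurable_EFinP].
apply: congr_lim; apply/funext => n.
rewrite integralT_nnsfun sintegralE.
under [RHS]eq_integral do rewrite integralT_nnsfun sintegralE.
rewrite ge0_integral_fsum//; last 2 first.
  by move=> r; apply: measurable_funeM; exact: measurable_kernel.
  by move=> r x _; exact: nnsfun_mulemu_ge0.
apply: eq_fsbigr => r _.
have [r0|r0] := leP 0%R r.
  by rewrite ge0_integralZl//; exact: (measurable_kernel Q).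
rewrite preimage_nnfun0// measure0 mule0 integral0_eq// => x _.
by rewrite measure0 mule0.
Qed.

End bind.

Section finite_measure_difference.
Local Open Scope ereal_scope.
Context d (T : measurableType d) (R : realType).
Variables m1 m2 : {finite_measure set T -> \bar R}.

(* The maximum with 0 only matters on sets that are not measurable. *)
Definition measure_diff & (forall A, measurable A -> m2 A <= m1 A) :=
  fun A => maxe 0 (m1 A - m2 A).

Hypothesis m21 : forall A, measurable A -> m2 A <= m1 A.

Local Notation diff := (measure_diff m21).

Lemma measure_diffE A : measurable A -> diff A = m1 A - m2 A.
Proof.
move=> mA; rewrite /measure_diff; apply/max_idPr.
by rewrite sube_ge0 ?m21// fin_num_measure ?orbT.
Qed.

Let measure_diff0 : diff set0 = 0.
Proof. by rewrite measure_diffE// !measure0 sube0. Qed.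

Let measure_diff_ge0 A : 0 <= diff A.
Proof. by rewrite /measure_diff le_max lexx. Qed.

Let measure_diff_sigma_additive : semi_sigma_additive diff.
Proof.
(* Sigma-additivity is inherited from the signed measure [m1 - m2], with which [diff] agrees on
   measurable sets. *)
pose nu := cadd (charge_of_finite_measure m1) (copp (charge_of_finite_measure m2)).
move=> F mF tF mUF; rewrite measure_diffE//.
rewrite [X in X @ _](_ : _ = fun n => \sum_(0 <= i < n) nu (F i)).
  exact: (@charge_semi_sigma_additive _ _ _ nu).
by apply/funext => n; apply: eq_bigr => i _; rewrite measure_diffE.
Qed.

HB.instance Definition _ := isMeasure.Build _ _ _ diff
  measure_diff0 measure_diff_ge0 measure_diff_sigma_additive.

Let measure_diff_fin : fin_num_fun diff.
Proof.
by move=> A mA; rewrite measure_diffE// fin_numB !fin_num_measure.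
Qed.

HB.instance Definition _ := @Measure_isFinite.Build _ _ _ diff measure_diff_fin.

Lemma exists_measure_diff : exists m : {finite_measure set T -> \bar R},
  forall A, measurable A -> m A + m2 A = m1 A.
Proof.
exists (measure_diff m21) => A mA /=.
by rewrite measure_diffE// subeK// fin_num_measure.
Qed.

End finite_measure_difference.

(** * Invariant measure of a chain with drift and minorization *)

Section drift_minorization.
Local Open Scope ereal_scope.
Context d (T : measurableType d) (R : realType).
Variables (Q : R.-pker T ~> T) (nu : probability T R) (C : set T) (c : R).
Hypotheses (mC : measurable C) (c0 : (0 < c)%R).
Hypothesis minorization :
  forall x A, C x -> measurable A -> c%:E * nu A <= Q x A.

Let mbind_fin (m : {finite_measure set T -> \bar R}) : fin_num_fun (mbind m Q).
Proof.
move=> A mA; rewrite ge0_fin_numE//.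
apply: (@le_lt_trans _ _ (mbind m Q setT)); first by apply: le_measure; rewrite ?inE.
rewrite /mbind; under eq_integral do rewrite prob_kernel.
by rewrite integral_cst//= mul1e ltey_eq fin_num_measure.
Qed.

(* One step of the chain killed at the times when it regenerates from [nu]. *)
Lemma regeneration_step (m : {finite_measure set T -> \bar R}) :
  exists m' : {finite_measure set T -> \bar R}, forall A, measurable A ->
    m' A + c%:E * m C * nu A = \int[m]_x Q x A.
Proof.
have Cfin : m C \is a fin_num by exact: fin_num_measure.
have cC0 : (0 <= c * fine (m C))%R by rewrite mulr_ge0 ?fine_ge0// ltW.
pose m1 := @Measure_isFinite.Build _ _ _ (mbind m Q) (mbind_fin m).
pose F1 : {finite_measure set T -> \bar R} := HB.pack (mbind m Q) m1.
pose F2 : {finite_measure set T -> \bar R} := mscale (NngNum cC0) nu.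
have F2E A : F2 A = c%:E * m C * nu A.
  by rewrite /F2/= /mscale/= EFinM fineK.
(* This is the minorization integrated over [C] against [m]. *)
have F21 A : measurable A -> F2 A <= F1 A.
  move=> mA; rewrite F2E /F1/= /mbind.
  rewrite muleAC -integral_cst// [leLHS]integral_mkcond.
  apply: ge0_le_integral => //.
  - move=> x _; rewrite patchE; case: ifPn => [_|_]; last exact: lexx.
    by rewrite mule_ge0// lee_fin ltW.
  - by apply/(measurable_restrictT _ _).1 => //; exact: measurable_cst.
  - exact: measurable_kernel.
  - move=> x _; rewrite patchE; case: ifPn => [|_]; last exact: measure_ge0.
    by rewrite in_setE => Cx; exact: minorization.
have [m' m'E] := exists_measure_diff F21.
by exists m' => A mA; rewrite -F2E m'E.
Qed.

Variables (V : T -> R) (eps M : R).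
Hypotheses (V0 : forall x, (0 <= V x)%R) (mV : measurable_fun setT V).
Hypotheses (eps0 : (0 < eps)%R) (M0 : (0 <= M)%R).
(** The penalty is [M] times [Q x C] instead of an indicator of [C] at [x]: this is what a drift
    inequality for a generator becomes once it is integrated in time. *)
Hypothesis drift : forall x,
  \int[Q x]_y (V y)%:E + eps%:E <= (V x)%:E + M%:E * Q x C.
Hypothesis nuV : \int[nu]_x (V x)%:E < +oo.

Section regeneration_series.
Variable kap : nat -> {finite_measure set T -> \bar R}.
Hypothesis kap0 : forall A, measurable A -> kap 0%N A = nu A.
Hypothesis kapS : forall n A, measurable A ->
  kap n.+1 A + c%:E * kap n C * nu A = \int[kap n]_x Q x A.

(** The probability of regenerating at step [n + 1]: [kap n] is the law after [n] steps of the chain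
    started from [nu] and killed when it regenerates, and its mass is the probability of
    survival. *)
Let s n := c%:E * kap n C.

Let s_ge0 n : 0 <= s n.
Proof. by rewrite mule_ge0// lee_fin ltW. Qed.

Let kapT n : kap n.+1 setT + s n = kap n setT.
Proof.
transitivity (\int[kap n]_x Q x setT).
  by rewrite -kapS// probability_setT mule1.
under eq_integral do rewrite prob_kernel.
by rewrite integral_cst// mul1e.
Qed.

Let sum_s n : \sum_(i < n) s i + kap n setT = 1.
Proof.
elim: n => [|n IH]; first by rewrite big_ord0 add0e kap0// probability_setT.
by rewrite big_ord_recr/= -addeA (addeC (s n)) kapT.
Qed.

Let mQV : measurable_fun setT (fun x => \int[Q x]_y (V y)%:E).
Proof.
apply: measurable_fun_integral_kernel => //.
- by move=> U mU; exact: measurable_kernel.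
- exact/measurable_EFinP.
Qed.

(** The drift is integrated against [kap n]. The mass that [Q] sends to [C] is [kap n.+1 C] plus the
    part of the regenerated mass [s n] that [nu] puts on [C]. *)
Let kap_drift n : \int[kap n.+1]_x (V x)%:E + eps%:E * kap n setT <=
  \int[kap n]_x (V x)%:E + M%:E * (kap n.+1 C + s n).
Proof.
have mEV : measurable_fun setT (EFin \o V) by exact/measurable_EFinP.
have EV0 x : setT x -> 0 <= (EFin \o V) x by move=> _; rewrite /= lee_fin.
have cC0 : (0 <= fine (s n))%R by rewrite fine_ge0.
have sfin : s n \is a fin_num by rewrite fin_numM// fin_num_measure.
have le1 : \int[kap n.+1]_x (V x)%:E <= \int[kap n]_x \int[Q x]_y (V y)%:E.
  rewrite -integral_mbind//.
  rewrite [leRHS](_ : _ = \int[measure_add (kap n.+1) (mscale (NngNum cC0) nu)]_y (V y)%:E).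
    by rewrite ge0_integral_measure_add// leeDl// integral_ge0.
  apply: eq_measure_integral => A mA _.
  transitivity (kap n.+1 A + (fine (s n))%:E * nu A); last by rewrite [RHS]measure_addE.
  by rewrite fineK//; exact/esym/kapS.
apply: (@le_trans _ _ (\int[kap n]_x (\int[Q x]_y (V y)%:E + eps%:E))).
  rewrite ge0_integralD//.
  - by rewrite integral_cst// leeD.
  - by move=> x _; apply: integral_ge0 => y _; rewrite lee_fin.
  - by move=> x _; rewrite lee_fin ltW.
apply: (@le_trans _ _ (\int[kap n]_x ((V x)%:E + M%:E * Q x C))).
  apply: ge0_le_integral => //.
  - move=> x _; apply: adde_ge0; last by rewrite lee_fin ltW.
    by apply: integral_ge0 => y _; rewrite lee_fin.
  - exact: emeasurable_funD.
  - by apply: emeasurable_funD => //; apply: measurable_funeM; exact: measurable_kernel.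
rewrite ge0_integralD//; last 2 first.
- by move=> x _; rewrite mule_ge0// lee_fin.
- by apply: measurable_funeM; exact: measurable_kernel.
rewrite leeD2l// ge0_integralZl//; last exact: measurable_kernel.
rewrite lee_wpmul2l ?lee_fin// -kapS// leeD2l//.
have /(lee_wpmul2l (s_ge0 n)) : nu C <= 1 by exact: probability_le1.
by rewrite mule1.
Qed.

(** The drift inequalities telescope; they are kept in additive form because the integrals of [V]
    are extended reals. *)
Let sum_kapT n : \int[kap n]_x (V x)%:E + eps%:E * \sum_(i < n) kap i setT <=
  \int[nu]_x (V x)%:E + M%:E * (\sum_(i < n) (kap i.+1 C + s i)).
Proof.
elim: n => [|n IH].
  rewrite !big_ord0 !mule0 !adde0 (_ : \int[_]_x _ = \int[nu]_x (V x)%:E)//.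
  by apply: eq_measure_integral => A mA _; exact: kap0.
rewrite !big_ord_recr/= !ge0_muleDr ?sume_ge0//; last 2 first.
- by move=> i _; rewrite adde_ge0.
- by rewrite adde_ge0.
rewrite [X in X <= _]addeCA.
apply: le_trans; first by apply: leeD2l; exact: kap_drift.
rewrite addeA [X in _ <= X]addeA -[X in _ <= _ + X]ge0_muleDr//.
by apply: leeD2r; rewrite addeC; exact: IH.
Qed.

Let mu : {measure set T -> \bar R} := mseries kap 0.

Let sum_s_le1 n : \sum_(i < n) s i <= 1.
Proof. by rewrite -(sum_s n) leeDl. Qed.

Let muT_lty : mu setT < +oo.
Proof.
(* The visits to [C] have total mass at most [1 / c], because [c * kap n C] is the regeneration
   probability [s n] and the [s n] sum to at most 1. *)
pose B := \int[nu]_x (V x)%:E + M%:E * (c^-1%:E + 1).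
have B0 : 0 <= \int[nu]_x (V x)%:E by apply: integral_ge0 => x _; rewrite lee_fin.
have Bfin : B \is a fin_num.
  by rewrite fin_numD ge0_fin_numE// nuV.
suff : mu setT <= eps^-1%:E * B.
  by move=> /le_lt_trans; apply; rewrite -(fineK Bfin) -EFinM ltry.
apply: lime_le; first exact: is_cvg_nneseries.
near=> n; rewrite big_mkord -(@lee_pmul2l _ eps%:E)//.
rewrite muleA -EFinM divff ?gt_eqF// mul1e.
apply: le_trans (le_trans (sum_kapT n) _); first by rewrite leeDr//; apply: integral_ge0 => x _; rewrite lee_fin.
rewrite leeD2l// lee_wpmul2l ?lee_fin// big_split/= leeD ?sum_s_le1//.
rewrite -(@lee_pmul2l _ c%:E)// -EFinM divff ?gt_eqF//.
rewrite ge0_sume_distrr//; apply: le_trans (sum_s_le1 n.+1).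
by rewrite big_ord_recl/= leeDr.
Unshelve. all: end_near. Qed.

Let muT_gt0 : 0 < mu setT.
Proof.
apply: (@lt_le_trans _ _ 1) => //.
rewrite /mu/= /mseries nneseries_recl//.
rewrite [X in _ <= X + _](_ : _ = 1); last exact: etrans (kap0 measurableT) (probability_setT _).
rewrite leeDl//.
exact: nneseries_ge0.
Qed.

Let mu_Q A : measurable A ->
  \int[mu]_x Q x A + nu A = mu A + (\sum_(i <oo) s i) * nu A.
Proof.
move=> mA; rewrite ge0_integral_measure_series//; last exact: measurable_kernel.
under eq_eseriesr do rewrite -kapS//.
rewrite nneseriesD//; last by move=> i _ _; apply: mule_ge0 => //; exact: s_ge0.
rewrite addeAC; congr (_ + _).
  rewrite [RHS]nneseries_recl// [RHS]addeC; congr (_ + _); last exact/esym/kap0.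
  by rewrite -(nneseries_addn 1)//; apply: eq_eseriesr => i _; rewrite addn1.
rewrite [RHS]muleC -(@fineK _ (nu A)) ?fin_num_measure// -nneseriesZl//.
by apply: eq_eseriesr => i _; rewrite muleC.
Qed.

Lemma regeneration_invariant : exists mu : probability T R,
  forall A, measurable A -> \int[mu]_x Q x A = mu A.
Proof.
have muTfin : mu setT \is a fin_num by rewrite ge0_fin_numE.
(* For the whole space, [mu_Q] compares total masses; as [mu] is finite they cancel, and
   regeneration is almost sure. *)
have s1 : \sum_(i <oo) s i = 1.
  have := mu_Q measurableT.
  under eq_integral do rewrite prob_kernel.
  rewrite integral_cst// mul1e probability_setT mule1.
  by move=> /(congr1 (fun z => z - mu setT)); rewrite addeAC subee// add0e addeAC subee// add0e.
have muQ A : measurable A -> \int[mu]_x Q x A = mu A.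
  move=> mA; have := mu_Q mA; rewrite s1 mul1e.
  move=> /(congr1 (fun z => z - nu A)); rewrite !addeK// fin_num_measure//.
pose r := (fine (mu setT))^-1%R.
have r0 : (0 <= r)%R by rewrite invr_ge0 fine_ge0.
exists (mnormalize mu nu) => A mA.
have muE B : mnormalize mu nu B = mscale (NngNum r0) mu B.
  by rewrite /mnormalize gt_eqF//= lt_eqF//= muleC.
rewrite (eq_measure_integral (mscale (NngNum r0) mu)).
  rewrite ge0_integral_mscale//; last exact: measurable_kernel.
  by rewrite (muQ A mA); exact/esym/muE.
by move=> B mB _; exact: muE.
Qed.

End regeneration_series.

Theorem drift_minorization_invariant : exists mu : probability T R,
  forall A, measurable A -> \int[mu]_x Q x A = mu A.
Proof.
have [F FP] := choice regeneration_step.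
apply: (@regeneration_invariant (fun n => iter n F nu)) => // n A mA.
exact: FP.
Qed.

End drift_minorization.

(** * Mean value and Taylor estimates in the sup norm *)

Section row_vectors.
Variable R : realType.

Lemma rV_normP n (x : 'rV[R]_n) r : 0 <= r ->
  reflect (forall i, `|x 0 i| <= r) (`|x| <= r).
Proof.
move=> r0; apply: (iffP idP) => [xr i|xr].
  apply: le_trans xr; rewrite [leRHS]mx_normrE.
  by rewrite (@le_bigmax _ _ _ _ (fun ij : 'I_1 * 'I_n => `|x ij.1 ij.2|) (0, i)).
rewrite [leLHS]mx_normrE; apply/bigmax_leP; split => // -[i j] _ /=.
by rewrite (ord1 i).
Qed.

Lemma coord_le_norm n (x : 'rV[R]_n) i : `|x 0 i| <= `|x|.
Proof. by move: i; apply/rV_normP. Qed.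

End row_vectors.

Section directional_derivative.
Variables (R : realType) (d : nat).
Implicit Types (f g : 'rV[R]_d -> R) (x v z : 'rV[R]_d).

Lemma is_derive_line f x v t : derivable f (t *: v + x) v ->
  is_derive t 1 (fun h : R => f (h *: v + x)) ('D_v f (t *: v + x)).
Proof.
move=> df.
have e : (fun h : R => h^-1 *: (f (h *: v + (t *: v + x)) - f (t *: v + x))) =
    (fun h : R => h^-1 *: (f ((h *: 1 + t) *: v + x) - f (t *: v + x))).
  by apply/funext => h; rewrite [h *: 1]mulr1 scalerDl addrA.
apply: DeriveDef; first by rewrite /derivable -e.
by rewrite /derive -e.
Qed.

(** Only the derivative of [f] in the direction [v] is assumed, so the one-variable chain rule is
    applied on the line [h |-> f (h *: v + x)]. *)
Lemma is_derive_comp (phi : R -> R) f x v (a b : R) :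
  is_derive (f x) 1 phi a -> is_derive x v f b ->
  is_derive x v (phi \o f) (a * b).
Proof.
move=> dphi df; have dfl : is_derive (0 : R) 1 (fun h : R => f (h *: v + x)) b.
  have := @is_derive_line f x v 0; rewrite scale0r add0r.
  by case: df => dfx <-; exact.
have dphi' : is_derive (f (0 *: v + x)) 1 phi a by rewrite scale0r add0r.
have dc : derivable (phi \o (fun h : R => f (h *: v + x))) 0 1.
  by apply: ex_derive; exact: is_derive1_comp.
apply: DeriveDef; first by apply/derivable1P; exact: dc.
have := @is_derive1_comp _ phi (fun h : R => f (h *: v + x)) 0 a b dphi' dfl.
case=> _ <-; rewrite /derive.
set g1 := fun h => h^-1 *: _; set g2 := fun h => h^-1 *: _.
suff -> : g1 = g2 by [].
by apply/funext => h; rewrite /g1 /g2 /= addr0 [_%:A]mulr1 scale0r add0r.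
Qed.

Lemma mean_value_line f x v (t : R) :
  (forall y, derivable f y v) ->
  exists2 s, `|s| <= `|t| & f (t *: v + x) - f x = t * 'D_v f (s *: v + x).
Proof.
move=> df; pose g h := f (h *: v + x).
have dg (s : R) : is_derive s (1 : R) g ('D_v f (s *: v + x)) by exact: is_derive_line.
have cg : continuous g.
  by move=> s; apply/differentiable_continuous/derivable1_diffP; exact: ex_derive.
have g0 : f x = g 0 by rewrite /g scale0r add0r.
rewrite g0 -/(g t).
have [t0|t0|->] := ltgtP t 0; last first.
- by exists 0 => //; rewrite subrr mul0r.
- have [c] := MVT t0 (fun s _ => dg s) (continuous_subspaceT cg).
  rewrite in_itv/= => /andP[c0 ct] ->; exists c; last by rewrite subr0 mulrC.
  by rewrite !gtr0_norm// ltW.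
- have [c] := MVT t0 (fun s _ => dg s) (continuous_subspaceT cg).
  rewrite in_itv/= => /andP[c0 ct] E; exists c.
    by rewrite !ltr0_norm// lerN2 ltW.
  by rewrite -opprB E sub0r mulrN opprK mulrC.
Qed.

Local Notation e_ i := (delta_mx 0 i : 'rV[R]_d).

(* The increment is telescoped along the path from x to x + z that moves the
   coordinates one at a time and stays within sup-distance |z| of x. *)
Lemma increment_bound f x z (c : 'I_d -> R) (B : R) : 0 <= B ->
  (forall i y, derivable f y (e_ i)) ->
  (forall i y, `|y - x| <= `|z| -> `|partial i f y - c i| <= B) ->
  `|f (x + z) - f x - \sum_i z 0 i * c i| <= d%:R * B * `|z|.
Proof.
move=> B0 df fB.
pose q k : 'rV[R]_d := \row_j (if (j < k)%N then x 0 j + z 0 j else x 0 j).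
have q0 : q 0%N = x by apply/rowP => j; rewrite mxE.
have qd : q d = x + z by apply/rowP => j; rewrite !mxE ltn_ord.
rewrite -qd -[in f x]q0 -(telescope_sumr (f \o q) (leq0n d)) big_mkord -sumrB.
apply: le_trans (ler_norm_sum _ _ _) _.
have -> : d%:R * B * `|z| = \sum_(i < d) B * `|z|.
  by rewrite sumr_const card_ord -mulrA mulr_natl.
apply: ler_sum => i _ /=.
have qS : q i.+1 = z 0 i *: e_ i + q i.
  apply/rowP => j; rewrite !mxE eqxx/= ltnS -val_eqE/=.
  case: ltngtP => [_|_|/val_inj ->]; rewrite ?mulr0 ?add0r//.
  by rewrite mulr1 addrC.
have [s sz] := mean_value_line (q i) (z 0 i) (df i).
rewrite qS => ->; rewrite -mulrBr normrM mulrC ler_pM//; last exact: coord_le_norm.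
apply: fB; apply/rV_normP => // j; rewrite !mxE eqxx/= -val_eqE/=.
case: ltngtP => [_|_|_].
- by rewrite mulr0 add0r addrAC subrr add0r coord_le_norm.
- by rewrite mulr0 add0r subrr normr0.
- by rewrite mulr1 addrK (le_trans sz)// coord_le_norm.
Qed.

(** [increment_bound] serves twice: for [f], with its gradient at [x] as slopes, and for each
    partial derivative, with slopes 0, which bounds its oscillation. Each use costs a factor [d]. *)
Lemma taylor2 f x z (B : R) : 0 <= B ->
  C2 f ->
  (forall i j y, `|y - x| <= `|z| -> `|partial i (partial j f) y| <= B) ->
  `|f (x + z) - f x - dot (grad f x) z| <= d%:R ^+ 2 * B * `|z| ^+ 2.
Proof.
move=> B0 [[_ f1] f2] fB.
have -> : dot (grad f x) z = \sum_i z 0 i * partial i f x.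
  by apply: eq_bigr => i _; rewrite mxE mulrC.
have -> : d%:R ^+ 2 * B * `|z| ^+ 2 = d%:R * (d%:R * B * `|z|) * `|z| by ring.
apply: increment_bound => //.
- by rewrite !mulr_ge0.
- by move=> i y; case: (f1 i).
move=> j y yx; rewrite -{1}(subrK x y) (addrC (y - x)).
rewrite -[X in `|X|]subr0.
have -> : 0 = \sum_i (y - x) 0 i * 0 :> R by rewrite big1// => i _; rewrite mulr0.
apply: (le_trans (@increment_bound _ x (y - x) (fun=> 0) B B0 _ _)).
- by move=> i w; case: (f2 j) => _ /(_ i)[].
- by move=> i w wx; rewrite subr0; apply: fB; exact: le_trans yx.
- by rewrite ler_wpM2l// mulr_ge0.
Qed.

End directional_derivative.

(** * Algebra of functions of class C2, compact supports *)

Section smooth.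
Variables (R : realType) (d : nat).
Implicit Types (f g : 'rV[R]_d -> R) (x : 'rV[R]_d).

Local Notation e_ i := (delta_mx 0 i : 'rV[R]_d).

Lemma C1_by f (df : 'I_d -> 'rV[R]_d -> R) : continuous f ->
  (forall i x, is_derive x (e_ i) f (df i x)) -> (forall i, continuous (df i)) ->
  C1 f.
Proof.
move=> cf Df cdf; split=> // i; split=> [x|]; first exact: ex_derive.
suff -> : partial i f = df i by [].
by apply/funext => x; rewrite /partial derive_val.
Qed.

Lemma C1_continuous f : C1 f -> continuous f. Proof. by case. Qed.

Lemma C1_is_derive f i x : C1 f -> is_derive x (e_ i) f (partial i f x).
Proof. by case=> _ /(_ i)[/(_ x) df _]; apply: DeriveDef. Qed.

Lemma C1_continuous_partial f i : C1 f -> continuous (partial i f).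
Proof. by case=> _ /(_ i)[]. Qed.

Lemma partial_eq f i (df : 'rV[R]_d -> R) :
  (forall x, is_derive x (e_ i) f (df x)) -> partial i f = df.
Proof. by move=> Df; apply/funext => x; rewrite /partial derive_val. Qed.

Lemma C1_cst (a : R) : C1 (fun _ : 'rV[R]_d => a).
Proof.
by apply: (@C1_by _ (fun _ _ => 0)) => *; exact: cst_continuous.
Qed.

Lemma partialD f g i : C1 f -> C1 g ->
  partial i (fun x => f x + g x) = (fun x => partial i f x + partial i g x).
Proof.
by move=> f1 g1; apply: partial_eq => x; apply: is_deriveD; exact: C1_is_derive.
Qed.

Lemma partialM f g i : C1 f -> C1 g ->
  partial i (fun x => f x * g x) =
  (fun x => f x * partial i g x + g x * partial i f x).
Proof.
by move=> f1 g1; apply: partial_eq => x; apply: is_deriveM; exact: C1_is_derive.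
Qed.

Lemma partial_cst (a : R) i : partial i (fun _ : 'rV[R]_d => a) = (fun=> 0).
Proof. by apply: partial_eq => x; exact: is_derive_cst. Qed.

Lemma partial_comp (phi dphi : R -> R) f i :
  (forall t : R, is_derive t (1 : R) phi (dphi t)) -> C1 f ->
  partial i (fun x => phi (f x)) = (fun x => dphi (f x) * partial i f x).
Proof.
move=> dp f1; apply: partial_eq => x.
by apply: is_derive_comp; exact: C1_is_derive.
Qed.

Lemma C1D f g : C1 f -> C1 g -> C1 (fun x => f x + g x).
Proof.
move=> f1 g1.
apply: (@C1_by _ (fun i x => partial i f x + partial i g x)) => [x|i x|i x].
- by apply: continuousD; exact: C1_continuous.
- by apply: is_deriveD; exact: C1_is_derive.
- by apply: continuousD; exact: C1_continuous_partial.
Qed.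

Lemma C1M f g : C1 f -> C1 g -> C1 (fun x => f x * g x).
Proof.
move=> f1 g1.
apply: (@C1_by _ (fun i x => f x * partial i g x + g x * partial i f x)) => [x|i x|i x].
- by apply: continuousM; exact: C1_continuous.
- by apply: is_deriveM; exact: C1_is_derive.
- apply: (@continuousD _ _ _ (fun x => f x * partial i g x) (fun x => g x * partial i f x));
    apply: continuousM; by [exact: C1_continuous|exact: C1_continuous_partial].
Qed.

Lemma C1_comp (phi dphi : R -> R) f :
  (forall t : R, is_derive t (1 : R) phi (dphi t)) -> continuous dphi -> C1 f ->
  C1 (fun x => phi (f x)).
Proof.
move=> dp cdp f1.
apply: (@C1_by _ (fun i x => dphi (f x) * partial i f x)) => [x|i x|i x].
- apply: (@continuous_comp _ _ _ f phi); first exact: C1_continuous.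
  by apply/differentiable_continuous/derivable1_diffP; exact: ex_derive.
- by apply: is_derive_comp; exact: C1_is_derive.
- apply: (@continuousM _ _ (fun x => dphi (f x))); last exact: C1_continuous_partial.
  by apply: (@continuous_comp _ _ _ f dphi); [exact: C1_continuous|exact: cdp].
Qed.

Lemma C2_cst (a : R) : C2 (fun _ : 'rV[R]_d => a).
Proof. by split=> [|i]; rewrite ?partial_cst; exact: C1_cst. Qed.

Lemma C2D f g : C2 f -> C2 g -> C2 (fun x => f x + g x).
Proof.
by move=> [f1 f2] [g1 g2]; split=> [|i]; rewrite ?partialD//; exact: C1D.
Qed.

Lemma C2M f g : C2 f -> C2 g -> C2 (fun x => f x * g x).
Proof.
move=> [f1 f2] [g1 g2]; split=> [|i]; first exact: C1M.
by rewrite partialM//; apply: C1D; exact: C1M.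
Qed.

Lemma C2_comp (phi dphi ddphi : R -> R) f :
  (forall t : R, is_derive t (1 : R) phi (dphi t)) ->
  (forall t : R, is_derive t (1 : R) dphi (ddphi t)) -> continuous ddphi -> C2 f ->
  C2 (fun x => phi (f x)).
Proof.
move=> dp ddp cdd [f1 f2].
have cdp : continuous dphi.
  by move=> t; apply/differentiable_continuous/derivable1_diffP; exact: ex_derive.
split=> [|i]; first exact: C1_comp dp cdp f1.
by rewrite (partial_comp i dp f1); apply: C1M => //; exact: C1_comp ddp cdd f1.
Qed.

Lemma C2_coord i : C2 (fun x : 'rV[R]_d => x 0 i).
Proof.
have dc j x : is_derive x (e_ j) (fun x : 'rV[R]_d => x 0 i) ((i == j)%:R).
  have lin : (fun h : R => h^-1 *: ((h *: e_ j + x) 0 i - x 0 i)) @ (0 : R)^' --> ((i == j)%:R : R).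
    apply: cvg_near_cst; near=> h.
    rewrite !mxE eqxx/= addrK [_ *: _]mulrA mulVf ?mul1r//.
    by near: h; exact: nbhs_dnbhs_neq.
  by apply: DeriveDef; [apply: cvgP; exact: lin|apply: cvg_lim => //; exact: lin].
have pc j : partial j (fun x : 'rV[R]_d => x 0 i) = (fun=> (i == j)%:R) by exact: partial_eq.
split; last by move=> j; rewrite pc; exact: C1_cst.
by apply: (C1_by _ (fun j x => dc j x)) => *; [exact: coord_continuous|exact: cst_continuous].
Unshelve. all: end_near. Qed.

Lemma C2N f : C2 f -> C2 (fun x => - f x).
Proof.
move=> f2; have -> : (fun x => - f x) = (fun x => -1 * f x) by apply/funext => x; rewrite mulN1r.
exact: (C2M (C2_cst (-1)) f2).
Qed.

Lemma C2X f n : C2 f -> C2 (fun x => f x ^+ n).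
Proof.
move=> f2; elim: n => [|n IH]; first exact: C2_cst.
have -> : (fun x => f x ^+ n.+1) = (fun x => f x * f x ^+ n) by apply/funext => x; rewrite exprS.
exact: (C2M f2 IH).
Qed.

Lemma C2_prod (I : Type) (s : seq I) (F : I -> 'rV[R]_d -> R) :
  (forall i, C2 (F i)) -> C2 (fun x => \prod_(i <- s) F i x).
Proof.
move=> F2; elim: s => [|i s IH].
  have -> : (fun x => \prod_(i <- [::]) F i x) = fun=> 1 by apply/funext => x; rewrite big_nil.
  exact: C2_cst.
have -> : (fun x => \prod_(i <- i :: s) F i x) = (fun x => F i x * \prod_(i <- s) F i x).
  by apply/funext => x; rewrite big_cons.
exact: (C2M (F2 i) IH).
Qed.

Lemma near_eq_partial f g i x : (\near x, f x = g x) -> partial i f x = partial i g x.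
Proof. by move=> fg; apply: near_eq_derive. Qed.

End smooth.

Section bounded_derivatives.
Variables (R : realType) (d : nat).
Implicit Types f : 'rV[R]_d -> R.

Lemma compact_norm_le (r : R) : compact [set x : 'rV[R]_d | `|x| <= r].
Proof.
apply: bounded_closed_compact.
  by exists r; split; [exact: num_real|move=> s rs x /= xr; exact: le_trans xr (ltW rs)].
have -> : [set x : 'rV[R]_d | `|x| <= r] = (fun x : 'rV[R]_d => `|x|) @^-1` [set s | s <= r] by [].
by apply: closed_comp => [x _|]; [exact: norm_continuous|exact: closed_le].
Qed.

Lemma continuous_bounded_ball f (r : R) : continuous f ->
  exists2 M, 0 <= M & forall x, `|x| <= r -> `|f x| <= M.
Proof.
move=> cf; have [r0|r0] := ltP r 0.
  by exists 0 => // x; rewrite leNgt (lt_le_trans r0).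
have cnf : {within [set x : 'rV[R]_d | `|x| <= r], continuous (fun x => `|f x|)}.
  by apply: continuous_subspaceT => x; apply: (continuous_comp (cf x)); exact: norm_continuous.
have [|c cr fc] := EVT_max_rV _ (@compact_norm_le r) cnf.
  by exists 0; rewrite /= normr0.
by exists `|f c| => // x xr; apply: fc; rewrite inE.
Qed.

Lemma continuous_bounded_support f r : continuous f ->
  (forall x, r < `|x| -> f x = 0) -> bounded_func f.
Proof.
move=> cf f0; have [M M0 fM] := continuous_bounded_ball r cf.
by exists M => x; have [/fM//|/f0->] := leP `|x| r; rewrite normr0.
Qed.

(** The complement of a closed ball is open, so [f] is 0 near each of its points. *)
Lemma partial_support f i r : (forall x, r < `|x| -> f x = 0) ->
  forall x, r < `|x| -> partial i f x = 0.
Proof.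
move=> f0 x xr; have <- := congr1 (@^~ x) (@partial_cst R d 0 i); apply: near_eq_partial.
have oN : open [set y : 'rV[R]_d | r < `|y|].
  have -> : [set y : 'rV[R]_d | r < `|y|] = (fun x : 'rV[R]_d => `|x|) @^-1` [set s | r < s] by [].
  by apply: open_comp => [y _|]; [exact: norm_continuous|exact: open_gt].
near=> y; apply: f0; near: y.
exact: (open_nbhs_nbhs (conj oN xr)).
Unshelve. all: end_near. Qed.

Lemma C2_support_C2b f r : C2 f -> (forall x, r < `|x| -> f x = 0) -> C2b f.
Proof.
move=> f2 f0; have [f1 pf1] := f2; split=> // [|i|i j].
- by apply: continuous_bounded_support f0; exact: C1_continuous.
- apply: (continuous_bounded_support (r := r)); first exact: C1_continuous_partial.
  exact: partial_support.
- apply: (continuous_bounded_support (r := r)); first exact: C1_continuous_partial.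
  by apply: partial_support; exact: partial_support.
Qed.

End bounded_derivatives.

(** * Cutoff functions of class C2 *)

Section cubic_bump.
Variable R : realType.
Implicit Types t : R.

Definition pospart t : R := Num.max t 0.

Lemma pospart_continuous : continuous pospart.
Proof. by move=> t; apply: (@continuous_max _ _ id (fun=> 0)) => //; exact: cst_continuous. Qed.

Lemma pospart_id t : 0 <= t -> pospart t = t.
Proof. by move=> t0; rewrite /pospart; apply/max_idPl. Qed.

Lemma pospart_eq0 t : t <= 0 -> pospart t = 0.
Proof. by move=> t0; rewrite /pospart; apply/max_idPr. Qed.

Lemma pospart_ge0 t : 0 <= pospart t.
Proof. by rewrite /pospart le_max lexx orbT. Qed.

(** With an exponent of at least 2, the difference quotient at the junction 0 is
    [pospart h ^+ n.+1], which tends to 0. *)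
Lemma is_derive_pospartX n t :
  is_derive t (1 : R) (fun t => pospart t ^+ n.+2) (n.+2%:R * pospart t ^+ n.+1).
Proof.
have [t0|t0|->] := ltgtP t 0.
- rewrite pospart_eq0 ?ltW// expr0n/= mulr0.
  apply: (@near_eq_is_derive _ _ _ (cst 0)).
    by near=> s; rewrite pospart_eq0 ?expr0n//= ltW//; near: s; exact: lt_nbhsl.
- rewrite pospart_id ?ltW//.
  have dX : is_derive t (1 : R) (fun s : R => s ^+ n.+2) (n.+2%:R * t ^+ n.+1).
    have e : (fun s : R => s ^+ n.+2) = (id : R -> R) ^+ n.+2 by rewrite exprfctE.
    by rewrite e; apply: is_derive_eq; rewrite [_ *: _]mulr1.
  apply: near_eq_is_derive dX.
  by near=> s; rewrite pospart_id// ltW//; near: s; exact: lt_nbhsr.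
- rewrite pospart_eq0// expr0n/= mulr0.
  have lim0 : (fun h : R => h^-1 *: (pospart (h *: 1 + 0) ^+ n.+2 - pospart 0 ^+ n.+2)) @ (0 : R)^' --> (0 : R).
    have : (fun h => pospart h ^+ n.+1) @ (0 : R)^' --> (0 : R).
      have p0 : pospart 0 ^+ n.+1 = 0 by rewrite pospart_eq0// expr0n.
      have c : (fun h => pospart h ^+ n.+1) @ (0 : R) --> pospart 0 ^+ n.+1.
        apply: (@continuous_comp _ _ _ pospart (fun s => s ^+ n.+1)).
          exact: pospart_continuous.
        exact: exprn_continuous.
      by rewrite p0 in c; exact: cvg_within_filter c.
    apply: cvg_trans; apply: near_eq_cvg; near=> h.
    have h0 : h != 0 by near: h; exact: nbhs_dnbhs_neq.
    rewrite [h *: 1]mulr1 addr0 (pospart_eq0 (lexx 0)) expr0n/= subr0 [_ *: _]mulrC.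
    have [hn|hp|h00] := ltgtP h 0; last by rewrite h00 eqxx in h0.
    + by rewrite (pospart_eq0 (ltW hn)) !expr0n/= mul0r.
    + by rewrite pospart_id ?ltW// [in RHS]exprSr -mulrA mulfV// mulr1.
  by apply: DeriveDef; [apply: cvgP; exact: lim0|apply: cvg_lim => //; exact: lim0].
Unshelve. all: end_near. Qed.

(** The cube is the lowest integer power of the positive part that is of class C2; the outer cube
    makes the junction at 1 as smooth as the one at 0. *)
Definition smoothstep t := 1 - pospart (1 - pospart t ^+ 3) ^+ 3.

Lemma C2_pospart3 d (f : 'rV[R]_d -> R) : C2 f -> C2 (fun x => pospart (f x) ^+ 3).
Proof.
move=> f2; apply: (C2_comp (is_derive_pospartX 1) _ _ f2 (ddphi := fun t => 3 * (2 * pospart t))).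
  move=> t; have := is_derive_pospartX 0 t.
  by move=> H; apply: is_deriveZ; rewrite -[pospart t]expr1.
move=> t; apply: cvgM; first exact: cvg_cst.
by apply: cvgM; [exact: cvg_cst|exact: pospart_continuous].
Qed.

Lemma C2_smoothstep d (f : 'rV[R]_d -> R) : C2 f -> C2 (fun x => smoothstep (f x)).
Proof.
move=> f2; apply: C2D; first exact: C2_cst.
apply/C2N/C2_pospart3/C2D; first exact: C2_cst.
exact/C2N/C2_pospart3.
Qed.

Lemma smoothstep_itv t : 0 <= smoothstep t <= 1.
Proof.
rewrite /smoothstep subr_ge0 gerBl exprn_ge0 ?pospart_ge0// andbT.
rewrite exprn_ile1 ?pospart_ge0// /pospart ge_max ler01 gerBl andbT.
by rewrite exprn_ge0// pospart_ge0.
Qed.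

Lemma smoothstep_eq0 t : t <= 0 -> smoothstep t = 0.
Proof.
by move=> t0; rewrite /smoothstep (pospart_eq0 t0) expr0n/= subr0 pospart_id// expr1n subrr.
Qed.

Lemma smoothstep_eq1 t : 1 <= t -> smoothstep t = 1.
Proof.
move=> t1; rewrite /smoothstep (@pospart_eq0 (1 - _)) ?expr0n ?subr0//.
rewrite subr_le0 pospart_id ?exprn_ege1//.
exact: le_trans t1.
Qed.

Lemma smoothstep_gt0 t : 0 < t -> 0 < smoothstep t.
Proof.
move=> t0; rewrite /smoothstep subr_gt0 exprn_ilt1 ?pospart_ge0//.
by rewrite /pospart gt_max ltr01 gtrBl exprn_gt0// lt_max t0.
Qed.

Variable d : nat.
Implicit Types (a x : 'rV[R]_d) (r : R).

(** A product over the coordinates suits the sup norm, whose balls are cubes. The transition from 1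
    to 0 has width 1; for small radii what matters is positivity inside the cube. *)
Definition bump a r x : R :=
  \prod_i (smoothstep (r - (x 0 i - a 0 i)) * smoothstep (r + (x 0 i - a 0 i))).

Lemma C2_bump a r : C2 (bump a r).
Proof.
apply: C2_prod => i.
have C2c : C2 (fun x : 'rV[R]_d => x 0 i - a 0 i).
  by apply: C2D; [exact: C2_coord|exact: C2_cst].
exact: (C2M (C2_smoothstep (C2D (C2_cst d r) (C2N C2c)))
            (C2_smoothstep (C2D (C2_cst d r) C2c))).
Qed.

Lemma bump_itv a r x : 0 <= bump a r x <= 1.
Proof.
have h i : 0 <= smoothstep (r - (x 0 i - a 0 i)) * smoothstep (r + (x 0 i - a 0 i)) <= 1.
  have /andP[u0 u1] := smoothstep_itv (r - (x 0 i - a 0 i)).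
  have /andP[v0 v1] := smoothstep_itv (r + (x 0 i - a 0 i)).
  by rewrite mulr_ge0//= mulr_ile1.
apply/andP; split; first by apply: prodr_ge0 => i _; case/andP: (h i).
by apply: prodr_ile1 => i _; exact: h.
Qed.

Lemma bump_ge0 a r x : 0 <= bump a r x. Proof. by case/andP: (bump_itv a r x). Qed.

Lemma bump_le1 a r x : bump a r x <= 1. Proof. by case/andP: (bump_itv a r x). Qed.

Lemma bump_eq0 a r x : 0 < r -> r <= `|x - a| -> bump a r x = 0.
Proof.
move=> r0 rx; have [i ri] : exists i, r <= `|(x - a) 0 i|.
  apply: contrapT => /forallNP h; suff : `|x - a| < r by rewrite ltNge rx.
  (* In dimension 0 there is no coordinate to pick, but the norm is then 0. *)
  have [d0|d0] := posnP d.
    have -> : x - a = 0 by apply/rowP => -[m md]; exfalso; rewrite d0 in md.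
    by rewrite normr0.
  rewrite [ltLHS]mx_normrE; apply/bigmax_ltP; split=> // -[i j] _ /=.
  by rewrite (ord1 i) ltNge; apply/negP; exact: h.
rewrite /bump (bigD1 i)//=; move: ri; rewrite !mxE ler_normr => /orP[ri|ri].
  by rewrite smoothstep_eq0 ?mul0r// subr_le0.
by rewrite (@smoothstep_eq0 (r + (x 0 i - a 0 i))) ?mulr0 ?mul0r//; lra.
Qed.

Lemma bump_eq1 a r x : `|x - a| + 1 <= r -> bump a r x = 1.
Proof.
move=> xr; apply: big1 => i _; have := coord_le_norm (x - a) i; rewrite !mxE ler_norml => /andP[h1 h2].
by rewrite !smoothstep_eq1 ?mulr1//; lra.
Qed.

Lemma bump_gt0 a r x : `|x - a| < r -> 0 < bump a r x.
Proof.
move=> xr; apply: prodr_gt0 => i _; have := coord_le_norm (x - a) i; rewrite !mxE ler_norml => /andP[h1 h2].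
by rewrite mulr_gt0 ?smoothstep_gt0//; lra.
Qed.

End cubic_bump.

(** * Regularity of finite Borel measures *)

Section borel_rV.
Variables (R : realType) (d : nat).
Implicit Types (A O F : set 'rV[R]_d).

Lemma open_measurable_rV O : open O -> measurable O.
Proof. by move=> oO; exact: sub_sigma_algebra. Qed.

Lemma closed_measurable_rV F : closed F -> measurable F.
Proof.
by move=> cF; have := measurableC (open_measurable_rV (closed_openC cF)); rewrite setCK.
Qed.

Lemma continuous_measurable_rV (f : 'rV[R]_d -> R) : continuous f -> measurable_fun setT f.
Proof.
move=> cf; apply: (measurability (@RGenOpens.G R)); first exact: RGenOpens.measurableE.
move=> _ [_ [a [b ->]] <-]; rewrite setTI; apply: open_measurable_rV.
by apply: open_comp => [x _|]; [exact: cf|exact: interval_open].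
Qed.

Lemma open_norm_lt (a : 'rV[R]_d) (r : R) : open [set x : 'rV[R]_d | `|x - a| < r].
Proof.
have -> : [set x : 'rV[R]_d | `|x - a| < r] = (fun x => `|x - a|) @^-1` [set s | s < r] by [].
apply: open_comp => [x _|]; last exact: open_lt.
apply: (@continuous_comp _ _ _ (fun x => x - a) (fun x => `|x|)); last exact: norm_continuous.
by apply: continuousB => //; exact: cst_continuous.
Qed.

Section outer_regularity.
Local Open Scope ereal_scope.
Variable mu : {finite_measure set 'rV[R]_d -> \bar R}.

(** Approximation from both sides, unlike outer approximation alone, passes to complements; the
    regular sets then form a sigma-algebra containing the open sets. *)
Definition regular_set A := forall e : R, (0 < e)%R -> exists F O,
  [/\ closed F, open O, F `<=` A, A `<=` O & mu (O `\` F) < e%:E].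

Let open_regular O : open O -> regular_set O.
Proof.
move=> oO e e0.
(* [F n] consists of the points at distance at least [1 / (n + 1)] from the complement of [O]. *)
pose F n := [set x : 'rV[R]_d | forall y, (`|y - x| < n.+1%:R^-1)%R -> O y].
have cF n : closed (F n).
  have -> : F n = ~` (\bigcup_(y in ~` O) [set x | (`|x - y| < n.+1%:R^-1)%R]).
    apply/seteqP; split=> [x Fx [y Oy yx]|x /= Fx y yx].
      by apply/Oy/Fx; rewrite distrC.
    by apply: contrapT => Oy; apply: Fx; exists y => //=; rewrite distrC.
  by apply/open_closedC/bigcup_open => y _; exact: open_norm_lt.
have ndF m n : (m <= n)%N -> F m `<=` F n.
  move=> mn x Fx y yx; apply: Fx; apply: lt_le_trans yx _.
  by rewrite lef_pV2 ?posrE// ler_nat.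
have FO n : F n `<=` O by move=> x; apply; rewrite subrr normr0.
have muOF : \bigcap_n (O `\` F n) = set0.
  apply/seteqP; split=> // x Fx; have [Ox _] := Fx 0%N I.
  have /nbhs_ballP[r /= r0 rO] := open_nbhs_nbhs (conj oO Ox).
  have [n _ nr] := near_infty_natSinv_lt (PosNum r0).
  have [_] := Fx n I; apply => y yx; apply: rO; rewrite mx_norm_ball /ball_/= distrC.
  by apply: lt_trans yx _; exact: (nr n (leqnn n)).
have mF n : measurable (O `\` F n).
  by apply: measurableD; [exact: open_measurable_rV|exact: closed_measurable_rV].
have : mu (O `\` F n) @[n --> \oo] --> 0.
  rewrite -(measure0 mu) -muOF; apply: nonincreasing_cvg_mu => //.
  - by rewrite ltey_eq fin_num_measure.
  - by rewrite muOF.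
  - by move=> m n mn; apply/subsetPset => x [Ox Fx]; split=> // /(ndF _ _ mn).
move=> /fine_cvgP[_ /cvgrPdist_lt/(_ _ e0)[n _ /(_ n (leqnn n))]].
rewrite sub0r normrN /= ger0_norm ?fine_ge0// => lte.
exists (F n), O; split=> //.
by rewrite -(@fineK _ (mu _)) ?fin_num_measure// lte_fin.
Qed.

Let setC_regular A : regular_set A -> regular_set (~` A).
Proof.
move=> rA e e0; have [F [U [cF oU FA AU muUF]]] := rA e e0.
exists (~` U), (~` F); split.
- exact: open_closedC.
- exact: closed_openC.
- exact: subsetC.
- exact: subsetC.
- by rewrite setDE setCK setIC -setDE.
Qed.

Let bigcup_regular (A : (set 'rV[R]_d)^nat) :
  (forall n, regular_set (A n)) -> regular_set (\bigcup_n A n).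
Proof.
move=> rA e e0.
(* One half of [e] is shared geometrically among the sets [A n]; the other half pays for replacing
   the union of the closed sets, which may fail to be closed, by a finite union. *)
have e2 n : (0 < e / 2 / (2 ^ n.+1)%:R)%R by rewrite !divr_gt0 ?ltr0n ?expn_gt0.
have /choice[FO hFO] n : exists p : set 'rV[R]_d * set 'rV[R]_d,
    [/\ closed p.1, open p.2, p.1 `<=` A n, A n `<=` p.2 &
        mu (p.2 `\` p.1) < (e / 2 / (2 ^ n.+1)%:R)%:E].
  by have [F [U H]] := rA n _ (e2 n); exists (F, U).
pose F n := (FO n).1; pose O n := (FO n).2.
have cF n : closed (F n) by case: (hFO n).
have oO n : open (O n) by case: (hFO n).
have mF n : measurable (F n) by exact: closed_measurable_rV.
have mO n : measurable (O n) by exact: open_measurable_rV.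
pose G N := \big[setU/set0]_(n < N) F n.
have mG N : measurable (G N) by exact: bigsetU_measurable.
have mUO : measurable (\bigcup_n O n) by exact: bigcupT_measurable.
have mUF : measurable (\bigcup_n F n) by exact: bigcupT_measurable.
have le1 : mu (\bigcup_n O n `\` \bigcup_n F n) <= (e / 2)%:E.
  apply: (@le_trans _ _ (\sum_(0 <= n <oo) mu (O n `\` F n))).
    apply: measure_sigma_subadditive => //.
    - by move=> n; exact: measurableD.
    - exact: measurableD.
    - by move=> x [[n _ Ox] Fx]; exists n => //; split=> // Fnx; apply: Fx; exists n.
  apply: (@le_trans _ _ (\sum_(0 <= n <oo) (e / 2 / (2 ^ n.+1)%:R)%:E)).
    by apply: lee_nneseries => // n _; case: (hFO n) => _ _ _ _ /ltW.
  by apply: (epsilon_trick0 xpredT); rewrite divr_ge0// ltW.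
have mD2 : measurable (\bigcup_n O n `\` \bigcup_n F n) by exact: measurableD.
have : mu (\bigcup_n O n `\` G N) @[N --> \oo] -->
    (fine (mu (\bigcup_n O n `\` \bigcup_n F n)))%:E.
  rewrite fineK ?fin_num_measure//.
  have -> : \bigcup_n O n `\` \bigcup_n F n = \bigcap_N (\bigcup_n O n `\` G N).
    apply/seteqP; split=> [x [Ox Fx] N _|x Gx].
      by split=> //; rewrite /G -bigcup_mkord => -[n _ Fnx]; apply: Fx; exists n.
    split; first by case: (Gx 0%N I).
    move=> [n _ Fnx]; have [_] := Gx n.+1 I; apply.
    by rewrite /G -bigcup_mkord; exists n => /=.
  apply: nonincreasing_cvg_mu => //.
  - by rewrite ltey_eq fin_num_measure//; exact: measurableD.
  - by move=> N; exact: measurableD.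
  - by apply: bigcapT_measurable => N; exact: measurableD.
  - move=> m n mn; apply/subsetPset => x [Ox Gx]; split=> //; apply: contra_not Gx.
    by rewrite /G -!bigcup_mkord => -[k /= km Fx]; exists k => //=; exact: leq_trans mn.
move=> /fine_cvgP[_ /cvgrPdist_lt/(_ (e / 2)%R)].
rewrite divr_gt0// => /(_ isT)[N _ /(_ N (leqnn N))] lte.
exists (G N), (\bigcup_n O n); split.
- by rewrite /G -bigcup_mkord; apply: closed_bigcup => //; exact: finite_II.
- by apply: bigcup_open => n _.
- rewrite /G -bigcup_mkord => x [n _ Fx]; exists n => //.
  by case: (hFO n) => _ _ FA _ _; exact: FA.
- by move=> x [n _ Ax]; exists n => //; case: (hFO n) => _ _ _ AO _; exact: AO.
- have mD1 : measurable (\bigcup_n O n `\` G N) by exact: measurableD.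
  rewrite -(@fineK _ (mu _)) ?fin_num_measure// lte_fin.
  move: le1 lte; rewrite -(@fineK _ (mu (_ `\` \bigcup_n F n))) ?fin_num_measure// lee_fin.
  by move=> le1; rewrite /= ltr_distlC => /andP[_]; lra.
Qed.

Lemma measurable_regular A : measurable A -> regular_set A.
Proof.
apply: (smallest_sub _ open_regular); split.
- by apply: open_regular; exact: open0.
- by move=> B rB; rewrite setTD; exact: setC_regular.
- exact: bigcup_regular.
Qed.

Lemma outer_regular A (e : R) : measurable A -> (0 < e)%R -> exists O,
  [/\ open O, A `<=` O & mu O <= mu A + e%:E].
Proof.
move=> mA e0; have [F [U [cF oU FA AU muUF]]] := measurable_regular mA e0.
exists U; split=> //; have mU := open_measurable_rV oU; have mF := closed_measurable_rV cF.
rewrite -(setDUK (subset_trans FA AU)) measureU//; last 2 first.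
- exact: measurableD.
- by apply/seteqP; split=> // x [Fx [_ /(_ Fx)]].
apply: leeD; last exact: ltW.
by apply: le_measure; rewrite ?inE.
Qed.

End outer_regularity.
End borel_rV.

(** * Translation invariance of Lebesgue measure *)

Section lebesgue_translation.
Local Open Scope ereal_scope.
Variable R : realType.

Lemma lebesgue_measure_translation (a : R) (A : set R) : measurable A ->
  pushforward lebesgue_measure ((fun x => a + x)%R : _ -> measurableTypeR R) A =
  lebesgue_measure A.
Proof.
move=> mA; apply/esym/lebesgue_measure_unique => //=; first exact: measurable_funD.
move=> ? _ [[b c]] _ <-.
have e : (fun x => a + x)%R @^-1` `]b, c]%classic = `](b - a)%R, (c - a)%R]%classic.
  by apply/seteqP; split=> x /=; rewrite !in_itv/= ltrBlDl lerBrDl.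
rewrite /pushforward e.
rewrite !lebesgue_measure_itv/= !lte_fin ltrD2r; case: ifPn => // _.
by rewrite -!EFinD; congr (_%:E); ring.
Qed.

Lemma ge0_integral_translation (a : R) (f : R -> \bar R) :
  (forall x, 0 <= f x) -> measurable_fun setT f ->
  \int[lebesgue_measure]_x f (a + x)%R = \int[lebesgue_measure]_x f x.
Proof.
move=> f0 mf.
have ma : measurable_fun setT ((fun x => a + x)%R : measurableTypeR R -> measurableTypeR R).
  exact: measurable_funD.
transitivity (\int[pushforward lebesgue_measure
    ((fun x => a + x)%R : measurableTypeR R -> measurableTypeR R)]_x f x).
  by rewrite ge0_integral_pushforward.
apply: eq_measure_integral => A mA _.
exact: lebesgue_measure_translation.
Qed.

Lemma measurable_addl_rV d (a : 'rV[R]_d) :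
  measurable_fun setT (fun z : 'rV[R]_d => a + z)%R.
Proof.
apply: measurable_rV => i; under eq_fun do rewrite mxE.
by apply: measurable_funD => //; exact: measurable_coord.
Qed.

(** By induction on the dimension: through [rV_cons], Tonelli's theorem separates the first
    coordinate from the others, and a translation acts on each of them. *)
Lemma ge0_integral_translation_rV d (a : 'rV[R]_d) (f : 'rV[R]_d -> \bar R) :
  (forall x, 0 <= f x) -> measurable_fun setT f ->
  \int[lebesgue_rV R d]_z f (a + z)%R = \int[lebesgue_rV R d]_z f z.
Proof.
elim: d a f => [|d IH] a f f0 mf.
  by congr (integral _ _ _); apply/funext => z; congr f; apply/rowP => -[].
have mc : measurable_fun setT (f \o @rV_cons R d).
  by apply: (measurableT_comp mf); exact: measurable_rV_cons.
have int_cons (g : 'rV[R]_d.+1 -> \bar R) : (forall x, 0 <= g x) -> measurable_fun setT g ->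
    \int[lebesgue_rV R d.+1]_z g z =
    \int[lebesgue_measure]_t \int[lebesgue_rV R d]_z g (rV_cons (t, z)).
  move=> g0 mg; rewrite /= ge0_integral_pushforward//; last exact: measurable_rV_cons.
  rewrite preimage_setT fubini_tonelli1//; last by move=> p; exact: g0.
  by apply: (measurableT_comp mg); exact: measurable_rV_cons.
pose a0 := (a 0 ord0)%R; pose a' : 'rV[R]_d := (\row_j a 0 (lift ord0 j))%R.
have consD t z : (a + rV_cons (t, z) = rV_cons ((a0 + t)%R, (a' + z)%R))%R.
  apply/rowP => i; rewrite !mxE; case: unliftP => [j ->|->] //=.
  by rewrite !mxE.
rewrite (int_cons f)// (int_cons (fun z => f (a + z)%R))//; last first.
  by apply: (measurableT_comp mf); exact: measurable_addl_rV.
under eq_integral do under eq_integral do rewrite consD.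
transitivity (\int[lebesgue_measure]_t \int[lebesgue_rV R d]_z f (rV_cons ((a0 + t)%R, z))).
  apply: eq_integral => t _.
  apply: (IH a' (fun z => f (rV_cons ((a0 + t)%R, z)))) => //.
  exact: (measurableT_comp mc (pair1_measurable _)).
apply: (@ge0_integral_translation a0 (fun t => \int[lebesgue_rV R d]_z f (rV_cons (t, z)))).
  by move=> t; exact: integral_ge0.
by apply: (@measurable_fun_fubini_tonelli_F _ _ _ _ _ _ (f \o @rV_cons R d)) => // p; exact: f0.
Qed.

End lebesgue_translation.

(** * Smooth approximation of open sets, comparison of measures *)

Lemma fatou_bound d (T : measurableType d) (R : realType) (m : {measure set T -> \bar R})
    (f : (T -> \bar R)^nat) (g : T -> \bar R) (B : \bar R) :
  (forall n, measurable_fun setT (f n)) -> (forall n x, (0 <= f n x)%E) ->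
  (forall x, f ^~ x @ \oo --> g x) ->
  (forall n, (\int[m]_x f n x <= B)%E) -> (\int[m]_x g x <= B)%E.
Proof.
move=> mf f0 fg fB.
rewrite (eq_integral (fun x => limn_einf (f ^~ x))); last first.
  by move=> x _; have [-> _] := cvg_limn_einf_sup (fg x).
apply: le_trans (fatou _ _ _ _) _ => //.
rewrite limn_einf_lim; apply: lime_le; first exact: is_cvg_einfs.
near=> n; apply: le_trans (fB n); apply: ereal_inf_lbound.
by exists n => /=.
Unshelve. all: end_near. Qed.

Section open_smooth_approximation.
Variables (R : realType) (d : nat) (O : set 'rV[R]_d).
Hypothesis oO : open O.

Let center (p : 'rV[rat]_d * rat) : 'rV[R]_d := map_mx ratr p.1.

Let rad (p : 'rV[rat]_d * rat) : R := ratr p.2.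

Let inner p := 0 < rad p /\ forall y, `|y - center p| < rad p -> O y.

(** The bumps of the rational cubes inside [O], enumerated by their codes; any other code gives the
    function 0. *)
Let h n : 'rV[R]_d -> R := if unpickle n is Some p then
  if `[< inner p >] then bump (center p) (rad p) else fun=> 0 else fun=> 0.

Let C2_h n : C2 (h n).
Proof.
rewrite /h; case: unpickle => [p|]; last exact: C2_cst.
by case: ifPn => _; [exact: C2_bump|exact: C2_cst].
Qed.

Let h_itv n x : 0 <= h n x <= 1.
Proof.
rewrite /h; case: unpickle => [p|]; last by rewrite lexx ler01.
by case: ifPn => _; [exact: bump_itv|rewrite lexx ler01].
Qed.

Let h_out n x : ~ O x -> h n x = 0.
Proof.
rewrite /h; case: unpickle => [p|//]; case: ifPn => // /asboolP[r0 pO] Ox.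
by apply: bump_eq0 => //; rewrite leNgt; apply/negP => /pO.
Qed.

Let h_in x : O x -> exists n, 0 < h n x.
Proof.
move=> Ox; have /nbhs_ballP[e /= e0 eO] := open_nbhs_nbhs (conj oO Ox).
have /rat_in_itvoo[q] : 0 < e / 2 by rewrite divr_gt0.
rewrite in_itv/= => /andP[q0 qe].
have c_ (i : 'I_d) : {a : rat | `|x 0 i - ratr a| < ratr q :> R}.
  have /rat_in_itvoo/cid[a] : x 0 i - ratr q < x 0 i + ratr q by rewrite ltrD2l gtrN.
  by rewrite in_itv/= => xa; exists a; rewrite distrC ltr_distl.
pose p : 'rV[rat]_d * rat := (\row_i sval (c_ i), q).
have xp : `|x - center p| < rad p.
  rewrite [ltLHS]mx_normrE; apply/bigmax_ltP; split=> // -[i j] _ /=.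
  by rewrite (ord1 i) !mxE /=; case: (c_ j).
have ip : inner p.
  split=> // y yp; apply: eO; rewrite mx_norm_ball /ball_ /= -(subrKA (center p)).
  apply: le_lt_trans (ler_normD _ _) _; rewrite [ltRHS]splitr.
  by rewrite ltrD// (lt_trans _ qe)// distrC.
by exists (pickle p); rewrite /h pickleK ifT ?bump_gt0//; exact/asboolP.
Qed.

(** A finite product, so of class C2. Off [O] every factor is 1; if [h n x > 0] for some [n], the
    product is at most [(1 - h n x) ^+ N] for [N > n], and the exponent [N] sends it to 0. *)
Let F N x := 1 - \prod_(n < N) (1 - h n x) ^+ N.

Let C2_F N : C2 (F N).
Proof.
apply: (C2D (C2_cst d 1)); apply: C2N; apply: C2_prod => n; apply: C2X.
exact: (C2D (C2_cst d 1) (C2N (C2_h n))).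
Qed.

Let prod_itv N x : 0 <= \prod_(n < N) (1 - h n x) ^+ N <= 1.
Proof.
have h1 n : 0 <= (1 - h n x) ^+ N <= 1.
  have /andP[h0 h1] := h_itv n x.
  by rewrite exprn_ge0 ?subr_ge0//= exprn_ile1 ?subr_ge0// gerBl.
apply/andP; split; first by apply: prodr_ge0 => n _; case/andP: (h1 n).
by apply: prodr_ile1 => n _; exact: h1.
Qed.

Let F_itv N x : 0 <= F N x <= 1.
Proof. by have /andP[p0 p1] := prod_itv N x; rewrite subr_ge0 p1 gerBl. Qed.

Let F_out N x : ~ O x -> F N x = 0.
Proof.
move=> Ox; rewrite /F big1 ?subrr// => n _.
by rewrite h_out// subr0 expr1n.
Qed.

Let cvg_F x : F ^~ x @ \oo --> (\1_O x : R).
Proof.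
have [Ox|Ox] := pselect (O x); last first.
  rewrite indicE memNset//; apply: cvg_near_cst; near=> N; exact: F_out.
rewrite indicE mem_set// -[X in _ --> X]subr0; apply: cvgB; first exact: cvg_cst.
have [n hn] := h_in Ox; have /andP[h0 h1] := h_itv n x.
apply: (@squeeze_cvgr _ _ _ _ (fun=> 0) (fun N => (1 - h n x) ^+ N)).
- near=> N; have /andP[-> _] := prod_itv N x => /=.
  have nN : (n < N)%N by near: N; exact: nbhs_infty_gt.
  rewrite (bigD1 (Ordinal nN))//= ler_piMr//; first by rewrite exprn_ge0// subr_ge0.
  apply: prodr_ile1 => k _; have /andP[k0 k1] := h_itv k x.
  by rewrite exprn_ge0 ?subr_ge0//= exprn_ile1 ?subr_ge0// gerBl.
- exact: cvg_cst.
- by apply: cvg_expr; rewrite ger0_norm ?subr_ge0// gtrBl.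
Unshelve. all: end_near. Qed.

Lemma open_smooth_approx : exists F : nat -> 'rV[R]_d -> R,
  [/\ forall N, C2 (F N), forall N x, 0 <= F N x <= 1, forall N x, ~ O x -> F N x = 0 &
      forall x, F ^~ x @ \oo --> (\1_O x : R)].
Proof. by exists F; split. Qed.

End open_smooth_approximation.

Section comparison_by_smooth_functions.
Variables (R : realType) (d : nat).
Variables (m : {finite_measure set 'rV[R]_d -> \bar R}).
Variables (m2 : {measure set 'rV[R]_d -> \bar R}) (c : R) (U : set 'rV[R]_d).
Hypotheses (c0 : 0 <= c) (oU : open U).
Hypothesis smooth_le : forall f : 'rV[R]_d -> R, C2 f ->
  (forall x, 0 <= f x <= 1) -> (forall x, ~ U x -> f x = 0) ->
  (c%:E * \int[m2]_x (f x)%:E <= \int[m]_x (f x)%:E)%E.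

Section open_set.
Variable O : set 'rV[R]_d.
Hypotheses (oO : open O) (OU : O `<=` U).

Lemma open_le : (c%:E * m2 O <= m O)%E.
Proof.
have [F [C2_F F_itv F_out cvg_F]] := open_smooth_approx oO.
have mO := open_measurable_rV oO.
have mF N : measurable_fun setT (F N).
  by apply: continuous_measurable_rV; apply: C1_continuous; case: (C2_F N).
have FO N : (c%:E * \int[m2]_x (F N x)%:E <= m O)%E.
  apply: le_trans (smooth_le (C2_F N) (F_itv N) _) _.
    by move=> x Ux; apply: F_out => /OU.
  have <- : (\int[m]_x (\1_O x)%:E = m O)%E by rewrite integral_indic// setIT.
  apply: ge0_le_integral => //.
  - by move=> x _; rewrite lee_fin; case/andP: (F_itv N x).
  - exact/measurable_EFinP.
  - exact/measurable_EFinP/measurable_indic.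
  - move=> x _; rewrite lee_fin; have [Ox|Ox] := pselect (O x).
      by rewrite indicE mem_set//; case/andP: (F_itv N x).
    by rewrite F_out.
have cE : (c%:E * m2 O = \int[m2]_x (c%:E * (\1_O x)%:E))%E.
  rewrite ge0_integralZl//; first by rewrite integral_indic// setIT.
  exact/measurable_EFinP/measurable_indic.
rewrite cE; apply: (@fatou_bound _ _ _ m2 (fun N x => (c%:E * (F N x)%:E)%E)).
- by move=> N; apply: measurable_funeM; exact/measurable_EFinP.
- by move=> N x; rewrite mule_ge0 ?lee_fin//; case/andP: (F_itv N x).
- move=> x; apply: cvgeZl => //; apply: cvg_EFin; last exact: cvg_F.
  by near=> N.
- move=> N; rewrite ge0_integralZl//; [exact/measurable_EFinP|].
  by move=> x _; rewrite lee_fin; case/andP: (F_itv N x).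
Unshelve. all: end_near. Qed.

End open_set.

(** Outer regularity is applied to the larger measure: an open [W] containing [A] with
    [m W <= m A + e] reduces the claim to the open set [W] intersected with [U], and [m2] may be
    infinite. *)
Lemma measurable_le A : measurable A -> (c%:E * m2 (A `&` U) <= m A)%E.
Proof.
move=> mA; apply/lee_addgt0Pr => e e0.
have [W [oW AW We]] := outer_regular m mA e0.
have mU := open_measurable_rV oU; have mW := open_measurable_rV oW.
apply: (@le_trans _ _ (c%:E * m2 (W `&` U))%E).
  apply: lee_wpmul2l; rewrite ?lee_fin//; apply: le_measure; rewrite ?inE; try exact: measurableI.
  by move=> x [Ax Ux]; split=> //; exact: AW.
apply: le_trans We; apply: (@le_trans _ _ (m (W `&` U))).
  by apply: open_le; [exact: openI|move=> x []].
by apply: le_measure; rewrite ?inE//; exact: measurableI.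
Qed.

End comparison_by_smooth_functions.

(** * Euclidean norm and integrability of the stable kernel *)

Section euclidean_norm.
Variables (R : realType) (d : nat).
Implicit Types x y z : 'rV[R]_d.

Lemma dot_ge0 x : 0 <= dot x x.
Proof. by apply: sumr_ge0 => i _; rewrite -expr2 sqr_ge0. Qed.

Lemma norm_le_enorm x : `|x| <= enorm x.
Proof.
apply/rV_normP => [|i]; first exact: sqrtr_ge0.
rewrite -(@ler_pXn2r _ 2)// ?nnegrE ?sqrtr_ge0// real_normK ?num_real// sqr_sqrtr ?dot_ge0//.
rewrite /dot (bigD1 i)//= -expr2 lerDl; apply: sumr_ge0 => j _.
by rewrite -expr2 sqr_ge0.
Qed.

Lemma enorm_le_norm x : enorm x <= d%:R * `|x|.
Proof.
rewrite -(@ler_pXn2r _ 2)// ?nnegrE ?sqrtr_ge0 ?mulr_ge0// sqr_sqrtr ?dot_ge0//.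
apply: (@le_trans _ _ (\sum_(i < d) `|x| ^+ 2)).
  apply: ler_sum => i _; rewrite -expr2 -real_normK ?num_real//.
  by rewrite ler_pXn2r ?nnegrE// coord_le_norm.
rewrite sumr_const card_ord exprMn -[leLHS]mulr_natl.
apply: ler_wpM2r; first by rewrite exprn_ge0.
by rewrite -natrX ler_nat expnS expn1; case: (d) => // n; rewrite leq_pmulr.
Qed.

Lemma measurable_dot (dT : measure_display) (S : measurableType dT)
    (f g : S -> 'rV[R]_d) : measurable_fun setT f -> measurable_fun setT g ->
  measurable_fun setT (fun t => dot (f t) (g t)).
Proof.
move=> mf mg; apply: measurable_sum => i.
by apply: measurable_funM;
  [exact: (measurableT_comp (measurable_coord i) mf)|exact: (measurableT_comp (measurable_coord i) mg)].
Qed.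

Lemma measurable_enorm : measurable_fun setT (@enorm R d).
Proof.
apply: (@measurableT_comp _ _ _ _ _ _ (@Num.sqrt R)).
  by apply: continuous_measurable_fun; exact: sqrt_continuous.
exact: measurable_dot.
Qed.

Lemma measurable_enorm_le1 : measurable [set w : 'rV[R]_d | enorm w <= 1].
Proof.
rewrite -[X in measurable X]setTI.
by apply: measurable_fun_ler => //; exact: measurable_enorm.
Qed.

End euclidean_norm.

Section stable_kernel_bounds.
Variables (R : realType) (d : nat) (alpha : R).
Hypothesis alpha12 : 1 < alpha < 2.
Implicit Types z : 'rV[R]_d.

Local Notation L := (@stable_kernel R d alpha).

Let da_gt0 : 0 < d%:R + alpha.
Proof. by case/andP: alpha12 => a1 _; rewrite ltr_wpDl// (lt_trans _ a1). Qed.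

Lemma stable_kernel_ge0 z : 0 <= L z.
Proof. by rewrite invr_ge0 powR_ge0. Qed.

Lemma measurable_stable_kernel : measurable_fun setT L.
Proof.
have -> : L = (fun z => enorm z `^ (- (d%:R + alpha))) by apply/funext => z; rewrite powRN.
exact: (measurableT_comp (measurable_powR _) (@measurable_enorm R d)).
Qed.

Lemma stable_kernel0 : L 0 = 0.
Proof.
rewrite /stable_kernel (_ : enorm 0 = 0) ?powR0 ?invr0 ?gt_eqF//.
by rewrite /enorm /dot big1 ?sqrtr0// => i _; rewrite mxE mul0r.
Qed.

Lemma stable_kernel_le z r : 0 < r -> r <= `|z| -> L z <= (r `^ (d%:R + alpha))^-1.
Proof.
move=> r0 rz; have re : r <= enorm z by rewrite (le_trans rz)// norm_le_enorm.
rewrite lef_pV2 ?posrE ?powR_gt0//; last exact: lt_le_trans re.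
by apply: ge0_ler_powR => //; rewrite ?nnegrE ?sqrtr_ge0// ltW.
Qed.

(** The hypothesis on [z] excludes the default value 0 of the kernel at the origin. *)
Lemma stable_kernel_ge z r : z != 0 -> `|z| <= r -> ((d%:R * r) `^ (d%:R + alpha))^-1 <= L z.
Proof.
move=> z0 zr; have e0 : 0 < enorm z by rewrite (lt_le_trans _ (norm_le_enorm z))// normr_gt0.
have er : enorm z <= d%:R * r by rewrite (le_trans (enorm_le_norm z))// ler_wpM2l.
rewrite lef_pV2 ?posrE ?powR_gt0//; last exact: lt_le_trans er.
by apply: ge0_ler_powR => //; rewrite ?nnegrE ltW// (lt_le_trans e0).
Qed.

Lemma lebesgue_cube (a : 'rV[R]_d) (r : R) : 0 <= r ->
  lebesgue_rV R d [set z | `|a + z| <= r] = ((2 * r) ^+ d)%:E.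
Proof.
move=> r0; have -> : [set z | `|a + z| <= r] = [set z | forall i, `[- r - a 0 i, r - a 0 i]%classic (z 0 i)].
  apply/seteqP; split=> z /= => [/(rV_normP _ r0) h i|h].
    by have := h i; rewrite mxE in_itv/= ler_norml lerBlDl lerBrDl.
  by apply/(rV_normP _ r0) => i; have := h i; rewrite mxE in_itv/= ler_norml lerBlDl lerBrDl.
rewrite (@lebesgue_rV_box R d (fun i => `[- r - a 0 i, r - a 0 i]%classic))//.
rewrite (eq_bigr (fun=> (2 * r)%:E)).
  by rewrite prodEFin prodr_const card_ord.
move=> i _; rewrite lebesgue_measure_itv/= lte_fin; case: ifPn => [_|].
  by rewrite -EFinB; congr (_%:E); ring.
rewrite -leNgt => h; have -> : r = 0 by lra.
by rewrite mulr0.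
Qed.

(** The sets may overlap, since [f] is compared with the sum of the [w n] times the indicators of
    the [S n]. Hence cubes, whose volume is known, can stand for dyadic shells. *)
Lemma shell_integral_le (f : 'rV[R]_d -> R) (w : R^nat) (S : (set 'rV[R]_d)^nat) :
  (forall z, 0 <= f z) -> measurable_fun setT f ->
  (forall n, 0 <= w n) -> (forall n, measurable (S n)) ->
  (forall z, f z = 0 \/ exists n, S n z /\ f z <= w n) ->
  (\int[lebesgue_rV R d]_z (f z)%:E <= \sum_(n <oo) (w n)%:E * lebesgue_rV R d (S n))%E.
Proof.
move=> f0 mf w0 mS fS.
have mw n : measurable_fun setT (fun z => ((w n)%:E * (\1_(S n) z)%:E)%E).
  by apply: measurable_funeM; exact/measurable_EFinP/measurable_indic.
have w0' n z : (0 <= (w n)%:E * (\1_(S n) z)%:E)%E by rewrite mule_ge0 ?lee_fin.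
apply: (@le_trans _ _ (\int[lebesgue_rV R d]_z \sum_(n <oo) (w n)%:E * (\1_(S n) z)%:E)%E).
  apply: ge0_le_integral => //.
  - by move=> z _; rewrite lee_fin.
  - exact/measurable_EFinP.
  - by apply: ge0_emeasurable_sum => // n z _ _; exact: w0'.
  - move=> z _; have [->|[n [Sz fz]]] := fS z.
      by apply: nneseries_ge0 => n _ _; exact: w0'.
    rewrite (@nneseriesD1 _ _ n)//.
    apply: (@le_trans _ _ ((w n)%:E * (\1_(S n) z)%:E)%E).
      by rewrite indicE mem_set// mule1 lee_fin.
    by rewrite leeDl//; apply: nneseries_ge0 => k _ _; exact: w0'.
rewrite integral_nneseries//; apply: lee_nneseries => [n _ _|n _].
  by apply: integral_ge0 => z _; exact: w0'.
rewrite ge0_integralZl//; last 2 first.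
- exact/measurable_EFinP/measurable_indic.
- by rewrite lee_fin.
by rewrite integral_indic// setIT.
Qed.

Lemma geometric_nneseries_lty (K q : R) : 0 <= K -> 0 <= q -> q < 1 ->
  (\sum_(n <oo) (K * q ^+ n)%:E < +oo)%E.
Proof.
move=> K0 q0 q1; apply: (@le_lt_trans _ _ (K / (1 - q))%:E); last by rewrite ltry.
apply: lime_le; first by apply: is_cvg_nneseries => n _ _; rewrite lee_fin mulr_ge0// exprn_ge0.
near=> n; rewrite big_mkord sumEFin lee_fin -mulr_sumr ler_wpM2l//.
have q1' : 0 < 1 - q by rewrite subr_gt0.
rewrite -[leRHS]div1r ler_pdivlMr// mulrC -opprB mulNr -subrX1 opprB gerBl.
exact: exprn_ge0.
Unshelve. all: end_near. Qed.

Let pow2_gt (x : R) : exists n, x < 2 ^+ n.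
Proof.
exists (Num.bound `|x|); apply: (le_lt_trans (ler_norm x)).
apply: (lt_trans (archi_boundP (normr_ge0 x))).
by rewrite -natrX ltr_nat ltn_expl.
Qed.

Let powR2_lt (x y : R) : x < y -> 2 `^ x < 2 `^ y.
Proof.
move=> xy; rewrite /powR gt_eqF// ltr_expR ltr_pM2r// ln_gt0//.
by rewrite ltr1n.
Qed.

Let powRX (x r : R) n : 0 <= x -> (x ^+ n) `^ r = (x `^ r) ^+ n.
Proof.
by move=> x0; rewrite -powR_mulrn// -powRrM mulrC powRrM powR_mulrn// powR_ge0.
Qed.

Let powR2V r : (2^-1 : R) `^ r = (2 `^ r)^-1.
Proof. by rewrite -[in LHS](@powR_inv1 _ 2)// -powRrM mulN1r powRN. Qed.

(** Dyadic shells give geometric series on both sides of the unit sphere: [alpha < 2] makes the one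
    near 0 converge, and [alpha > 0] the one at infinity. *)
Lemma integral_stable_kernel_lty :
  (\int[lebesgue_rV R d]_z (Num.min 1 (`|z| ^+ 2) * L z)%:E < +oo)%E.
Proof.
have /andP[a1 a2] := alpha12; have a0 : 0 < alpha by rewrite (lt_trans _ a1).
pose p := d%:R + alpha.
pose W (z : 'rV[R]_d) := Num.min 1 (`|z| ^+ 2) * L z.
have mnorm : measurable_fun setT (fun z : 'rV[R]_d => `|z|).
  by apply: continuous_measurable_rV; exact: norm_continuous.
have mW : measurable_fun setT W.
  apply: measurable_funM; last exact: measurable_stable_kernel.
  by apply: measurable_minr => //; exact: measurable_funX.
have m0 (z : 'rV[R]_d) : 0 <= Num.min 1 (`|z| ^+ 2) by rewrite le_min ler01 exprn_ge0.
have W0 z : 0 <= W z by rewrite mulr_ge0// stable_kernel_ge0.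
pose W1 z := if `|z| <= 1 then W z else 0.
pose W2 z := if `|z| <= 1 then 0 else W z.
have mle1 : measurable_fun setT (fun z : 'rV[R]_d => `|z| <= 1) by exact: measurable_fun_ler.
have mW1 : measurable_fun setT W1 by exact: measurable_fun_ifT.
have mW2 : measurable_fun setT W2 by exact: measurable_fun_ifT.
have W10 z : 0 <= W1 z by rewrite /W1; case: ifP.
have W20 z : 0 <= W2 z by rewrite /W2; case: ifP.
have cube (r : R) : 0 <= r -> lebesgue_rV R d [set z | `|z| <= r] = ((2 * r) ^+ d)%:E.
  by move=> r0; rewrite -(lebesgue_cube 0 r0); congr (_ _); apply/seteqP; split=> z /=; rewrite add0r.
have mcube r : measurable [set z : 'rV[R]_d | `|z| <= r].
  by rewrite -[X in measurable X]setTI; exact: measurable_fun_ler.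
have -> : (\int[lebesgue_rV R d]_z (W z)%:E =
    \int[lebesgue_rV R d]_z (W1 z)%:E + \int[lebesgue_rV R d]_z (W2 z)%:E)%E.
  rewrite -ge0_integralD//; last 4 first.
  - by move=> z _; rewrite lee_fin.
  - exact/measurable_EFinP.
  - by move=> z _; rewrite lee_fin.
  - exact/measurable_EFinP.
  by apply: eq_integral => z _; rewrite /W1 /W2 -EFinD; case: ifP => _; rewrite ?addr0 ?add0r.
have p2 (x : R) : 0 < 2 `^ x by rewrite powR_gt0.
have h0 : 0 < 2^-1 :> R by [].
have h1 : 2^-1 < 1 :> R by lra.
apply: lte_add_pinfty.
- pose S n := [set z : 'rV[R]_d | `|z| <= 2^-1 ^+ n].
  (* On the shell [2^-(n+1) < |z| <= 2^-n], the square is bounded at the outer radius and the kernel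
     at the inner one. *)
  pose w n : R := (2^-1 ^+ n) ^+ 2 * ((2^-1 ^+ n.+1) `^ p)^-1.
  apply: le_lt_trans (shell_integral_le (w := w) (S := S) W10 mW1 _ _ _) _.
  + by move=> n; rewrite mulr_ge0 ?invr_ge0 ?powR_ge0 ?exprn_ge0.
  + by move=> n; exact: mcube.
  + move=> z; have [->|z0] := eqVneq z 0.
      by left; rewrite /W1 /W stable_kernel0 mulr0; case: ifP.
    have nz : 0 < `|z| by rewrite normr_gt0.
    rewrite /W1; case: ifPn => [z1|_]; [right|by left].
    have [n zn np] : exists2 n, 2^-1 ^+ n.+1 < `|z| & `|z| <= 2^-1 ^+ n.
      have ex : exists n, 2^-1 ^+ n.+1 < `|z|.
        have [n nn] := pow2_gt `|z|^-1; exists n.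
        rewrite exprVn invf_plt ?posrE ?exprn_gt0//; apply: lt_trans nn _.
        by rewrite ltr_eXn2l ?ltr1n.
      exists (ex_minn ex); case: ex_minnP => // -[//|n] _ /(_ n) nmin.
      by rewrite leNgt; apply/negP => /nmin; rewrite ltnn.
    exists n; split=> //; rewrite /w ler_pM ?stable_kernel_ge0//.
      by rewrite ge_min; apply/orP; right; rewrite ler_pXn2r ?nnegrE// ?exprn_ge0.
    by apply: stable_kernel_le; rewrite ?exprn_gt0// ltW.
  (* From one shell to the next, the square is divided by 4, the kernel multiplied by [2 ^ p] and
     the volume divided by [2 ^ d]: the ratio is [2 ^ (alpha - 2)]. *)
  pose q : R := 4^-1 * 2 `^ p * 2^-1 ^+ d.
  have qE : q = 2 `^ alpha / 4.
    rewrite /q /p powRD ?powR_mulrn//; last by apply/implyP => _; rewrite pnatr_eq0.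
    have : (2 ^+ d : R) != 0 by rewrite expf_neq0// pnatr_eq0.
    by rewrite exprVn => d0; field.
  have q1 : q < 1.
    rewrite qE ltr_pdivrMr// mul1r (_ : 4 = 2 `^ 2%:R).
      exact: powR2_lt.
    by rewrite powR_mulrn// -natrX.
  apply: le_lt_trans (geometric_nneseries_lty (K := 2 ^+ d * 2 `^ p) (q := q) _ _ q1).
  + apply: lee_nneseries => [n _ _|n _].
      by rewrite mule_ge0// lee_fin mulr_ge0 ?invr_ge0 ?powR_ge0 ?exprn_ge0.
    rewrite cube ?exprn_ge0// -EFinM lee_fin /w /q powRX ?invr_ge0// powR2V.
    have -> : (((2 `^ p)^-1) ^+ n.+1)^-1 = 2 `^ p * (2 `^ p) ^+ n by rewrite exprVn invrK exprS.
    rewrite (_ : 4^-1 = 2^-1 * 2^-1 :> R); last by field.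
    rewrite expr2 !exprMn (exprAC _ n d) le_eqVlt; apply/orP; left; apply/eqP.
    ring.
  + by rewrite mulr_ge0 ?exprn_ge0// powR_ge0.
  + by rewrite !mulr_ge0 ?exprn_ge0// powR_ge0.
- pose S n := [set z : 'rV[R]_d | `|z| <= 2 ^+ n.+1].
  pose w n : R := ((2 ^+ n) `^ p)^-1.
  apply: le_lt_trans (shell_integral_le (w := w) (S := S) W20 mW2 _ _ _) _.
  + by move=> n; rewrite invr_ge0 powR_ge0.
  + by move=> n; exact: mcube.
  + move=> z; rewrite /W2; case: ifPn => [_|]; [by left|rewrite -ltNge => z1; right].
    have [n zn np] : exists2 n, `|z| <= 2 ^+ n.+1 & 2 ^+ n < `|z|.
      have ex : exists n, `|z| <= 2 ^+ n.+1.
        have [n nn] := pow2_gt `|z|; exists n; apply: le_trans (ltW nn) _.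
        by rewrite ler_eXn2l ?ltr1n.
      exists (ex_minn ex); case: ex_minnP => // -[//|n] _ /(_ n) nmin.
      by rewrite ltNge; apply/negP => /nmin; rewrite ltnn.
    exists n; split=> //; rewrite /w /W -[leRHS]mul1r.
    apply: ler_pM; [exact: m0|exact: stable_kernel_ge0|by rewrite ge_min lexx|].
    by apply: stable_kernel_le; rewrite ?exprn_gt0// ltW.
  (* Here the volume is multiplied by [2 ^ d] and the kernel divided by [2 ^ p]: the ratio is
     [2 ^ (- alpha)]. *)
  pose q : R := 2 ^+ d / 2 `^ p.
  have qE : q = (2 `^ alpha)^-1.
    rewrite /q /p powRD ?powR_mulrn//; last by apply/implyP => _; rewrite pnatr_eq0.
    have : (2 ^+ d : R) != 0 by rewrite expf_neq0// pnatr_eq0.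
    have : 2 `^ alpha != 0 by rewrite gt_eqF.
    by move=> u v; field; rewrite u v.
  have q1 : q < 1.
    rewrite qE invf_lt1// -[X in X < _](powRr0 2).
    exact: powR2_lt.
  apply: le_lt_trans (geometric_nneseries_lty (K := 4 ^+ d) (q := q) _ _ q1).
  + apply: lee_nneseries => [n _ _|n _].
      by rewrite mule_ge0// lee_fin invr_ge0 powR_ge0.
    rewrite cube ?exprn_ge0// -EFinM lee_fin /w /q powRX//.
    rewrite (_ : 2 * 2 ^+ n.+1 = 4 * 2 ^+ n :> R); last by rewrite exprS; ring.
    rewrite !exprMn exprVn (exprAC _ n d) le_eqVlt; apply/orP; left; apply/eqP.
    by move: (_ ^+ n) (_ ^- n) (_ ^+ d) => *; ring.
  + by rewrite exprn_ge0.
  + by rewrite mulr_ge0 ?exprn_ge0// invr_ge0 powR_ge0.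
Qed.

End stable_kernel_bounds.

(** * Bounds for the coefficients, the jumps and the generator *)

Section coefficient_bounds.
Variables (R : realType) (d : nat) (lam : R -> R).
Variables (b : 'rV[R]_d -> 'rV[R]_d) (k : 'rV[R]_d -> 'rV[R]_d -> R).
Hypotheses (lam0 : forall r, 0 <= r -> 0 < lam r).
Hypothesis lam_nd : forall r s, 0 <= r -> r <= s -> lam r <= lam s.
Hypothesis Lbk : class_L lam b k.

Lemma connected_norm_lt (r : R) : connected [set x : 'rV[R]_d | `|x| < r].
Proof.
have -> : [set x : 'rV[R]_d | `|x| < r] =
    \bigcup_(y in [set x : 'rV[R]_d | `|x| < r]) ((fun t : R => t *: y) @` `[0, 1]).
  apply/seteqP; split=> [x xr|x [y /= yr [t]]].
    by exists x => //; exists 1; [rewrite /= in_itv/= ler01 lexx|rewrite scale1r].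
  rewrite /= in_itv/= => /andP[t0 t1] <-; rewrite /= normrZ ger0_norm//.
  by apply: le_lt_trans yr; rewrite ler_piMl.
apply: bigcup_connected.
  by exists 0 => y yr; exists 0; [rewrite /= in_itv/= lexx ler01|rewrite scale0r].
move=> y yr; apply: connected_continuous_connected; first exact: segment_connected.
by apply: continuous_subspaceT => t; exact: scalel_continuous.
Qed.

Lemma local_bounds (r : R) : exists2 Lam, 0 < Lam &
  forall x, `|x| < r -> enorm (b x) <= Lam /\ forall z, Lam^-1 <= k x z <= Lam.
Proof.
have [r0|r0] := leP r 0.
  by exists 1 => // x xr; have := lt_le_trans xr r0; rewrite normr_lt0.
pose D := [set x : 'rV[R]_d | `|x| < r].
have De (s : R) : d%:R * r <= s -> D `<=` eball (s + 1).
  move=> rs x xr; rewrite /eball /=; apply: (le_lt_trans (enorm_le_norm x)).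
  rewrite ltr_pwDr// (le_trans _ rs)// ler_wpM2l// ltW//.
have bD : bounded_domain D.
  split.
  - have -> : D = [set x | `|x - 0| < r] by apply/seteqP; split=> x; rewrite /D /= subr0.
    exact: open_norm_lt.
  - exact: connected_norm_lt.
  - by exists 0; rewrite /D /= normr0.
  - by exists (d%:R * r + 1); exact: De.
case: Lbk => _ _ _ /(_ D bD) H; exists (lambda_dom lam D); last exact: H.
(* By monotonicity every admissible value is at least [lam 0 > 0]. One admissible radius has to be
   exhibited, because [inf] of the empty set is 0. *)
apply: (lt_le_trans (lam0 (lexx 0))); apply: lb_le_inf.
  exists (lam (d%:R * r)), (d%:R * r) => //; split; last exact: De.
  by rewrite mulr_ge0// ltW.
by move=> _ [s [s0 _] <-]; exact: lam_nd.
Qed.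

End coefficient_bounds.

Section jump.
Variables (R : realType) (d : nat).
Hypothesis d0 : (0 < d)%N.
Implicit Types (f : 'rV[R]_d -> R) (x z : 'rV[R]_d).

Definition jump f x z :=
  f (x + z) - f x - \1_[set w | enorm w <= 1] z * dot (grad f x) z.

Lemma jump_near f x z : enorm z <= 1 -> jump f x z = f (x + z) - f x - dot (grad f x) z.
Proof. by move=> z1; rewrite /jump indicE mem_set// mul1r. Qed.

Lemma jump_far f x z : 1 < enorm z -> jump f x z = f (x + z) - f x.
Proof. by move=> z1; rewrite /jump indicE memNset ?mul0r ?subr0//= leNgt z1. Qed.

Lemma min_near z : enorm z <= 1 -> Num.min 1 (`|z| ^+ 2) = `|z| ^+ 2.
Proof.
move=> z1; apply/min_idPr; rewrite exprn_ile1//.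
exact: le_trans (norm_le_enorm z) z1.
Qed.

(** The compensator is cut at Euclidean norm 1 whereas the weight uses the sup norm; passing from
    one norm to the other costs [d ^ 2]. *)
Lemma min_far z : 1 < enorm z -> 1 <= d%:R ^+ 2 * Num.min 1 (`|z| ^+ 2).
Proof.
move=> z1; have d1 : 1 <= d%:R :> R by rewrite ler1n.
have dz : 1 <= d%:R * `|z| by rewrite ltW// (lt_le_trans z1)// enorm_le_norm.
rewrite minr_pMr ?exprn_ge0// le_min mulr1 exprn_ege1//= -exprMn exprn_ege1//.
Qed.

Lemma hessian_bound f (P : 'rV[R]_d -> Prop) :
  (forall i j, exists M, forall y, P y -> `|partial i (partial j f) y| <= M) ->
  exists2 B, 0 <= B & forall i j y, P y -> `|partial i (partial j f) y| <= B.
Proof.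
move=> H.
have /choice[M MP] : forall ij : 'I_d * 'I_d, exists M, forall y, P y ->
    `|partial ij.1 (partial ij.2 f) y| <= M by move=> [i j]; exact: H.
exists (\sum_ij `|M ij|); first by rewrite sumr_ge0.
move=> i j y Py; apply: (le_trans (MP (i, j) y Py)).
rewrite (bigD1 (i, j))//=; apply: (le_trans (ler_norm _)).
by rewrite lerDl sumr_ge0.
Qed.

Lemma C2_continuous_hessian f i j : C2 f -> continuous (partial i (partial j f)).
Proof. by move=> [_ /(_ j)]; exact: C1_continuous_partial. Qed.

(** A small jump from the ball of radius [r] stays in the ball of radius [r + 1], where compactness
    bounds the Hessian. *)
Lemma local_jump_bound f (r : R) : C2 f -> exists2 B, 0 <= B &
  forall x z, `|x| <= r -> enorm z <= 1 -> `|jump f x z| <= B * Num.min 1 (`|z| ^+ 2).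
Proof.
move=> f2.
have [|B B0 fB] := @hessian_bound f (fun y => `|y| <= r + 1).
  move=> i j; have [M M0 fM] := continuous_bounded_ball (r + 1) (C2_continuous_hessian (i := i) (j := j) f2).
  by exists M.
exists (d%:R ^+ 2 * B) => [|x z xr z1]; first by rewrite mulr_ge0 ?exprn_ge0.
rewrite jump_near// min_near//; apply: taylor2 => // i j y yx; apply: fB.
have z1' := le_trans (norm_le_enorm z) z1.
rewrite -(subrK x y) (le_trans (ler_normD _ _))// addrC lerD//.
exact: le_trans z1'.
Qed.

Lemma global_jump_bound f : C2b f -> exists2 B, 0 <= B &
  forall x z, `|jump f x z| <= B * Num.min 1 (`|z| ^+ 2).
Proof.
move=> [f2 [M fM] _ hb].
have [|B B0 fB] := @hessian_bound f (fun=> True).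
  by move=> i j; have [N fN] := hb i j; exists N.
have M0 : 0 <= M by exact: le_trans (fM 0).
exists (d%:R ^+ 2 * B + d%:R ^+ 2 * (2 * M)) => [|x z].
  by rewrite addr_ge0// !mulr_ge0// exprn_ge0.
have m0 : 0 <= Num.min 1 (`|z| ^+ 2) by rewrite le_min ler01 exprn_ge0.
rewrite mulrDl; have [z1|z1] := leP (enorm z) 1.
  rewrite jump_near// ler_wpDr ?mulr_ge0 ?exprn_ge0// min_near//.
  by apply: taylor2 => // i j y _; exact: fB.
rewrite jump_far// ler_wpDl ?mulr_ge0 ?exprn_ge0//.
apply: (@le_trans _ _ (2 * M)).
  by rewrite (le_trans (ler_normB _ _))// mulr_natl mulr2n lerD.
rewrite mulrAC ler_peMl ?mulr_ge0//.
exact: min_far.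
Qed.

Lemma measurable_grad f : C1 f -> measurable_fun setT (grad f).
Proof.
move=> f1; apply: measurable_rV => i; under eq_fun do rewrite mxE.
by apply: continuous_measurable_rV; exact: C1_continuous_partial.
Qed.

Lemma measurable_jump f : C1 f ->
  measurable_fun setT (fun p : 'rV[R]_d * 'rV[R]_d => jump f p.1 p.2).
Proof.
move=> f1; have mf := continuous_measurable_rV (C1_continuous f1).
have m1 : measurable_fun setT (fun p : 'rV[R]_d * 'rV[R]_d => p.1) by exact: measurable_fst.
have m2 : measurable_fun setT (fun p : 'rV[R]_d * 'rV[R]_d => p.2) by exact: measurable_snd.
have madd : measurable_fun setT (fun p : 'rV[R]_d * 'rV[R]_d => p.1 + p.2).
  apply: measurable_rV => i; under eq_fun do rewrite mxE.
  by apply: measurable_funD; [exact: (measurableT_comp (measurable_coord i) m1)|exact: (measurableT_comp (measurable_coord i) m2)].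
apply: measurable_funB.
  by apply: measurable_funB; [exact: (measurableT_comp mf madd)|exact: (measurableT_comp mf m1)].
apply: measurable_funM.
  have mI : measurable_fun setT (\1_[set w : 'rV[R]_d | enorm w <= 1] : 'rV[R]_d -> R).
    by apply: measurable_indic; exact: measurable_enorm_le1.
  exact: (measurableT_comp mI m2).
by apply: measurable_dot => //; exact: (measurableT_comp (measurable_grad f1) m1).
Qed.

End jump.

Section generator_estimates.
Variables (R : realType) (d : nat) (alpha K0 : R) (lam : R -> R).
Variables (b : 'rV[R]_d -> 'rV[R]_d) (k : 'rV[R]_d -> 'rV[R]_d -> R).
Hypotheses (d0 : (0 < d)%N) (alpha12 : 1 < alpha < 2).
Hypotheses (lam0 : forall r, 0 <= r -> 0 < lam r).
Hypothesis lam_nd : forall r s, 0 <= r -> r <= s -> lam r <= lam s.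
Hypothesis Lbk : class_L lam b k.
Hypothesis growth : growth_condition b k K0.
Implicit Types (f : 'rV[R]_d -> R) (x z : 'rV[R]_d).

Local Notation L := (@stable_kernel R d alpha).
Local Notation leb := (lebesgue_rV R d).
Local Notation W z := (Num.min 1 (`|z| ^+ 2) * L z).

Let kL_ge0 x z : 0 <= k x z * L z.
Proof. by rewrite mulr_ge0 ?stable_kernel_ge0//; case: Lbk => _ _ /(_ x z)/ltW. Qed.

Let W_ge0 z : 0 <= W z.
Proof. by rewrite mulr_ge0 ?stable_kernel_ge0// le_min ler01 exprn_ge0. Qed.

Let mW : measurable_fun setT (fun z : 'rV[R]_d => W z).
Proof.
apply: measurable_funM; last exact: measurable_stable_kernel.
apply: measurable_minr => //; apply: measurable_funX.
by apply: continuous_measurable_rV; exact: norm_continuous.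
Qed.

Definition jump_mass : R := fine (\int[leb]_z (W z)%:E).

Lemma jump_mass_ge0 : 0 <= jump_mass.
Proof. by rewrite fine_ge0// integral_ge0// => z _; rewrite lee_fin. Qed.

Lemma jump_massE : (\int[leb]_z (W z)%:E)%E = jump_mass%:E.
Proof.
rewrite fineK// ge0_fin_numE; first exact: integral_stable_kernel_lty.
by apply: integral_ge0 => z _; rewrite lee_fin.
Qed.

Lemma measurable_jump_integrand f : C1 f -> measurable_fun setT
  (fun p : 'rV[R]_d * 'rV[R]_d => jump f p.1 p.2 * (k p.1 p.2 * L p.2)).
Proof.
move=> f1; apply: measurable_funM; first exact: measurable_jump.
apply: measurable_funM; first by case: Lbk.
have m2 : measurable_fun setT (fun p : 'rV[R]_d * 'rV[R]_d => p.2) by exact: measurable_snd.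
exact: (measurableT_comp (@measurable_stable_kernel R d alpha) m2).
Qed.

Lemma measurable_jump_integrand1 f x : C1 f -> measurable_fun setT
  (fun z => jump f x z * (k x z * L z)).
Proof.
by move=> f1; exact: (measurableT_comp (measurable_jump_integrand f1) (pair1_measurable x)).
Qed.

(** The jump integral is the difference of the integrals of its positive and negative parts, each of
    which is measurable in [x] by Tonelli's theorem. *)
Lemma measurable_generator f : C1 f -> measurable_fun setT (generator alpha b k f).
Proof.
move=> f1; apply: emeasurable_funD.
  apply/measurable_EFinP/measurable_dot; first by case: Lbk.
  exact: measurable_grad.
have mh : measurable_fun setT (fun p : 'rV[R]_d * 'rV[R]_d =>
    (jump f p.1 p.2 * (k p.1 p.2 * L p.2))%:E).
  by apply/measurable_EFinP; exact: measurable_jump_integrand.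
rewrite [X in measurable_fun _ X](_ : _ = (fun x =>
   (\int[leb]_z (fun p : 'rV[R]_d * 'rV[R]_d => (jump f p.1 p.2 * (k p.1 p.2 * L p.2))%:E)^\+%E (x, z)
  - \int[leb]_z (fun p : 'rV[R]_d * 'rV[R]_d => (jump f p.1 p.2 * (k p.1 p.2 * L p.2))%:E)^\-%E (x, z))%E)).
  apply: emeasurable_funB.
    apply: (@measurable_fun_fubini_tonelli_F _ _ _ _ _ _ _ (measurable_funepos mh)).
    by move=> p; exact: funepos_ge0.
  apply: (@measurable_fun_fubini_tonelli_F _ _ _ _ _ _ _ (measurable_funeneg mh)).
  by move=> p; exact: funeneg_ge0.
apply/funext => x; rewrite [LHS]integralE.
by congr (_ - _)%E; apply: eq_integral => z _; rewrite ?funeposE ?funenegE.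
Qed.

Lemma integral_jump_bound f x (C : R) : C1 f -> 0 <= C ->
  (forall z, `|jump f x z * (k x z * L z)| <= C * W z) ->
  exists2 g, `|g| <= C * jump_mass &
    (\int[leb]_z (jump f x z * (k x z * L z))%:E)%E = g%:E.
Proof.
move=> f1 C0 h.
have mh : measurable_fun setT (fun z => (jump f x z * (k x z * L z))%:E).
  by apply/measurable_EFinP; exact: measurable_jump_integrand1.
have le1 : (\int[leb]_z `|(jump f x z * (k x z * L z))%:E| <= (C * jump_mass)%:E)%E.
  rewrite EFinM -jump_massE -ge0_integralZl//; last 2 first.
  - exact/measurable_EFinP.
  - by move=> z _; rewrite lee_fin.
  apply: ge0_le_integral => //.
  - exact: measurableT_comp.
  - by apply: measurable_funeM; exact/measurable_EFinP.
  - by move=> z _; rewrite /= -EFinM lee_fin.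
have fin : (\int[leb]_z (jump f x z * (k x z * L z))%:E \is a fin_num)%E.
  apply: integrable_fin_num => //; apply/integrableP; split=> //.
  exact: le_lt_trans le1 (ltry _).
exists (fine (\int[leb]_z (jump f x z * (k x z * L z))%:E)); last by rewrite fineK.
rewrite -lee_fin -[leLHS]/(`|(fine _)%:E|%E) fineK//.
exact: le_trans (le_abse_integral leb measurableT mh) le1.
Qed.

Lemma dot_bound x y : `|dot x y| <= d%:R * `|x| * `|y|.
Proof.
apply: le_trans (ler_norm_sum _ _ _) _.
have -> : d%:R * `|x| * `|y| = \sum_(i < d) `|x| * `|y|.
  by rewrite sumr_const card_ord -mulrA mulr_natl.
by apply: ler_sum => i _; rewrite normrM ler_pM// coord_le_norm.
Qed.

Lemma generator_local_bound f (r : R) : C2b f -> exists2 C, 0 <= C &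
  forall x, `|x| < r -> exists2 g, `|g| <= C & generator alpha b k f x = g%:E.
Proof.
move=> fb; have [f2 _ _ _] := fb; have [f1 _] := f2.
have [B B0 hB] := global_jump_bound d0 fb.
have [Lam Lam0 hL] := local_bounds lam0 lam_nd Lbk r.
have [G G0 hG] : exists2 G, 0 <= G & forall x, `|grad f x| <= G.
  case: fb => _ _ /choice[M MP] _; exists (\sum_i `|M i|); first exact: sumr_ge0.
  move=> x; apply/rV_normP => [|i]; first exact: sumr_ge0.
  rewrite mxE (le_trans (MP i x))// (bigD1 i)//= (le_trans (ler_norm _))// lerDl.
  exact: sumr_ge0.
exists (d%:R * Lam * G + B * Lam * jump_mass).
  by rewrite addr_ge0 ?mulr_ge0 ?jump_mass_ge0// ltW.
move=> x xr; have [bx kx] := hL x xr.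
have [|z|g gB E] := @integral_jump_bound f x (B * Lam) f1; first by rewrite mulr_ge0// ltW.
  rewrite normrM (ger0_norm (kL_ge0 x z)) [leRHS](_ : _ = (B * Num.min 1 (`|z| ^+ 2)) * (Lam * L z)); last ring.
  apply: ler_pM; [exact: normr_ge0|exact: kL_ge0|exact: hB|].
  by rewrite ler_wpM2r ?stable_kernel_ge0//; case/andP: (kx z).
exists (dot (b x) (grad f x) + g); last by rewrite EFinD -E.
apply: (le_trans (ler_normD _ _)); apply: lerD => //.
apply: (le_trans (dot_bound _ _)); rewrite ler_pM ?mulr_ge0// ler_wpM2l//.
exact: le_trans (norm_le_enorm _) bx.
Qed.

(** From a distant [x], only jumps of length at least [|x| - r] reach the support. For these the
    kernel is at most [1 / (|x| - r)], as [d + alpha >= 1], while the growth condition makes [k x z]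
    at most linear in [|x|]; the product stays bounded. *)
Lemma generator_bound f (r : R) : 0 <= r -> C2 f -> (forall x, r < `|x| -> f x = 0) ->
  exists2 C, 0 <= C &
  forall x, exists2 g, `|g| <= C & generator alpha b k f x = g%:E.
Proof.
move=> r0 f2 f0; have fb := C2_support_C2b f2 f0; have [f1 _] := f2.
have [C1 C10 hC1] := generator_local_bound (r + 2) fb.
have [_ [M fM] _ _] := fb; have M0 : 0 <= M by exact: le_trans (fM 0).
(* The second factor bounds [k x z * L z]: one has [k x z <= 2 * |K0| * d * |x|], and
   [|x| <= (r + 1) * (|x| - r)] as soon as [|x| >= r + 1]. *)
pose c2 := M * (2 * `|K0| * d%:R * (r + 1)).
have c20 : 0 <= c2 by rewrite !mulr_ge0// addr_ge0.
pose C2 := c2 * (2 * r) ^+ d.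
have C20 : 0 <= C2 by rewrite mulr_ge0// exprn_ge0// mulr_ge0.
exists (C1 + C2); first exact: addr_ge0.
move=> x; have [xr|xr] := ltP `|x| (r + 2).
  by have [g gC1 gE] := hC1 x xr; exists g => //; rewrite ler_wpDr.
have fx : f x = 0 by apply: f0; lra.
have gx : grad f x = 0.
  by apply/rowP => i; rewrite !mxE; apply: (partial_support i f0); lra.
have jE z : jump f x z = f (x + z).
  by rewrite /jump fx gx subr0 (_ : dot 0 z = 0) ?mulr0 ?subr0// /dot big1// => i _; rewrite mxE mul0r.
have bnd z : `|jump f x z * (k x z * L z)| <= c2 * \1_[set z | `|x + z| <= r] z.
  rewrite jE indicE; have [xz|xz] := leP `|x + z| r; last first.
    by rewrite f0// mul0r normr0 mulr_ge0.
  rewrite mem_set// mulr1 normrM ler_pM// ger0_norm//.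
  have zx : `|x| - r <= `|z|.
    by have := ler_normB (x + z) z; rewrite addrK; lra.
  have xr1 : 1 <= `|x| - r by lra.
  have Lz : L z <= (`|x| - r)^-1.
    apply: le_trans (stable_kernel_le alpha12 _ zx) _; first by lra.
    rewrite lef_pV2 ?posrE ?powR_gt0; [|lra..].
    by apply: le1r_powR => //; case/andP: alpha12 => a1 _; rewrite ler_wpDl// ltW.
  have x1 : 1 <= `|x| by lra.
  have e1 : 1 <= enorm x by exact: le_trans (norm_le_enorm x).
  have kx : k x z <= 2 * `|K0| * (d%:R * `|x|).
    have := growth x z; rewrite ge_max => /andP[_ gr].
    have ke : k x z <= 2 * `|K0| * enorm x.
      rewrite -(@ler_pM2l _ (enorm x)); last by lra.
      apply: (le_trans gr); apply: (@le_trans _ _ (`|K0| * (1 + enorm x ^+ 2))).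
        by rewrite ler_wpM2r// ?ler_norm// addr_ge0// exprn_ge0//; lra.
      rewrite (_ : enorm x * _ = `|K0| * (2 * enorm x ^+ 2)); last ring.
      by rewrite ler_wpM2l//; have := exprn_ege1 2 e1; lra.
    apply: (le_trans ke); rewrite ler_wpM2l ?mulr_ge0//; exact: enorm_le_norm.
  apply: (@le_trans _ _ (2 * `|K0| * (d%:R * `|x|) * (`|x| - r)^-1)).
    by rewrite ler_pM ?stable_kernel_ge0//; case: Lbk => _ _ /(_ x z)/ltW.
  rewrite ler_pdivrMr; last by lra.
  rewrite -!mulrA !ler_wpM2l//; nra.
have mh : measurable_fun setT (fun z => (jump f x z * (k x z * L z))%:E).
  by apply/measurable_EFinP; exact: measurable_jump_integrand1.
have mS : measurable [set z : 'rV[R]_d | `|x + z| <= r].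
  rewrite -[X in measurable X]setTI; apply: measurable_fun_ler => //.
  apply: (measurableT_comp _ (measurable_addl_rV x)).
  by apply: continuous_measurable_rV; exact: norm_continuous.
have le1 : (\int[leb]_z `|(jump f x z * (k x z * L z))%:E| <= C2%:E)%E.
  rewrite /C2 EFinM -(lebesgue_cube x r0) -[X in (_ * leb X)%E]setIT -integral_indic//.
  rewrite -ge0_integralZl//; last exact/measurable_EFinP/measurable_indic.
  apply: ge0_le_integral => //.
  - exact: measurableT_comp.
  - by apply: measurable_funeM; exact/measurable_EFinP/measurable_indic.
  - by move=> z _; rewrite /= -EFinM lee_fin.
have fin : (\int[leb]_z (jump f x z * (k x z * L z))%:E \is a fin_num)%E.
  apply: integrable_fin_num => //; apply/integrableP; split=> //.
  exact: le_lt_trans le1 (ltry _).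
exists (fine (\int[leb]_z (jump f x z * (k x z * L z))%:E)).
  rewrite ler_wpDl// -lee_fin -[leLHS]/(`|(fine _)%:E|%E) fineK//.
  exact: le_trans (le_abse_integral leb measurableT mh) le1.
have d0' : dot (b x) 0 = 0 by rewrite /dot big1// => i _; rewrite mxE mulr0.
rewrite fineK// -[RHS]add0e; congr (_ + _)%E.
by rewrite gx d0'.
Qed.

End generator_estimates.

(** * Lower bound and comparison principle for the generator *)

Section minorization_estimate.
Variables (R : realType) (d : nat) (alpha : R) (lam : R -> R).
Variables (b : 'rV[R]_d -> 'rV[R]_d) (k : 'rV[R]_d -> 'rV[R]_d -> R).
Hypotheses (d0 : (0 < d)%N) (alpha12 : 1 < alpha < 2).
Hypotheses (lam0 : forall r, 0 <= r -> 0 < lam r).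
Hypothesis lam_nd : forall r s, 0 <= r -> r <= s -> lam r <= lam s.
Hypothesis Lbk : class_L lam b k.
Implicit Types (f g V : 'rV[R]_d -> R) (x z : 'rV[R]_d).

Local Notation L := (@stable_kernel R d alpha).
Local Notation leb := (lebesgue_rV R d).
Local Notation W z := (Num.min 1 (`|z| ^+ 2) * L z).

Let k_ge0 x z : 0 <= k x z. Proof. by case: Lbk => _ _ /(_ x z)/ltW. Qed.

Let kL_ge0 x z : 0 <= k x z * L z.
Proof. by rewrite mulr_ge0 ?stable_kernel_ge0. Qed.

Let dot0r x : dot x 0 = 0. Proof. by rewrite /dot big1// => i _; rewrite mxE mulr0. Qed.
Let dot0l x : dot 0 x = 0. Proof. by rewrite /dot big1// => i _; rewrite mxE mul0r. Qed.

(* Only the jumps from x into the support of f contribute. *)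
Lemma generator_lower_bound (a : 'rV[R]_d) (r : R) : 0 <= r ->
  (forall y, `|y - a| < 1 -> r + 1 <= `|y|) ->
  exists2 c, 0 < c & forall f, C2 f -> (forall x, 0 <= f x <= 1) ->
    (forall x, ~ [set y | `|y - a| < 1] x -> f x = 0) ->
  forall x, `|x| <= r -> (c%:E * \int[leb]_z (f z)%:E <= generator alpha b k f x)%E.
Proof.
move=> r0 aU; have [Lam Lam0 hL] := local_bounds lam0 lam_nd Lbk (r + 1).
(* A jump from the ball of radius [r] into the unit ball around [a] has length at most [rho]. *)
pose rho := r + `|a| + 1.
have rho0 : 0 < rho by rewrite /rho; have := normr_ge0 a; lra.
have drho0 : 0 < d%:R * rho by rewrite mulr_gt0// ltr0n.
pose c := Lam^-1 * ((d%:R * rho) `^ (d%:R + alpha))^-1.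
exists c => [|f f2 f01 fU x xr]; first by rewrite mulr_gt0 ?invr_gt0// powR_gt0.
have [f1 _] := f2.
have fout y : `|y| < r + 1 -> f y = 0.
  by move=> yr; apply: fU => /= /aU; rewrite leNgt yr.
have fx : f x = 0 by apply: fout; lra.
have gx : grad f x = 0.
  apply/rowP => i; rewrite !mxE.
  have <- := congr1 (@^~ x) (@partial_cst R d 0 i); apply: near_eq_partial.
  have oN : open [set y : 'rV[R]_d | `|y - 0| < r + 1] by exact: open_norm_lt.
  near=> y; apply: fout; rewrite -[y]subr0; near: y.
  by apply: (open_nbhs_nbhs (conj oN _)); rewrite /= subr0; lra.
have mf := continuous_measurable_rV (C1_continuous f1).
have mfx : measurable_fun setT (fun z => (f (x + z))%:E).
  by apply/measurable_EFinP; exact: (measurableT_comp mf (measurable_addl_rV x)).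
have -> : generator alpha b k f x = (\int[leb]_z (f (x + z) * (k x z * L z))%:E)%E.
  rewrite /generator gx dot0r add0e; apply: eq_integral => z _.
  by rewrite fx dot0l mulr0 !subr0.
rewrite -(ge0_integral_translation_rV x); last 2 first.
- by move=> z; rewrite lee_fin; case/andP: (f01 z).
- exact/measurable_EFinP.
rewrite -ge0_integralZl//; last 2 first.
- by move=> z _; rewrite lee_fin; case/andP: (f01 (x + z)).
- by rewrite lee_fin mulr_ge0// invr_ge0 ?powR_ge0// ltW.
have c0 : 0 <= c by rewrite mulr_ge0// invr_ge0 ?powR_ge0// ltW.
apply: ge0_le_integral => //.
- by move=> z _; rewrite mule_ge0// lee_fin//; case/andP: (f01 (x + z)).
- exact: measurable_funeM.
- have mh := measurable_jump_integrand1 alpha Lbk x f1.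
  apply/measurable_EFinP; rewrite [X in measurable_fun _ X](_ : _ =
      (fun z => jump f x z * (k x z * L z)))//.
  by apply/funext => z; rewrite /jump fx gx dot0l mulr0 !subr0.
move=> z _; rewrite -EFinM lee_fin mulrC.
have [xzU|xzU] := pselect (`|x + z - a| < 1); last by rewrite fU// !mul0r.
rewrite ler_wpM2l//; first by case/andP: (f01 (x + z)).
have [_ kx] := hL x (le_lt_trans xr (ltr_pwDr ltr01 (lexx _))).
apply: ler_pM; rewrite ?invr_ge0 ?powR_ge0 ?(ltW Lam0)//; first by case/andP: (kx z).
apply: stable_kernel_ge => //.
- apply/eqP => z0; move: (aU _ xzU); rewrite z0 addr0; lra.
- have := ler_normB (x + z - a) (x - a).
  rewrite (_ : x + z - a - (x - a) = z); last by rewrite opprB addrA subrK addrAC subrr add0r.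
  by have := ler_normB x a; rewrite /rho; lra.
Unshelve. all: end_near. Qed.

Lemma generator_cst_add V (c : R) x : C1 V ->
  generator alpha b k (fun y => V y + c) x = generator alpha b k V x.
Proof.
move=> V1; have gE : grad (fun y => V y + c) x = grad V x.
  apply/rowP => i; rewrite !mxE partialD//; last exact: C1_cst.
  by rewrite partial_cst addr0.
rewrite /generator gE; congr (_ + _)%E; apply: eq_integral => z _.
by congr (_%:E); congr (_ * _); rewrite opprD addrACA subrr addr0.
Qed.

(** Equality near [x] makes the gradients agree, so that only the jumps differ. Positive and
    negative parts are compared separately because the integrals may be infinite. *)
Lemma generator_le f g x : C1 f -> C1 g -> (forall y, f y <= g y) ->
  (\near x, f x = g x) -> (generator alpha b k f x <= generator alpha b k g x)%E.
Proof.
move=> f1 g1 fg nfg; have fx : f x = g x by exact: nbhs_singleton nfg.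
have gx : grad f x = grad g x.
  by apply/rowP => i; rewrite !mxE; exact: near_eq_partial.
have bE : dot (b x) (grad f x) = dot (b x) (grad g x) by rewrite gx.
rewrite /generator bE; apply: leeD2l.
have mh h : C1 h -> measurable_fun setT (fun z => (jump h x z * (k x z * L z))%:E).
  by move=> h1; apply/measurable_EFinP; exact: (measurable_jump_integrand1 alpha Lbk x h1).
have le z : jump f x z * (k x z * L z) <= jump g x z * (k x z * L z).
  by rewrite ler_wpM2r// /jump fx gx lerD2r lerB.
rewrite integralE [leRHS]integralE; apply: leeB; apply: ge0_le_integral => //.
- exact: measurable_funepos (mh _ f1).
- exact: measurable_funepos (mh _ g1).
- by move=> z _; rewrite !funeposE ge_max !le_max !lee_fin (le z) lexx !orbT.
- exact: measurable_funeneg (mh _ g1).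
- exact: measurable_funeneg (mh _ f1).
- by move=> z _; rewrite !funenegE ge_max !le_max -!EFinN !lee_fin lerN2 (le z) lexx !orbT.
Qed.

Section drift.
Variables (V : 'rV[R]_d -> R).
Hypotheses (V2 : C2 V) (V0 : forall x, 0 <= V x).

Let V1 : C1 V. Proof. by case: V2. Qed.

(** The part of the jump integral of [V] that no Taylor bound controls, freed from the coefficient
    [k]. *)
Definition far_integrand x z : R :=
  if enorm z <= 1 then 0 else V (x + z) * L z.

Let far_ge0 x z : 0 <= far_integrand x z.
Proof. by rewrite /far_integrand; case: ifP => // _; rewrite mulr_ge0 ?stable_kernel_ge0. Qed.

Let menorm : measurable_fun setT (fun z : 'rV[R]_d => enorm z <= 1).
Proof. by apply: measurable_fun_ler => //; exact: measurable_enorm. Qed.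

Let mfar x : measurable_fun setT (far_integrand x).
Proof.
apply: measurable_fun_ifT => //; apply: measurable_funM; last exact: measurable_stable_kernel.
exact: (measurableT_comp (continuous_measurable_rV (C1_continuous V1)) (measurable_addl_rV x)).
Qed.

Let m0 z : 0 <= Num.min 1 (`|z| ^+ 2). Proof. by rewrite le_min ler01 exprn_ge0. Qed.

Let W0 z : 0 <= W z. Proof. by rewrite mulr_ge0 ?stable_kernel_ge0. Qed.

Let mW : measurable_fun setT (fun z : 'rV[R]_d => W z).
Proof.
apply: measurable_funM; last exact: measurable_stable_kernel.
apply: measurable_minr => //; apply: measurable_funX.
by apply: continuous_measurable_rV; exact: norm_continuous.
Qed.

(** Since [V >= 0], the negative part of the jump integrand is integrable, so an upper bound on the
    generator makes the positive part integrable too; the lower bound on [k] then removes the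
    coefficient. *)
Lemma far_integral_lty x : (generator alpha b k V x < +oo)%E ->
  (\int[leb]_z (far_integrand x z)%:E < +oo)%E.
Proof.
move=> Vx; have [Lam Lam0 hL] := local_bounds lam0 lam_nd Lbk (`|x| + 1).
have [_ kx] := hL x (ltr_pwDr ltr01 (lexx _)).
have k1 z : Lam^-1 <= k x z by case/andP: (kx z).
have k2 z : k x z <= Lam by case/andP: (kx z).
have [B B0 hB] := local_jump_bound `|x| V2.
pose h z := (jump V x z * (k x z * L z))%:E.
have mh : measurable_fun setT h.
  by apply/measurable_EFinP; exact: (measurable_jump_integrand1 alpha Lbk x V1).
pose c := (B + V x * d%:R ^+ 2) * Lam.
have c0 : 0 <= c by rewrite mulr_ge0 ?addr_ge0 ?mulr_ge0 ?exprn_ge0// ltW.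
(* Small jumps are bounded below by Taylor's formula, large ones by [- V x]. *)
have jge z : - ((B + V x * d%:R ^+ 2) * Num.min 1 (`|z| ^+ 2)) <= jump V x z.
  have [z1|z1] := leP (enorm z) 1.
    have := hB x z (lexx _) z1; rewrite ler_norml => /andP[h1 _]; apply: le_trans h1.
    by rewrite lerN2 mulrDl lerDl !mulr_ge0 ?exprn_ge0.
  rewrite jump_far// mulrDl -mulrA.
  have := ler_wpM2l (V0 x) (min_far d0 z1); rewrite mulr1 => h1.
  by have := V0 (x + z); have := mulr_ge0 B0 (m0 z); lra.
have hneg : (\int[leb]_z h^\- z < +oo)%E.
  apply: (@le_lt_trans _ _ (c * @jump_mass R d alpha)%:E); last exact: ltry.
  rewrite EFinM -jump_massE// -ge0_integralZl//; last 2 first.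
  - exact/measurable_EFinP.
  - by move=> z _; rewrite lee_fin.
  apply: ge0_le_integral => //.
  - exact: measurable_funeneg.
  - by apply: measurable_funeM; exact/measurable_EFinP.
  - move=> z _; rewrite funenegE ge_max -EFinM -EFinN !lee_fin (mulr_ge0 c0 (W0 z)) andbT.
    rewrite lerNl (_ : c * _ = ((B + V x * d%:R ^+ 2) * Num.min 1 (`|z| ^+ 2)) * (Lam * L z)); last by rewrite /c; ring.
    rewrite -mulNr; apply: (@le_trans _ _ (- ((B + V x * d%:R ^+ 2) * Num.min 1 (`|z| ^+ 2)) * (k x z * L z))).
      rewrite !mulNr lerN2 ler_wpM2l//; first by rewrite mulr_ge0// addr_ge0// mulr_ge0// exprn_ge0.
      by rewrite ler_wpM2r ?stable_kernel_ge0.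
    by rewrite ler_wpM2r.
have hpos : (\int[leb]_z h^\+ z < +oo)%E.
  move: Vx; rewrite /generator => Vx.
  have : (\int[leb]_z h z < +oo)%E.
    by rewrite ltNge; apply/negP; rewrite leye_eq => /eqP hoo; move: Vx; rewrite [X in (_ + X)%E]hoo.
  rewrite integralE ltNge => H; rewrite ltNge; apply: contra H; rewrite !leye_eq => /eqP ->.
  by rewrite addye// -ltNye ltNye_eq; apply/orP; left; rewrite fin_numN ge0_fin_numE// integral_ge0.
(* [c2] pays for the term [V x] that [jump] subtracts from [V (x + z)] at large [z]. *)
pose c2 := Lam ^+ 2 * V x * d%:R ^+ 2.
have c20 : 0 <= c2 by rewrite !mulr_ge0 ?exprn_ge0// ltW.
apply: (@le_lt_trans _ _ (\int[leb]_z (Lam%:E * h^\+ z + c2%:E * (W z)%:E))%E).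
  apply: ge0_le_integral => //.
  - by move=> z _; rewrite lee_fin.
  - exact/measurable_EFinP.
  - by apply: emeasurable_funD; apply: measurable_funeM; [exact: measurable_funepos|exact/measurable_EFinP].
  - move=> z _; rewrite /far_integrand; case: ifPn => [z1|].
      by rewrite adde_ge0 ?mule_ge0 ?lee_fin// ltW.
    rewrite -ltNge => z1.
    apply: (@le_trans _ _ (Lam%:E * h z + c2%:E * (W z)%:E)%E); last first.
      apply: leeD2r; apply: lee_wpmul2l; first by rewrite lee_fin ltW.
      by rewrite funeposE le_max lexx.
    rewrite /h jump_far// -!EFinM -EFinD lee_fin.
    have L0 := stable_kernel_ge0 alpha z.
    have h1 : V (x + z) * L z <= Lam * (V (x + z) * (k x z * L z)).
      rewrite (_ : Lam * _ = (Lam * k x z) * (V (x + z) * L z)); last ring.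
      rewrite ler_peMl ?mulr_ge0//.
      by rewrite -(@mulfV _ Lam) ?gt_eqF// ler_wpM2l// ltW.
    have h2 : Lam * (V x * (k x z * L z)) <= c2 * W z.
      rewrite (_ : c2 * _ = Lam * (V x * (Lam * (d%:R ^+ 2 * Num.min 1 (`|z| ^+ 2)) * L z))); last by rewrite /c2; ring.
      rewrite ler_wpM2l ?(ltW Lam0)// ler_wpM2l// ler_wpM2r//.
      by rewrite (le_trans (k2 z))// ler_peMr ?(ltW Lam0)// min_far.
    by rewrite mulrBl mulrBr; lra.
rewrite ge0_integralD//; last 4 first.
- by move=> z _; rewrite mule_ge0// lee_fin ltW.
- by apply: measurable_funeM; exact: measurable_funepos.
- by move=> z _; rewrite mule_ge0// lee_fin.
- by apply: measurable_funeM; exact/measurable_EFinP.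
rewrite ge0_integralZl//; last 2 first.
- exact: measurable_funepos.
- by rewrite lee_fin ltW.
rewrite ge0_integralZl//; last 2 first.
- exact/measurable_EFinP.
- by move=> z _; rewrite lee_fin.
apply: lte_add_pinfty; last by rewrite jump_massE// -EFinM ltry.
by apply: lte_mul_pinfty => //; rewrite lee_fin ltW.
Qed.

End drift.
End minorization_estimate.

(** * Upper bounds for the generator of truncated Lyapunov functions *)

Section drift_on_balls.
Variables (R : realType) (d : nat) (alpha : R) (lam : R -> R).
Variables (b : 'rV[R]_d -> 'rV[R]_d) (k : 'rV[R]_d -> 'rV[R]_d -> R).
Hypotheses (d0 : (0 < d)%N) (alpha12 : 1 < alpha < 2).
Hypotheses (lam0 : forall r, 0 <= r -> 0 < lam r).
Hypothesis lam_nd : forall r s, 0 <= r -> r <= s -> lam r <= lam s.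
Hypothesis Lbk : class_L lam b k.
Variables (V : 'rV[R]_d -> R).
Hypotheses (V2 : C2 V) (V0 : forall x, 0 <= V x).
Implicit Types (f : 'rV[R]_d -> R) (x z : 'rV[R]_d).

Local Notation L := (@stable_kernel R d alpha).
Local Notation leb := (lebesgue_rV R d).
Local Notation W z := (Num.min 1 (`|z| ^+ 2) * L z).
Local Notation far := (far_integrand alpha V).

Let V1 : C1 V. Proof. by case: V2. Qed.

Let kL_ge0 x z : 0 <= k x z * L z.
Proof. by rewrite mulr_ge0 ?stable_kernel_ge0//; case: Lbk => _ _ /(_ x z)/ltW. Qed.

Let far_ge0 x z : 0 <= far x z.
Proof. by rewrite /far_integrand; case: ifP => // _; rewrite mulr_ge0 ?stable_kernel_ge0. Qed.

Let menorm : measurable_fun setT (fun z : 'rV[R]_d => enorm z <= 1).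
Proof. by apply: measurable_fun_ler => //; exact: measurable_enorm. Qed.

Let mfar x : measurable_fun setT (far x).
Proof.
apply: measurable_fun_ifT => //; apply: measurable_funM; last exact: measurable_stable_kernel.
exact: (measurableT_comp (continuous_measurable_rV (C1_continuous V1)) (measurable_addl_rV x)).
Qed.

Let m0 z : 0 <= Num.min 1 (`|z| ^+ 2). Proof. by rewrite le_min ler01 exprn_ge0. Qed.

Let W0 z : 0 <= W z. Proof. by rewrite mulr_ge0 ?stable_kernel_ge0. Qed.

Let mW : measurable_fun setT (fun z : 'rV[R]_d => W z).
Proof.
apply: measurable_funM; last exact: measurable_stable_kernel.
apply: measurable_minr => //; apply: measurable_funX.
by apply: continuous_measurable_rV; exact: norm_continuous.
Qed.

(* After the translation z = x1 - x + z', the kernels at z and z' are comparable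
   as soon as |z'| is large with respect to |x1 - x|. *)
Lemma far_integral_bound x1 (r : R) : 0 <= r ->
  (\int[leb]_z (far x1 z)%:E < +oo)%E -> exists2 M, 0 <= M &
  forall x, `|x| <= r -> (\int[leb]_z (far x z)%:E <= M%:E)%E.
Proof.
move=> r0 J1.
pose p := d%:R + alpha; pose s := `|x1| + r + 1.
have s1 : 1 <= s by rewrite /s; have := normr_ge0 x1; lra.
(* For [|z| < 2 * s] the point [x1 + z] lies in this ball, and only the bound of [V] on it is
   used. *)
have [Mb Mb0 hM] := continuous_bounded_ball (`|x1| + 2 * s) (C1_continuous V1).
pose J := fine (\int[leb]_z (far x1 z)%:E).
have J0 : 0 <= J by rewrite fine_ge0// integral_ge0// => z _; rewrite lee_fin.
have JE : (\int[leb]_z (far x1 z)%:E = J%:E)%E.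
  by rewrite fineK// ge0_fin_numE// integral_ge0// => z _; rewrite lee_fin.
(* The ratio of the kernel bounds at [|z| / 2] and at [d * |z|]; for [|z| >= 2 * s] the translated
   jump [x1 - x + z] has norm at least [|z| / 2]. *)
pose C := (2 * d%:R) `^ p; have C0 : 0 <= C by exact: powR_ge0.
pose D := Mb * (d%:R ^+ 2 * @jump_mass R d alpha).
have D0 : 0 <= D by rewrite !mulr_ge0 ?exprn_ge0// jump_mass_ge0.
exists (C * J + D) => [|x xr]; first exact: addr_ge0 (mulr_ge0 C0 J0) D0.
pose y := x1 - x.
have ys : `|y| <= s by rewrite /y /s; have := ler_normB x1 x; lra.
have farT z : (0 <= (far x z)%:E)%E by rewrite lee_fin.
rewrite -(ge0_integral_translation_rV y)//; last exact/measurable_EFinP.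
pose g z : R := Mb * (d%:R ^+ 2 * W z).
have g0 z : 0 <= g z by apply: mulr_ge0 => //; apply: mulr_ge0; [exact: exprn_ge0|exact: W0].
have mg : measurable_fun setT g by apply: measurable_funM => //; apply: measurable_funM.
apply: (@le_trans _ _ (\int[leb]_z (C%:E * (far x1 z)%:E + (g (y + z))%:E))%E).
  apply: ge0_le_integral => //.
  - by apply/measurable_EFinP; exact: (measurableT_comp (mfar x) (measurable_addl_rV y)).
  - apply: emeasurable_funD; first by apply: measurable_funeM; exact/measurable_EFinP.
    by apply/measurable_EFinP; exact: (measurableT_comp mg (measurable_addl_rV y)).
  - move=> z _; rewrite -EFinM -EFinD lee_fin.
    rewrite {1}/far_integrand; case: ifPn => [_|]; first by rewrite addr_ge0// mulr_ge0.
    rewrite -ltNge => yz1.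
    rewrite (_ : x + (y + z) = x1 + z); last by rewrite /y addrA (addrC x) subrK.
    have [zs|zs] := leP (2 * s) `|z|.
      rewrite ler_wpDr//.
      have z1 : 1 < enorm z by rewrite (lt_le_trans _ (norm_le_enorm z))//; lra.
      rewrite /far_integrand ifF; last by apply/negbTE; rewrite -ltNge.
      rewrite mulrCA ler_wpM2l//.
      have z0 : z != 0 by rewrite -normr_gt0; lra.
      have yz : `|z| / 2 <= `|y + z|.
        by have := ler_normB (y + z) y; rewrite addrAC subrr add0r; lra.
      have zh0 : 0 < `|z| / 2 by rewrite divr_gt0// normr_gt0.
      apply: (le_trans (stable_kernel_le alpha12 zh0 yz)).
      apply: le_trans (ler_wpM2l C0 (stable_kernel_ge alpha12 z0 (lexx _))).
      have e : ((d%:R * `|z|) `^ p)^-1 = C^-1 * ((`|z| / 2) `^ p)^-1.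
        rewrite -invfM -powRM ?mulr_ge0//.
        by congr (_ `^ _)^-1; field.
      by rewrite e mulrA mulfV ?mul1r// gt_eqF// powR_gt0// mulr_gt0// ltr0n.
    rewrite ler_wpDl ?mulr_ge0// /g mulrA [leRHS]mulrAC.
    have Lyz := stable_kernel_ge0 alpha (y + z).
    rewrite mulrAC -mulrA; apply: ler_pM => //.
      apply: le_trans (ler_norm _) (hM _ _).
      by have := ler_normD x1 z; lra.
    rewrite mulrA ler_peMl// min_far//.
rewrite ge0_integralD//; last 4 first.
- by move=> z _; rewrite mule_ge0// lee_fin.
- by apply: measurable_funeM; exact/measurable_EFinP.
- by move=> z _; rewrite lee_fin.
- by apply/measurable_EFinP; exact: (measurableT_comp mg (measurable_addl_rV y)).
rewrite (@ge0_integral_translation_rV _ _ y (fun z => (g z)%:E)); last 2 first.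
- by move=> z; rewrite lee_fin.
- exact/measurable_EFinP.
rewrite EFinD; apply: leeD.
  rewrite ge0_integralZl//; last 2 first.
  - exact/measurable_EFinP.
  - by move=> z _; rewrite lee_fin.
  by rewrite JE EFinM.
rewrite /D mulrA EFinM -jump_massE//.
under eq_integral do rewrite /g mulrA EFinM.
rewrite ge0_integralZl//; [exact/measurable_EFinP|by move=> z _; rewrite lee_fin|].
by rewrite lee_fin mulr_ge0// exprn_ge0.
Qed.

(** The bound is uniform over truncations [f] of [V]: the gradient and the small jumps at [x] only
    see the region where [f = V], and the large jumps are dominated by the tail integral of [V],
    which is finite at [x1] and therefore bounded on the ball. *)
Lemma generator_ball_bound x1 (r : R) : 0 <= r ->
  (generator alpha b k V x1 < +oo)%E -> exists2 M, 0 <= M &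
  forall f, C2 f -> (forall x, 0 <= f x <= V x) ->
    (forall y, `|y| < r + 2 -> f y = V y) ->
  forall x, `|x| <= r -> (generator alpha b k f x <= M%:E)%E.
Proof.
move=> r0 /(far_integral_lty d0 alpha12 lam0 lam_nd Lbk V2 V0) J1.
have [M M0 hM] := far_integral_bound r0 J1.
have [Lam Lam0 hL] := local_bounds lam0 lam_nd Lbk (r + 1).
have [B B0 hB] := local_jump_bound r V2.
have /choice[G GP] : forall i, exists N, forall x, `|x| <= r -> `|partial i V x| <= N.
  by move=> i; have [N _ hN] := continuous_bounded_ball r (C1_continuous_partial (i := i) V1); exists N.
pose S := \sum_i `|G i|; have S0 : 0 <= S by exact: sumr_ge0.
pose D := B * Lam * @jump_mass R d alpha.
have D0 : 0 <= D by rewrite !mulr_ge0 ?jump_mass_ge0// ltW.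
exists (d%:R * Lam * S + (D + Lam * M)).
  apply: addr_ge0; last by rewrite addr_ge0// mulr_ge0// ltW.
  by rewrite !mulr_ge0// ltW.
move=> f f2 f01 fV x xr; have [f1 _] := f2.
have [bx kx] := hL x (le_lt_trans xr (ltr_pwDr ltr01 (lexx _))).
have fx : f x = V x by apply: fV; lra.
have gx : grad f x = grad V x.
  apply/rowP => i; rewrite !mxE; apply: near_eq_partial.
  have oN : open [set y : 'rV[R]_d | `|y - 0| < r + 2] by exact: open_norm_lt.
  near=> y; apply: fV; rewrite -[y]subr0; near: y.
  by apply: (open_nbhs_nbhs (conj oN _)); rewrite /= subr0; lra.
rewrite /generator EFinD; apply: leeD.
  rewrite gx lee_fin (le_trans (ler_norm _))// (le_trans (dot_bound _ _))//.
  apply: ler_pM => //; rewrite ?mulr_ge0//.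
    by rewrite ler_wpM2l// (le_trans (norm_le_enorm _)).
  apply/rV_normP => // i; rewrite mxE (le_trans (GP i x xr))// (le_trans (ler_norm _))//.
  by rewrite /S (bigD1 i)//= lerDl sumr_ge0.
have mh : measurable_fun setT (fun z => (jump f x z * (k x z * L z))%:E).
  by apply/measurable_EFinP; exact: (measurable_jump_integrand1 alpha Lbk x f1).
apply: (@le_trans _ _ (\int[leb]_z (fun z => (jump f x z * (k x z * L z))%:E)^\+ z)%E).
  rewrite integralE -[leRHS]sube0; apply: leeB => //.
  by apply: integral_ge0 => z _; exact: funeneg_ge0.
apply: (@le_trans _ _ (\int[leb]_z ((B * Lam)%:E * (W z)%:E + Lam%:E * (far x z)%:E))%E).
  apply: ge0_le_integral => //.
  - exact: measurable_funepos.
  - by apply: emeasurable_funD; apply: measurable_funeM; exact/measurable_EFinP.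
  - move=> z _; rewrite funeposE ge_max -!EFinM -EFinD !lee_fin.
    apply/andP; split; last first.
      apply: addr_ge0; [apply: mulr_ge0 (W0 z)|apply: mulr_ge0 (far_ge0 x z)]; last exact: ltW.
      by rewrite mulr_ge0// ltW.
    rewrite /far_integrand; case: ifPn => [z1|].
      rewrite mulr0 addr0.
      have -> : jump f x z = jump V x z.
        rewrite /jump fx gx fV//; have := norm_le_enorm z; have := ler_normD x z; lra.
      apply: le_trans (_ : (B * Num.min 1 (`|z| ^+ 2)) * (Lam * L z) <= _); last first.
        by rewrite le_eqVlt; apply/orP; left; apply/eqP; ring.
      apply: (@le_trans _ _ (`|jump V x z| * (k x z * L z))).
        by rewrite ler_wpM2r// ler_norm.
      apply: ler_pM => //; first exact: hB.
      by rewrite ler_wpM2r ?stable_kernel_ge0//; case/andP: (kx z).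
    rewrite -ltNge => z1; apply: ler_wpDl.
      by apply: mulr_ge0 (W0 z); rewrite mulr_ge0// ltW.
    rewrite jump_far// [leRHS]mulrCA.
    apply: (@le_trans _ _ (V (x + z) * (k x z * L z))).
      rewrite ler_wpM2r//; have /andP[_ h1] := f01 (x + z); have /andP[h2 _] := f01 x; lra.
    rewrite ler_wpM2l// ler_wpM2r ?stable_kernel_ge0//; by case/andP: (kx z).
rewrite ge0_integralD//; last 4 first.
- move=> z _; apply: mule_ge0; rewrite lee_fin; last exact: W0.
  by rewrite mulr_ge0// ltW.
- by apply: measurable_funeM; exact/measurable_EFinP.
- by move=> z _; apply: mule_ge0; rewrite lee_fin; [exact: ltW|exact: far_ge0].
- by apply: measurable_funeM; exact/measurable_EFinP.
rewrite EFinD; apply: leeD.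
  rewrite ge0_integralZl//; last 3 first.
  - exact/measurable_EFinP.
  - by move=> z _; rewrite lee_fin; exact: W0.
  - by rewrite lee_fin mulr_ge0// ltW.
  by rewrite jump_massE// -EFinM.
rewrite ge0_integralZl//; last 3 first.
- exact/measurable_EFinP.
- by move=> z _; rewrite lee_fin.
- by rewrite lee_fin ltW.
by rewrite EFinM lee_wpmul2l ?lee_fin ?(ltW Lam0)// hM.
Unshelve. all: end_near. Qed.

End drift_on_balls.

Section drift_test_functions.
Variables (R : realType) (d : nat) (alpha : R) (lam : R -> R).
Variables (b : 'rV[R]_d -> 'rV[R]_d) (k : 'rV[R]_d -> 'rV[R]_d -> R).
Hypotheses (d0 : (0 < d)%N) (alpha12 : 1 < alpha < 2).
Hypotheses (lam0 : forall r, 0 <= r -> 0 < lam r).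
Hypothesis lam_nd : forall r s, 0 <= r -> r <= s -> lam r <= lam s.
Hypothesis Lbk : class_L lam b k.

Lemma norm_const_mx (a : R) : `|const_mx a : 'rV[R]_d| = `|a|.
Proof.
apply/eqP; rewrite eq_le; apply/andP; split.
  by apply/rV_normP => // i; rewrite mxE.
by have := coord_le_norm (const_mx a : 'rV[R]_d) (Ordinal d0); rewrite mxE.
Qed.

Lemma compact_sub_ball (K : set 'rV[R]_d) : compact K ->
  exists2 r, 0 <= r & forall x, K x -> `|x| <= r.
Proof.
move=> /compact_bounded[M [_ KM]]; exists (`|M| + 1) => [|x Kx].
  by rewrite addr_ge0.
by apply: KM => //; rewrite (le_lt_trans (ler_norm M))// ltrDl.
Qed.

Lemma drift_test_functions : lyapunov_stable alpha b k ->
  exists (V : 'rV[R]_d -> R) (r eps M : R),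
  [/\ [/\ C2 V, forall x, 0 <= V x, 0 <= r, 0 < eps & 0 <= M] &
    forall m, r + 2 <= m -> exists f,
    [/\ C2 f, forall x, m + 1 < `|x| -> f x = 0, forall x, 0 <= f x <= V x,
        forall x, `|x| <= m -> f x = V x &
        forall x, `|x| < m -> (generator alpha b k f x <=
          (M * \1_[set y | `|y| <= r] x - eps)%:E)%E]].
Proof.
move=> [V' [K [eps [V'2 [ell lV'] cK eps0 HV']]]].
pose V x := V' x + - ell.
have V'1 : C1 V' by case: V'2.
have V2 : C2 V := C2D V'2 (C2_cst d (- ell)).
have V1 : C1 V by case: V2.
have V0 x : 0 <= V x by rewrite subr_ge0; apply: lV'; exists x.
have HV x : ~ K x -> (generator alpha b k V x <= (- eps)%:E)%E.
  by move=> Kx; rewrite /V generator_cst_add//; exact: HV'.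
have [r r0 Kr] := compact_sub_ball cK.
(* A point off [K]: only there does the Lyapunov condition say that the generator of [V] is not
   [+oo]. *)
pose x1 : 'rV[R]_d := const_mx (r + 1).
have Vx1 : (generator alpha b k V x1 < +oo)%E.
  apply: le_lt_trans (ltry (- eps)); apply: HV => /Kr.
  by rewrite norm_const_mx ger0_norm; lra.
have [M M0 hM] := generator_ball_bound d0 alpha12 lam0 lam_nd Lbk V2 V0 r0 Vx1.
exists V, r, eps, (M + eps); split; first by split=> //; lra.
move=> m rm; pose f x := V x * bump 0 (m + 1) x.
have m1 : 0 < m + 1 by lra.
have f2 : C2 f := C2M V2 (C2_bump 0 (m + 1)).
have fV x : `|x| <= m -> f x = V x.
  by move=> xm; rewrite /f bump_eq1 ?mulr1// subr0 lerD2r.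
have f0V x : 0 <= f x <= V x.
  by rewrite mulr_ge0 ?bump_ge0//= ler_piMr// bump_le1.
have f1 : C1 f by case: f2.
exists f; split=> // [x xm|x xm].
  by rewrite /f bump_eq0 ?mulr0// subr0 ltW.
rewrite indicE; have [xr|xr] := leP `|x| r.
  rewrite mem_set// mulr1 addrK; apply: hM => // y yr; apply: fV; lra.
rewrite memNset ?mulr0 ?sub0r; last by move=> /=; rewrite leNgt xr.
(* Between the radii [r] and [m], [f <= V] with equality near [x], so truncation can only lower the
   generator. *)
apply: le_trans (HV x _); last by move=> /Kr; rewrite leNgt xr.
apply: (generator_le _ Lbk f1 V1) => [y|]; first by case/andP: (f0V y).
have oN : open [set y : 'rV[R]_d | `|y - 0| < m] by exact: open_norm_lt.
near=> y; apply: fV; rewrite ltW// -[y]subr0; near: y.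
by apply: (open_nbhs_nbhs (conj oN _)); rewrite /= subr0.
Unshelve. all: end_near. Qed.

End drift_test_functions.

(** * Time grids and optional stopping *)

Section countable_index.
Context d1 d2 (T : measurableType d1) (S : measurableType d2).

Lemma measurable_fun_countable_index (N : T -> nat) (Y : nat -> T -> S) :
  (forall j, measurable [set t | N t = j]) ->
  (forall j, measurable_fun setT (Y j)) ->
  measurable_fun setT (fun t => Y (N t) t).
Proof.
move=> mN mY _ B mB; rewrite setTI.
have -> : (fun t => Y (N t) t) @^-1` B = \bigcup_j ([set t | N t = j] `&` Y j @^-1` B).
  apply/seteqP; split=> [t Bt|t [j _ [/= <- //]]].
  by exists (N t).
apply: bigcupT_measurable => j; apply: measurableI => //.
by rewrite -[X in measurable X]setTI; exact: mY.
Qed.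

End countable_index.

Lemma grid_itv (R : realType) n (s : R) : 0 <= s ->
  (Num.truncn (n.+1%:R * s))%:R / n.+1%:R <= s < (Num.truncn (n.+1%:R * s)).+1%:R / n.+1%:R.
Proof.
move=> s0; have ns0 : 0 <= n.+1%:R * s by rewrite mulr_ge0.
have /andP[h1 h2] := truncn_itv ns0.
by rewrite ler_pdivrMr// [s * _]mulrC h1/= ltr_pdivlMr// [s * _]mulrC.
Qed.

(** The grid point is the first one strictly after [s]; convergence along [s^'+] is what
    right-continuity of paths requires. *)
Lemma grid_cvg (R : realType) (s : R) : 0 <= s ->
  (fun n => (Num.truncn (n.+1%:R * s)).+1%:R / n.+1%:R) @ \oo --> s^'+.
Proof.
move=> s0; set t := fun n => _.
have c : t @ \oo --> s.
  apply: (@squeeze_cvgr _ _ _ _ (fun=> s) (fun n => s + n.+1%:R^-1)).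
  - near=> n; have /andP[h1 h2] := grid_itv n s0; rewrite (ltW h2)/=.
    by rewrite /t -natr1 mulrDl mul1r lerD2r.
  - exact: cvg_cst.
  - by rewrite -[X in _ --> X]addr0; apply: cvgD; [exact: cvg_cst|exact: cvg_harmonic].
move=> A sA; have H : \forall n \near \oo, s < t n -> A (t n) := c _ sA.
suff : \forall n \near \oo, A (t n) by [].
by apply: filterS H => n; apply; have /andP[_] := grid_itv n s0.
Unshelve. all: end_near. Qed.

Section optional_stopping.
Local Open Scope ereal_scope.
Context (R : realType) dO (Omega : measurableType dO) (P : probability Omega R).
Variables (F : R -> set_system Omega) (M : R -> Omega -> R) (T C : R).
Variable sigma : Omega -> R.
Hypothesis Fm : forall t A, (0 <= t)%R -> F t A -> measurable A.
Hypothesis Fmon : forall s t A, (0 <= s)%R -> (s <= t)%R -> F s A -> F t A.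
Hypothesis FD : forall t A B, F t A -> F t B -> F t (A `\` B).
Hypothesis FT : forall t, F t setT.
Hypothesis martM : martingale P F M.
Hypothesis MC : forall t w, (0 <= t <= T + 1)%R -> (`|M t w| <= C)%R.
Hypothesis Mrc : forall t w, (0 <= t)%R -> M ^~ w @ t^'+ --> M t w.
Hypothesis sigma_itv : forall w, (0 <= sigma w <= T)%R.
(** Strict inequality fits the half-open cells of the grid, and it is the form in which exit times
    are seen to be observable. *)
Hypothesis sigmaF : forall t, (0 <= t)%R -> F t [set w | (sigma w < t)%R].

(* The times (N + 1) / (n + 1) that follow sigma on a grid of mesh 1 / (n + 1)
   take finitely many values and decrease to sigma from the right. *)
Let N n w : nat := Num.truncn (n.+1%:R * sigma w).
Let tm n j : R := (j.+1%:R / n.+1%:R)%R.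

Let N_itv n w : ((N n w)%:R / n.+1%:R <= sigma w < tm n (N n w))%R.
Proof.
by apply: grid_itv; case/andP: (sigma_itv w).
Qed.

Let N_eq n j : [set w | N n w = j] =
  [set w | (sigma w < tm n j)%R] `\` [set w | (sigma w < j%:R / n.+1%:R)%R].
Proof.
apply/seteqP; split=> [w /= <-|w /= [h1 /negP]].
  by have /andP[h1 h2] := N_itv n w; split=> //; apply/negP; rewrite -leNgt.
rewrite -leNgt => h2; apply: truncn_def.
rewrite -ler_pdivrMl// mulrC h2/= -ltr_pdivlMl//.
by rewrite [ltRHS]mulrC.
Qed.

Let tm_ge0 n j : (0 <= tm n j)%R. Proof. by rewrite divr_ge0. Qed.

Let FN n j : F (tm n j) [set w | N n w = j].
Proof.
rewrite N_eq; apply: FD; first exact: sigmaF.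
apply: (@Fmon (j%:R / n.+1%:R)%R); first by rewrite divr_ge0.
  by rewrite ler_pM2r ?invr_gt0// ler_nat.
by apply: sigmaF; rewrite divr_ge0.
Qed.

Let mN n j : measurable [set w | N n w = j].
Proof. exact: (Fm (tm_ge0 n j) (FN n j)). Qed.

Let mM t : (0 <= t)%R -> measurable_fun setT (M t).
Proof.
move=> t0; have [/measurable_int/measurable_EFinP//] := martM t0 (lexx t).
Qed.

Let Mn n w : R := M (tm n (N n w)) w.

Let mMn n : measurable_fun setT (Mn n).
Proof.
apply: (@measurable_fun_countable_index _ _ _ _ (N n) (fun j => M (tm n j))) => // j.
exact: mM.
Qed.

Let tm_le n w : (tm n (N n w) <= sigma w + n.+1%:R^-1)%R.
Proof.
have /andP[h _] := N_itv n w.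
by rewrite /tm -natr1 mulrDl mul1r lerD2r.
Qed.

Let tm_leT n w : (0 <= tm n (N n w) <= T + 1)%R.
Proof.
rewrite tm_ge0/= (le_trans (tm_le n w))// lerD//; first by case/andP: (sigma_itv w).
by rewrite invf_le1// ler1n.
Qed.

Let MnC n w : (`|Mn n w| <= C)%R. Proof. exact: MC (tm_leT n w). Qed.

Let cvg_Mn w : Mn ^~ w @ \oo --> M (sigma w) w.
Proof.
have /andP[s0 _] := sigma_itv w.
exact: (cvg_comp _ _ (grid_cvg s0) (@Mrc _ w s0)).
Qed.

Lemma measurable_stopped : measurable_fun setT (fun w => M (sigma w) w).
Proof. by apply: (measurable_fun_cvg mMn) => w _; exact: cvg_Mn. Qed.

Let T0 : (0 <= T)%R.
Proof. by have /andP[h1 h2] := sigma_itv point; exact: le_trans h2. Qed.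

Let M_int t : (0 <= t)%R -> P.-integrable setT (EFin \o M t).
Proof. by move=> t0; case: (martM t0 (lexx t)). Qed.

Let M_const s t A : (0 <= s)%R -> (s <= t)%R -> F s A ->
  \int[P]_(w in A) (M s w)%:E = \int[P]_(w in A) (M t w)%:E.
Proof. by move=> s0 st FA; have [_ _ _ /(_ A FA)] := martM s0 st. Qed.

(** The event [N n = j] belongs to [F (tm n j)], and the grid times following [sigma <= T] are at
    most [T + 1]. On each of these finitely many events the martingale property replaces
    [M (tm n j)] by [M (T + 1)]. *)
Let expectation_Mn n : \int[P]_w (Mn n w)%:E = \int[P]_w (M 0%R w)%:E.
Proof.
pose J := (Num.truncn (n.+1%:R * T)).+1.
pose A j := [set w | N n w = j].
have NJ w : (N n w < J)%N.
  rewrite ltnS; apply: le_truncn; rewrite ler_wpM2l//.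
  by case/andP: (sigma_itv w).
have AT : \big[setU/set0]_(j <- iota 0 J) A j = setT.
  rewrite -bigcup_seq; apply/seteqP; split=> // w _.
  have h : N n w \in iota 0 J by rewrite mem_iota leq0n add0n NJ.
  by exists (N n w).
have tA : trivIset [set` iota 0 J] A.
  by apply/trivIsetP => i j _ _ ij; apply/seteqP; split=> // w [Ai Aj]; move/eqP: ij; rewrite -[i]Ai -[j]Aj.
have split_int (f : Omega -> R) : measurable_fun setT f ->
    \int[P]_w (f w)%:E = \sum_(j <- iota 0 J) \int[P]_(w in A j) (f w)%:E.
  move=> mf; rewrite -AT; apply: integral_bigsetU_EFin => //.
  - by move=> j; exact: mN.
  - exact: iota_uniq.
  - by rewrite AT; exact/measurable_EFinP.
have JT j : (j \in iota 0 J) -> (tm n j <= T + 1)%R.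
  rewrite mem_iota leq0n add0n ltnS => jJ.
  have nT0 : (0 <= n.+1%:R * T)%R by rewrite mulr_ge0.
  have /andP[h _] := truncn_itv nT0.
  rewrite /tm ler_pdivrMr// mulrDl mul1r -natr1 mulrC lerD ?ler1n//.
  by rewrite (le_trans _ h)// ler_nat.
rewrite split_int//.
transitivity (\sum_(j <- iota 0 J) \int[P]_(w in A j) (M (T + 1) w)%:E).
  apply: eq_big_seq => j jJ; rewrite -(M_const (tm_ge0 n j) (JT j jJ) (FN n j)).
  by apply: eq_integral => w /[!inE] wj; rewrite /Mn wj.
rewrite -split_int; last by apply: mM; rewrite addr_ge0.
by rewrite -(@M_const 0%R)// addr_ge0.
Qed.

Theorem optional_stopping : \int[P]_w (M (sigma w) w)%:E = \int[P]_w (M 0%R w)%:E.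
Proof.
have [|||||_ _ cv] := @dominated_convergence _ _ _ P setT measurableT
  (fun n w => (Mn n w)%:E) (fun w => (M (sigma w) w)%:E) (cst C%:E).
- by move=> n; exact/measurable_EFinP.
- exact/measurable_EFinP/measurable_stopped.
- by apply: aeW => w _; apply: cvg_EFin; [near=> n|exact: cvg_Mn].
- by apply: finite_measure_integrable_cst.
- by apply: aeW => w n _; rewrite lee_fin MnC.
rewrite -(cvg_lim _ cv)//; under eq_fun do rewrite expectation_Mn.
by rewrite lim_cst.
Unshelve. all: end_near. Qed.

End optional_stopping.

(** * Filtrations, exit times and path regularity *)

Section filtrations.
Variables (R : realType) (d : nat) (dO : measure_display).
Variables (Omega : measurableType dO) (X : R -> Omega -> 'rV[R]_d).
Hypothesis mX : forall t, 0 <= t -> measurable_fun setT (X t).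
Hypothesis cX : forall w, cadlag X w.
Implicit Types (s t r : R) (w : Omega) (A B : set Omega).

Local Notation raw := (raw_filtration X).
Local Notation F := (filtration X).

Lemma raw_measurable t A : raw t A -> measurable A.
Proof.
apply: smallest_sub; first exact: sigma_algebra_measurable.
move=> _ [s [B [s0 st mB ->]]]; rewrite -[X in measurable X]setTI; exact: mX.
Qed.

Lemma raw_le s t A : s <= t -> raw s A -> raw t A.
Proof.
move=> st; apply: smallest_sub; first exact: smallest_sigma_algebra.
move=> _ [u [B [u0 us mB ->]]]; apply: sub_sigma_algebra.
by exists u, B; split=> //; exact: le_trans st.
Qed.

Lemma raw_path s t (B : set 'rV[R]_d) : 0 <= s -> s <= t -> measurable B -> raw t (X s @^-1` B).
Proof. by move=> s0 st mB; apply: sub_sigma_algebra; exists s, B. Qed.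

Lemma rawT t : raw t setT.
Proof. exact: (@measurableT _ (g_sigma_algebraType _)). Qed.

Lemma rawD t A B : raw t A -> raw t B -> raw t (A `\` B).
Proof. by move=> rA rB; exact: (@measurableD _ (g_sigma_algebraType _)). Qed.

Lemma raw_bigcap t (A : (set Omega)^nat) : (forall n, raw t (A n)) -> raw t (\bigcap_n A n).
Proof. by move=> rA; exact: (@bigcapT_measurable _ (g_sigma_algebraType _)). Qed.

Lemma filtration_measurable t A : F t A -> measurable A.
Proof. by move=> /(_ (t + 1)) H; apply: (@raw_measurable (t + 1)); apply: H; rewrite /= ltrDl. Qed.

Lemma filtration_le s t A : s <= t -> F s A -> F t A.
Proof. by move=> st FA u /= tu; apply: FA => /=; exact: le_lt_trans tu. Qed.

Lemma filtrationD t A B : F t A -> F t B -> F t (A `\` B).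
Proof. by move=> FA FB u tu; apply: rawD; [exact: FA|exact: FB]. Qed.

Lemma filtrationT t : F t setT. Proof. by move=> u _; exact: rawT. Qed.

Section exit_time.
Variables (r T : R).
Hypothesis T0 : 0 <= T.

(** Adding [T] to the set caps the time and keeps the infimum off its default value on the empty
    set. The strict inequality defines an open set, so that an exit is visible at rational times. *)
Definition exit_time w : R := inf ([set t | 0 <= t /\ r < `|X t w|] `|` [set T]).

Let S w := [set t | 0 <= t /\ r < `|X t w|] `|` [set T].

Let S_lb w : lbound (S w) 0.
Proof. by move=> t [[]//|->]. Qed.

Let S_has w : has_inf (S w).
Proof. by split; [exists T; right|exists 0; exact: S_lb]. Qed.

Lemma exit_time_itv w : 0 <= exit_time w <= T.
Proof.
rewrite /exit_time lb_le_inf/=; [|by exists T; right|exact: S_lb].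
by apply: ge_inf; [by case: (S_has w)|right].
Qed.

Lemma before_exit w s : 0 <= s -> s < exit_time w -> `|X s w| <= r.
Proof.
move=> s0 st; rewrite leNgt; apply/negP => rX.
have : exit_time w <= s by apply: ge_inf; [by case: (S_has w)|left].
by rewrite leNgt st.
Qed.

Lemma exit_timeE w : (forall s, 0 <= s <= T -> `|X s w| <= r) -> exit_time w = T.
Proof.
move=> h; apply/eqP; rewrite eq_le; have /andP[_ ->] /= := exit_time_itv w.
apply: lb_le_inf; first by exists T; right.
move=> t [[t0 rX]|->//]; rewrite leNgt; apply/negP => tT.
by have := h t; rewrite t0 (ltW tT) => /(_ isT); rewrite leNgt rX.
Qed.

Lemma cadlag_norm_right t w : 0 <= t -> (fun s => `|X s w|) @ t^'+ --> `|X t w|.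
Proof. by move=> t0; apply: cvg_norm; case: (cX w) => + _; exact. Qed.

(** If the norm were below [r] at the exit time, right-continuity would keep it there for a while,
    and the infimum would be larger. *)
Lemma at_exit w : exit_time w < T -> r <= `|X (exit_time w) w|.
Proof.
move=> sT; rewrite leNgt; apply/negP => Xr.
have /andP[s0 _] := exit_time_itv w.
have [e /= e0 He] : \forall s \near (exit_time w)^'+, `|X s w| < r.
  by move: (@cadlag_norm_right _ w s0) => /cvgr_lt/(_ r Xr).
pose u := Num.min (exit_time w + e) T.
have su : exit_time w < u by rewrite lt_min sT ltrDl e0.
have : u <= exit_time w.
  apply: lb_le_inf; first by exists T; right.
  move=> t [[t0 rX]|->]; last by rewrite ge_min lexx orbT.
  have st : exit_time w <= t by apply: ge_inf; [by case: (S_has w)|left].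
  rewrite ge_min; apply/orP; left; rewrite leNgt; apply/negP => te.
  have : `|X t w| < r.
    move: st; rewrite le_eqVlt => /orP[/eqP <-//|st].
    by apply: He => //=; rewrite distrC ger0_norm ?subr_ge0 ?ltW// ltrBlDl.
  by rewrite ltNge (ltW rX).
by rewrite leNgt su.
Qed.

Let rat_exceed (q : rat) t : set Omega :=
  if 0 <= ratr q :> R then if ratr q < t then [set w | r < `|X (ratr q) w|] else set0 else set0.

(** By right-continuity, a path beyond radius [r] at time [u] stays beyond it on an interval to the
    right of [u], which contains a rational. The condition [t <= T] keeps the added point [T] from
    counting as an exit before [t]. *)
Lemma exit_time_ltE t : t <= T ->
  [set w | exit_time w < t] = \bigcup_(q in [set: rat]) rat_exceed q t.
Proof.
move=> tT; apply/seteqP; split=> [w /= st|w [q _]].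
  have ts : 0 < t - exit_time w by rewrite subr_gt0.
  have [u [[u0 rX]|->]] := inf_adherent ts (S_has w); last first.
    by rewrite -/(exit_time w) addrC subrK ltNge tT.
  rewrite -/(exit_time w) addrC subrK => ut.
  have [e /= e0 He] : \forall s \near u^'+, r < `|X s w|.
    by move: (@cadlag_norm_right _ w u0) => /cvgr_gt/(_ r rX).
  have /rat_in_itvoo[q] : u < Num.min (u + e) t by rewrite lt_min ut ltrDl e0.
  rewrite in_itv/= lt_min => /and3P[uq que qt]; exists q => //.
  rewrite /rat_exceed (le_trans u0 (ltW uq)) qt /=; apply: He => //=.
  by rewrite distrC ger0_norm ?subr_ge0 ?ltW// ltrBlDl.
rewrite /rat_exceed; case: ifPn => // q0; case: ifPn => // qt /= rX.
by apply: le_lt_trans qt; apply: ge_inf; [by case: (S_has w)|left].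
Qed.

Lemma raw_exit_time_lt t : 0 <= t -> raw t [set w | exit_time w < t].
Proof.
move=> t0; have [tT|Tt] := leP t T; last first.
  rewrite (_ : mkset _ = setT); first exact: rawT.
  apply/seteqP; split=> // w _ /=; apply: le_lt_trans Tt.
  by have /andP[] := exit_time_itv w.
rewrite exit_time_ltE//.
apply: (@countable_bigcupT_measurable _ (g_sigma_algebraType _)) => // q.
rewrite /rat_exceed; case: ifPn => q0; last exact: (@measurable0 _ (g_sigma_algebraType _)).
case: ifPn => qt; last exact: (@measurable0 _ (g_sigma_algebraType _)).
apply: (raw_path q0 (ltW qt) (B := [set x : 'rV[R]_d | r < `|x|])).
rewrite -[X in measurable X]setTI; apply: measurable_fun_ltr => //.
by apply: continuous_measurable_rV; exact: norm_continuous.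
Qed.

Lemma filtration_exit_time_lt t : 0 <= t -> F t [set w | exit_time w < t].
Proof. by move=> t0 u /= tu; apply: raw_le (raw_exit_time_lt t0); exact: ltW. Qed.

(** Only the strict events are in the raw filtration; the closed one is the intersection of the
    events [exit_time w < t + e n], which lies in the right-continuous filtration at [t]. *)
Lemma exit_stopping_time : stopping_time X (fun w => (exit_time w)%:E).
Proof.
split=> [w|t t0 u /= tu]; first by rewrite lee_fin; have /andP[] := exit_time_itv w.
(* With this choice [t + e n <= u] for every [n]. *)
pose e n := (u - t) / n.+1%:R.
have ut : 0 < u - t by rewrite subr_gt0.
have e0 n : 0 < e n by rewrite divr_gt0.
have -> : [set w | ((exit_time w)%:E <= t%:E)%E] = \bigcap_n [set w | exit_time w < t + e n].
  apply/seteqP; split=> w /=.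
    by rewrite lee_fin => st n _ /=; rewrite (le_lt_trans st)// ltrDl.
  move=> h; rewrite lee_fin; apply/ler_addgt0Pr => eps eps0.
  have [n _ hn] := near_infty_natSinv_lt (PosNum (divr_gt0 eps0 ut)).
  apply: (le_trans (ltW (h n I))); rewrite lerD2l.
  have /ltW := hn n (leqnn n); rewrite /= ler_pdivlMr// => hh.
  by rewrite /e mulrC.
apply: raw_bigcap => n; apply: (@raw_le (t + e n)).
  rewrite -lerBrDl /e ler_pdivrMr//; apply: ler_peMr; [exact: ltW|by rewrite ler1n].
by apply: raw_exit_time_lt; rewrite addr_ge0// ltW// e0.
Qed.

End exit_time.

(** One-sided limits bound the path near each time, and compactness of [[0, T]] makes the bound
    uniform. *)
Lemma cadlag_bounded T w : exists M, forall s, 0 <= s <= T -> `|X s w| <= M.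
Proof.
have cov : forall s : R, `[0, T]%classic s ->
    \forall u \near s & M \near +oo, 0 <= u -> `|X u w| <= M.
  move=> s; rewrite /= in_itv/= => /andP[s0 _].
  have [M1 H1] : exists M, \forall u \near s^'+, `|X u w| <= M.
    exists (`|X s w| + 1); move: (@cadlag_norm_right _ w s0) => /cvgr_le; apply.
    by rewrite ltrDl.
  have [M2 H2] : exists M, \forall u \near s^'-, 0 <= u -> `|X u w| <= M.
    move: s0; rewrite le_eqVlt => /orP[/eqP <-|s0].
      (* To the left of 0 there are only negative times, which the guard [0 <= u] excludes. *)
      by exists 0, 1 => //= u _; rewrite ltNge => /negP u0 uu.
    have [_ /(_ _ s0)/cvg_ex[l Xl]] := cX w.
    exists (`|l| + 1).
    have : (fun u => `|X u w|) @ s^'- --> `|l| by exact: cvg_norm.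
    move=> /cvgr_le/(_ (`|l| + 1)); rewrite ltrDl ltr01 => /(_ isT).
    by apply: filterS.
  have {}H1 : \forall u \near s, s < u -> `|X u w| <= M1 := H1.
  have {}H2 : \forall u \near s, u < s -> 0 <= u -> `|X u w| <= M2 := H2.
  have H : \forall M \near +oo, [/\ M1 <= M, M2 <= M & `|X s w| <= M].
    by near=> M; split; near: M; apply: nbhs_pinfty_ge; exact: num_real.
  have H3 : \forall u \near s, forall M, [/\ M1 <= M, M2 <= M & `|X s w| <= M] ->
      0 <= u -> `|X u w| <= M.
    near=> u => M [M1M M2M XM] u0; have [us|us|->//] := ltgtP u s.
    - by apply: le_trans M2M; exact: (near H2 u).
    - by apply: le_trans M1M; exact: (near H1 u).
  exists ([set u | forall M, [/\ M1 <= M, M2 <= M & `|X s w| <= M] -> 0 <= u -> `|X u w| <= M],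
    [set M | [/\ M1 <= M, M2 <= M & `|X s w| <= M]]); first by split.
  by move=> [u M] [/= hu hM]; exact: hu.
have H := (compact_near_coveringP _).1 (@segment_compact R 0 T) _ _ _ _ cov.
have [M HM] := filter_ex (H _).
exists M => u u0T; apply: HM; first by rewrite /= in_itv/=.
by case/andP: u0T.
Unshelve. all: end_near. Qed.

(** Right-continuity makes the path a limit of its values on grids. Negative times, at which nothing
    is assumed, are sent to 0. *)
Lemma measurable_path : measurable_fun setT (fun p : R * Omega => X (Num.max p.1 0) p.2).
Proof.
pose pos (p : R * Omega) := Num.max p.1 0.
have p0 p : 0 <= pos p by rewrite le_max lexx orbT.
have mpos : measurable_fun setT pos.
  by apply: measurable_maxr => //; exact: measurable_fst.
pose N n (p : R * Omega) : nat := Num.truncn (n.+1%:R * pos p).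
pose Y n j (p : R * Omega) := X (j.+1%:R / n.+1%:R) p.2.
have mY n j : measurable_fun setT (Y n j).
  have m2 : measurable_fun setT (fun p : R * Omega => p.2) by exact: measurable_snd.
  by apply: (measurableT_comp (mX _) m2); rewrite divr_ge0.
have mN n j : measurable [set p | N n p = j].
  have -> : [set p | N n p = j] = [set p | j%:R <= n.+1%:R * pos p] `&` [set p | n.+1%:R * pos p < j.+1%:R].
    apply/seteqP; split=> p /=.
      move=> /eqP; rewrite truncn_eq ?mulr_ge0// => /andP[h1 h2]; split=> //.
    by move=> [h1 h2]; apply/eqP; rewrite truncn_eq ?mulr_ge0// h1 h2.
  have mn : measurable_fun setT (fun p => n.+1%:R * pos p) by exact: measurable_funM.
  by apply: measurableI; rewrite -[X in measurable X]setTI;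
    [exact: measurable_fun_ler|exact: measurable_fun_ltr].
apply: measurable_rV => i.
pose Z n p := Y n (N n p) p 0 i.
apply: (@measurable_fun_cvg _ _ _ _ Z) => [n|p _].
  apply: (measurableT_comp (measurable_coord i)).
  exact: measurable_fun_countable_index.
have [rc _] := cX p.2.
have H : (fun n => Y n (N n p) p) @ \oo --> X (pos p) p.2.
  exact: (cvg_comp _ _ (grid_cvg (p0 p)) (rc _ (p0 p))).
exact: (cvg_comp _ _ H (@coord_continuous _ _ _ 0 i _)).
Qed.

End filtrations.

Lemma bounded_integrable (R : realType) d (T : measurableType d) (P : probability T R)
    (f : T -> R) (C : R) : measurable_fun setT f -> (forall x, `|f x| <= C) ->
  P.-integrable setT (EFin \o f).
Proof.
move=> mf fC; apply: (@le_integrable _ _ _ P setT measurableT _ (cst C%:E)).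
- exact/measurable_EFinP.
- by move=> x _ /=; rewrite lee_fin (le_trans (fC x))// ler_norm.
- by apply: finite_measure_integrable_cst.
Qed.

(** * Time integrals along a path *)

Section path_integral.
Variables (R : realType) (d : nat) (dO : measure_display).
Variables (Omega : measurableType dO) (X : R -> Omega -> 'rV[R]_d).
Hypothesis mX : forall t, 0 <= t -> measurable_fun setT (X t).
Hypothesis cX : forall w, cadlag X w.
Implicit Types (s t r : R) (w : Omega) (h : 'rV[R]_d -> R).

Local Notation mu := (@lebesgue_measure R).

Definition path_integral h t w : R := \int[mu]_(s in `[0%R, t]) h (X s w).

Lemma measurable_path1 h w : measurable_fun setT h ->
  measurable_fun setT (fun s => h (X (Num.max s 0) w)).
Proof.
move=> mh; apply: (measurableT_comp mh).
exact: (measurableT_comp (measurable_path mX cX) (pair2_measurable w)).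
Qed.

Lemma measurable_path_itv h t w : measurable_fun setT h ->
  measurable_fun `[0%R, t] (fun s => h (X s w)).
Proof.
move=> mh; apply: (eq_measurable_fun (fun s => h (X (Num.max s 0) w))).
  by move=> s; rewrite inE/= in_itv/= => /andP[s0 _]; rewrite (max_idPl s0).
by apply: measurable_funTS; exact: measurable_path1.
Qed.

Lemma integrable_path h t w (C : R) : measurable_fun setT h -> (forall x, `|h x| <= C) ->
  mu.-integrable `[0%R, t] (EFin \o (fun s => h (X s w))).
Proof.
move=> mh hC; apply: (@le_integrable _ _ _ mu _ _ _ (cst C%:E)) => //.
- by apply/measurable_EFinP; exact: measurable_path_itv.
- by move=> s _ /=; rewrite lee_fin (le_trans (hC _))// ler_norm.
- apply/integrableP; split; first exact: measurable_cst.
  rewrite integral_cst//= lebesgue_measure_itv/=; case: ifP => _; last by rewrite mule0.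
  by rewrite -EFinB -EFinM ltry.
Qed.

Lemma path_integral_increment h s t w (C : R) : measurable_fun setT h ->
  (forall x, `|h x| <= C) -> 0 <= s -> s <= t ->
  `|path_integral h t w - path_integral h s w| <= C * (t - s).
Proof.
move=> mh hC s0 st; have ih := integrable_path t w mh hC.
rewrite /path_integral (Rintegral_itvB ih); [|by rewrite bnd_simp|by rewrite bnd_simp].
have sub : `]s, t] `<=` `[0, t] by apply: subset_itvr; rewrite bnd_simp.
have ih' : mu.-integrable `]s, t] (EFin \o (fun s => h (X s w))).
  exact: integrableS ih.
apply: (le_trans (le_normr_Rintegral _ ih')) => //.
have -> : C * (t - s) = \int[mu]_(x in `]s, t]) (cst C) x.
  rewrite Rintegral_cst//= lebesgue_measure_itv/= lte_fin; case: ifPn => //.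
  by rewrite -leNgt => ts; rewrite (@le_anti _ _ s t) ?st ?ts// subrr.
apply: le_Rintegral => //.
- by apply/integrable_norm.
- apply: integrableS (@integrable_path (fun=> C) t w `|C| _ _) => //.
Qed.

Lemma path_integral0 h w : path_integral h 0 w = 0.
Proof. by rewrite /path_integral set_itv1 Rintegral_set1. Qed.

Lemma path_integral_bound h t w (C : R) : measurable_fun setT h ->
  (forall x, `|h x| <= C) -> 0 <= t -> `|path_integral h t w| <= C * t.
Proof.
move=> mh hC t0; have := path_integral_increment w mh hC (lexx 0) t0.
by rewrite path_integral0 !subr0.
Qed.

Lemma path_integral_cvg h t w (C : R) : measurable_fun setT h ->
  (forall x, `|h x| <= C) -> 0 <= t ->
  path_integral h ^~ w @ t^'+ --> path_integral h t w.
Proof.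
move=> mh hC t0; have C0 : 0 <= C by exact: le_trans (hC 0).
have C1 : 0 < C + 1 by rewrite ltr_wpDl.
apply/cvgrPdist_le => e e0; near=> s.
have ts : t < s by near: s; exact: nbhs_right_gt.
rewrite distrC (le_trans (path_integral_increment w mh hC t0 (ltW ts)))//.
apply: (@le_trans _ _ ((C + 1) * (s - t))).
  by apply: ler_wpM2r; rewrite ?lerDl// subr_ge0 ltW.
rewrite mulrC -ler_pdivlMr// lerBlDl; near: s.
by apply: nbhs_right_le; rewrite ltrDl divr_gt0.
Unshelve. all: end_near. Qed.

(** The comparison leaves out the endpoint [t], a null set: when [t] is an exit time, the process
    may already be outside the ball then. *)
Lemma path_integral_le h1 h2 t w (C1 C2 : R) :
  measurable_fun setT h1 -> measurable_fun setT h2 ->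
  (forall x, `|h1 x| <= C1) -> (forall x, `|h2 x| <= C2) ->
  (forall s, 0 <= s < t -> h1 (X s w) <= h2 (X s w)) ->
  path_integral h1 t w <= path_integral h2 t w.
Proof.
move=> m1 m2 b1 b2 h12.
have sub : `[0, t[ `<=` `[0, t] by apply: subset_itvl; rewrite bnd_simp.
have I1 : mu.-integrable `[0, t[ (EFin \o (fun s => h1 (X s w))).
  exact: integrableS (integrable_path t w m1 b1).
have I2 : mu.-integrable `[0, t[ (EFin \o (fun s => h2 (X s w))).
  exact: integrableS (integrable_path t w m2 b2).
rewrite /path_integral -!Rintegral_itv_bndo_bndc//.
by apply: le_Rintegral => // s /=; rewrite in_itv/=; exact: h12.
Qed.

Lemma path_integral_cst (c : R) t w : 0 <= t -> path_integral (fun=> c) t w = c * t.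
Proof.
move=> t0; rewrite /path_integral (Rintegral_cst _ _ c)//= lebesgue_measure_itv/= lte_fin.
by case: ifPn => [_|]; rewrite ?sube0// -leNgt => t0'; rewrite (@le_anti _ _ t 0) ?t0 ?t0'// !mulr0.
Qed.

Lemma path_integral_affine h (M c : R) t w (C : R) : measurable_fun setT h ->
  (forall x, `|h x| <= C) -> 0 <= t ->
  path_integral (fun x => M * h x + c) t w = M * path_integral h t w + c * t.
Proof.
move=> mh hC t0; rewrite -(path_integral_cst c w t0) /path_integral.
have hMC x : `|M * h x| <= `|M| * C by rewrite normrM ler_wpM2l.
rewrite RintegralD//=.
- by rewrite RintegralZl//; exact: integrable_path hC.
- exact: (@integrable_path (fun x => M * h x) t w _ (measurable_funM (measurable_cst _) mh) hMC).
- exact: (@integrable_path (fun=> c) t w `|c| (measurable_cst _)).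
Qed.

End path_integral.

(** * Strong Markov property at finite stopping times *)

Section strong_markov_process.
Local Open Scope ereal_scope.
Variables (R : realType) (d : nat) (dO : measure_display).
Variables (Omega : measurableType dO) (X : R -> Omega -> 'rV[R]_d).
Variable P : probability 'rV[R]_d R -> probability Omega R.
Hypothesis XP : strong_markov_process X P.
Implicit Types (nu : probability 'rV[R]_d R) (s t r T : R) (w : Omega) (B : set 'rV[R]_d).

Let mX t : (0 <= t)%R -> measurable_fun setT (X t).
Proof. by case: XP => + _ _ _ _; exact. Qed.

Let cX w : cadlag X w.
Proof. by case: XP. Qed.

Lemma initial_integral nu (f : 'rV[R]_d -> R) (C : R) : measurable_fun setT f ->
  (forall x, `|f x| <= C)%R -> \int[P nu]_w (f (X 0%R w))%:E = \int[nu]_x (f x)%:E.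
Proof.
move=> mf fC; have m0 := mX (lexx 0).
have init B : measurable B -> pushforward (P nu) (X 0) B = nu B by case: XP => _ _ + _ _; exact.
rewrite -(@eq_measure_integral _ _ _ _ nu (pushforward (P nu) (X 0))); last by move=> A mA _; exact: init.
rewrite integral_pushforward//=; first exact/measurable_EFinP.
rewrite preimage_setT; apply: (@bounded_integrable _ _ _ (P nu) (fun w => f (X 0%R w)) C) => //.
exact: measurableT_comp.
Qed.

Section stopping.
Variable sigma : Omega -> R.
Hypothesis st : stopping_time X (EFin \o sigma).

Let stT : stopped_filtration X (EFin \o sigma) setT.
Proof.
split; first exact: (@measurableT _ (g_sigma_algebraType _)).
by move=> t t0; rewrite setTI; case: st => _ + ; exact.
Qed.

Let s0 w : (0 <= sigma w)%R. Proof. by case: st => + _ => /(_ w); rewrite lee_fin. Qed.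

Let strong nu t B : (0 <= t)%R -> measurable B ->
  is_cond_expectation (P nu) (stopped_filtration X (EFin \o sigma))
      (fun w => \1_B (X (sigma w + t)%R w))
      (fun w => fine (P_at P (X (sigma w) w) (X t @^-1` B))).
Proof.
move=> t0 mB; have [_ _ _ _ sm] := XP.
have m1 : measurable_fun setT (\1_B : 'rV[R]_d -> R) by exact: measurable_indic.
have b1 : bounded_func (\1_B : 'rV[R]_d -> R).
  by exists 1%R => x; rewrite ger0_norm// ?indicE ?lern1 ?leq_b1.
have := sm nu _ st t t0 _ m1 b1.
have -> : [set v | (EFin \o sigma) v < +oo] = setT by apply/seteqP; split=> // w _ /=; exact: ltry.
rewrite (_ : (fun w => _) = (fun w => \1_B (X (sigma w + t)%R w))); last first.
  by apply/funext => w; rewrite indicT mul1r.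
rewrite [X in is_cond_expectation _ _ _ X](_ : _ =
  (fun w => fine (P_at P (X (sigma w) w) (X t @^-1` B))))//.
apply/funext => w; rewrite indicT mul1r; congr fine; rewrite unlock.
rewrite (_ : (fun w => _) = (fun w => (\1_(X t @^-1` B) w)%:E)) ?integral_indic ?setIT//.
by rewrite -[X in measurable X]setTI; exact: mX.
Qed.

(** Measurability is read off the strong Markov property, whose integrability clause covers the
    indicator of [X (sigma w + t) w] being in [B]; any initial law serves. *)
Lemma measurable_stopped_position t : (0 <= t)%R ->
  measurable_fun setT (fun w => X (sigma w + t)%R w).
Proof.
move=> t0 _ B mB; rewrite setTI.
have [/measurable_int/measurable_EFinP m1 _ _ _] := strong \d_(0%R : 'rV[R]_d) t0 mB.
rewrite (_ : _ @^-1` B = (fun w => \1_B (X (sigma w + t)%R w) : R) @^-1` [set 1%R]).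
  by rewrite -[X in measurable X]setTI; exact: m1.
by apply/seteqP; split=> w /=; rewrite indicE; case: (boolP (_ \in _)); rewrite ?inE ?notin_setE//=
  => _ /esym/eqP; rewrite oner_eq0.
Qed.

Lemma strong_markov_set nu t B : (0 <= t)%R -> measurable B ->
  P nu ((fun w => X (sigma w + t)%R w) @^-1` B) =
  \int[P nu]_w P_at P (X (sigma w) w) (X t @^-1` B).
Proof.
move=> t0 mB; have [_ _ _ /(_ _ stT)] := strong nu t0 mB.
rewrite (_ : (fun w => (\1_B _)%:E) = (fun w => (\1_((fun w => X (sigma w + t)%R w) @^-1` B) w)%:E))//.
rewrite integral_indic ?setIT//; last first.
  by rewrite -[X in measurable X]setTI; exact: measurable_stopped_position.
move=> ->; apply: eq_integral => w _; rewrite fineK// fin_num_measure//.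
by rewrite -[X in measurable X]setTI; exact: mX.
Qed.

End stopping.

Lemma constant_stopping_time s : (0 <= s)%R -> stopping_time X (EFin \o (fun=> s)).
Proof.
move=> s0; split=> [w|t t0]; first by rewrite lee_fin.
have [st|ts] := boolP (s <= t)%R.
  by rewrite (_ : mkset _ = setT); [exact: filtrationT|apply/seteqP; split=> // w _ /=; rewrite lee_fin].
rewrite (_ : mkset _ = setT `\` setT); first by apply: filtrationD; exact: filtrationT.
by rewrite setDv; apply/seteqP; split=> // w /=; rewrite lee_fin (negPf ts).
Qed.

Lemma chapman_kolmogorov nu s t B : (0 <= s)%R -> (0 <= t)%R -> measurable B ->
  P nu (X (s + t)%R @^-1` B) = \int[P nu]_w P_at P (X s w) (X t @^-1` B).
Proof. by move=> s0 t0 mB; exact: (strong_markov_set (constant_stopping_time s0)). Qed.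

Section exit_position.
Variables (r T : R).
Hypothesis T0 : (0 <= T)%R.

Lemma measurable_exit_time : measurable_fun setT (exit_time X r T).
Proof.
apply: (@measurability _ _ _ _ _ _ (@RGenInftyO.G R)); first exact: RGenInftyO.measurableE.
move=> _ [_ [t ->] <-]; rewrite setTI.
have [t0|t0] := leP 0%R t.
  have := filtration_measurable mX (filtration_exit_time_lt cX r T0 t0).
  by rewrite (_ : mkset _ = exit_time X r T @^-1` `]-oo, t[)//; apply/seteqP; split=> w /=; rewrite in_itv.
rewrite (_ : _ @^-1` _ = set0)//; apply/seteqP; split=> // w /=; rewrite in_itv/= => h.
by have /andP[+ _] := exit_time_itv X r T0 w; rewrite leNgt (lt_trans h).
Qed.

Lemma measurable_exit_position : measurable_fun setT (fun w => X (exit_time X r T w) w).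
Proof.
have := measurable_stopped_position (exit_stopping_time cX r T0) (lexx 0).
by under eq_fun do rewrite addr0.
Qed.

End exit_position.
End strong_markov_process.

(** * Dynkin's formula at exit times *)

Section dynkin.
Local Open Scope ereal_scope.
Variables (R : realType) (d : nat) (dO : measure_display).
Variables (Omega : measurableType dO) (X : R -> Omega -> 'rV[R]_d).
Variable P : probability 'rV[R]_d R -> probability Omega R.
Variable I : ('rV[R]_d -> R) -> 'rV[R]_d -> \bar R.
Hypothesis XP : associated_process X P I.

Let mX t : (0 <= t)%R -> measurable_fun setT (X t).
Proof. by case: XP => -[+ _ _ _ _] _; exact. Qed.

Let cX w : cadlag X w.
Proof. by case: XP => -[]. Qed.

Variables (f g : 'rV[R]_d -> R) (C : R).
Hypotheses (f2 : C2b f) (mg : measurable_fun setT g).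
Hypotheses (gC : forall x, (`|g x| <= C)%R) (If : forall x, I f x = (g x)%:E).
Variables (r T : R).
Hypothesis T0 : (0 <= T)%R.

Let sigma := exit_time X r T.

Let cf : continuous f. Proof. by case: f2 => -[[]]. Qed.

Let mf : measurable_fun setT f. Proof. exact: continuous_measurable_rV. Qed.

Let M t w : R := (f (X t w) - f (X 0%R w) - path_integral X g t w)%R.

Let martM nu : martingale (P nu) (filtration X) M.
Proof.
have [_ /(_ nu f f2)] := XP.
rewrite (_ : (fun t w => _) = M)//; apply/funext => t; apply/funext => w.
rewrite /M /path_integral /Rintegral; congr (_ - fine _)%R.
by apply: eq_integral => s _; exact: If.
Qed.

Let f_cvg t w : (0 <= t)%R -> (fun s => f (X s w)) @ t^'+ --> f (X t w).
Proof.
move=> t0; apply: continuous_cvg; first exact: cf.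
by case: (cX w) => + _; exact.
Qed.

Let Mrc t w : (0 <= t)%R -> M ^~ w @ t^'+ --> M t w.
Proof.
move=> t0; apply: cvgB; last exact: (@path_integral_cvg _ _ _ _ X mX cX g t w C).
by apply: cvgB; [exact: f_cvg|exact: cvg_cst].
Qed.

Let C0 : (0 <= C)%R. Proof. exact: le_trans (gC 0%R). Qed.

Let s_itv w : (0 <= sigma w <= T)%R. Proof. exact: exit_time_itv. Qed.

Let M_stopped_measurable (nu : probability 'rV[R]_d R) : measurable_fun setT (fun w => M (sigma w) w).
Proof.
apply: (@measurable_stopped _ _ _ (P nu) (filtration X) M T sigma) => //.
- by move=> t A _; exact: filtration_measurable.
- by move=> s t A _; exact: filtration_le.
- exact: filtrationD.
- by move=> t t0; exact: filtration_exit_time_lt.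
Qed.

Definition dynkin_term w : R := (f (X (sigma w) w) - path_integral X g (sigma w) w)%R.

Let dynkin_termE w : dynkin_term w = (M (sigma w) w + f (X 0%R w))%R.
Proof. by rewrite /dynkin_term /M; ring. Qed.

Lemma measurable_dynkin_term : measurable_fun setT dynkin_term.
Proof.
rewrite (_ : dynkin_term = fun w => M (sigma w) w + f (X 0%R w))%R; last exact/funext/dynkin_termE.
apply: measurable_funD; first exact: (M_stopped_measurable \d_(0%R : 'rV[R]_d)).
exact: measurableT_comp (mX (lexx 0%R)).
Qed.

Lemma dynkin_term_bound : exists D, forall w, (`|dynkin_term w| <= D)%R.
Proof.
have [_ [B fB] _ _] := f2; exists (B + C * T)%R => w.
have /andP[s0 sT] := s_itv w.
apply: (le_trans (ler_normB _ _)); apply: lerD => //.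
apply: (le_trans (path_integral_bound mX cX w mg gC s0)).
by rewrite ler_wpM2l.
Qed.

Lemma integrable_dynkin_term (nu : probability 'rV[R]_d R) : (P nu).-integrable setT (EFin \o dynkin_term).
Proof.
have [D hD] := dynkin_term_bound.
exact: (bounded_integrable _ measurable_dynkin_term hD).
Qed.

Lemma dynkin (nu : probability 'rV[R]_d R) : \int[P nu]_w (dynkin_term w)%:E = \int[nu]_x (f x)%:E.
Proof.
have [_ [B fB] _ _] := f2.
have i0 : (P nu).-integrable setT (EFin \o (fun w => f (X 0%R w))).
  apply: (bounded_integrable _ _ (fun w => fB (X 0%R w))).
  exact: measurableT_comp (mX (lexx 0%R)).
have iM : (P nu).-integrable setT (EFin \o (fun w => M (sigma w) w)).
  rewrite (_ : _ \o _ = (EFin \o dynkin_term) \- (EFin \o (fun w => f (X 0%R w)))).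
    exact: integrableB (integrable_dynkin_term nu) i0.
  by apply/funext => w /=; rewrite dynkin_termE -EFinB addrK.
under eq_integral do rewrite dynkin_termE EFinD.
rewrite integralD//= (initial_integral _ nu mf fB); last by case: XP.
rewrite -[RHS]add0e; congr (_ + _).
rewrite (@optional_stopping _ _ _ (P nu) (filtration X) M T (B + B + C * (T + 1))%R sigma) => //.
- rewrite integral0_eq// => w _.
  by rewrite /M path_integral0 subrr subr0.
- by move=> t A _; exact: filtration_measurable.
- by move=> s t A _; exact: filtration_le.
- exact: filtrationD.
- by move=> t; exact: filtrationT.
- move=> t w /andP[t0 tT]; apply: (le_trans (ler_normB _ _)); apply: lerD.
    by apply: (le_trans (ler_normB _ _)); apply: lerD.
  apply: (le_trans (path_integral_bound mX cX w mg gC t0)).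
  by rewrite ler_wpM2l.
- by move=> t t0; exact: filtration_exit_time_lt.
Qed.

Lemma dynkin_at x : \int[P_at P x]_w (dynkin_term w)%:E = (f x)%:E.
Proof.
rewrite /P_at dynkin integral_dirac ?diracT ?mul1e//.
exact/measurable_EFinP.
Qed.

(** The comparison goes through the positive part of [dynkin_term], because the integral of [Y] may
    be infinite. *)
Lemma dynkin_ge x (Y : Omega -> R) : measurable_fun setT Y -> (forall w, 0 <= Y w)%R ->
  (forall w, dynkin_term w <= Y w)%R -> (f x)%:E <= \int[P_at P x]_w (Y w)%:E.
Proof.
move=> mY Y0 dY; rewrite -dynkin_at.
apply: (@le_trans _ _ (\int[P_at P x]_w (Num.max (dynkin_term w) 0)%:E)).
  apply: le_integral => //; first exact: integrable_dynkin_term.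
    have [D hD] := dynkin_term_bound.
    apply: (@bounded_integrable _ _ _ (P_at P x) (fun w => Num.max (dynkin_term w) 0)%R D).
      exact: measurable_maxr measurable_dynkin_term _.
    move=> w; rewrite ger0_norm ?le_max ?lexx ?orbT// ge_max.
    by rewrite (le_trans (ler_norm _))//= (le_trans _ (hD w)).
  by move=> w _; rewrite lee_fin le_max lexx.
apply: ge0_le_integral => //.
- by move=> w _; rewrite lee_fin le_max lexx orbT.
- by apply/measurable_EFinP; exact: measurable_maxr measurable_dynkin_term _.
- exact/measurable_EFinP.
- by move=> w _; rewrite lee_fin ge_max dY Y0.
Qed.

End dynkin.

(** * The standard exponential law *)

Section standard_exponential.
Local Open Scope ereal_scope.
Variable R : realType.
Local Notation leb := (@lebesgue_measure R).
Local Notation pdf := (exponential_pdf (1%R : R)).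

Definition std_exponential : probability (measurableTypeR R) R :=
  exponential_distribution_exponential_prob__canonical__probability_measure_Probability (@ltr01 R).

Let pdf0 t : (0 <= pdf t)%R. Proof. exact: exponential_pdf_ge0. Qed.

Let mpdf : measurable_fun setT pdf. Proof. exact: measurable_exponential_pdf. Qed.

(** Dirac masses weighted by the density: bound to Lebesgue measure they give the exponential law,
    so that [integral_mbind] becomes the density formula. *)
Definition pdf_kernel (t : measurableTypeR R) : {measure set (measurableTypeR R) -> \bar R} :=
  mscale (NngNum (pdf0 t)) \d_t.

Let measurable_pdf_kernel (U : set (measurableTypeR R)) : measurable U ->
  measurable_fun setT (pdf_kernel ^~ U).
Proof.
move=> mU; rewrite /pdf_kernel /mscale/=.
apply: emeasurable_funM; first exact/measurable_EFinP.
by apply/measurable_EFinP; exact: measurable_indic.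
Qed.

HB.instance Definition _ := isKernel.Build _ _ _ _ R pdf_kernel measurable_pdf_kernel.

Lemma integral_std_exponential (f : R -> \bar R) : measurable_fun setT f -> (forall t, 0 <= f t) ->
  \int[std_exponential]_t f t = \int[leb]_t ((pdf t)%:E * f t).
Proof.
move=> mf f0; rewrite (@eq_measure_integral _ _ _ _ (mbind leb pdf_kernel)).
  rewrite integral_mbind//; apply: eq_integral => t _.
  by rewrite ge0_integral_mscale//= integral_dirac// diracT mul1e.
move=> A mA _.
suff : mbind leb pdf_kernel A = \int[leb]_(t in A) (pdf t)%:E by [].
rewrite /mbind [RHS]integral_mkcond; apply: eq_integral => t _.
transitivity ((pdf t)%:E * (\d_t A : \bar R)); first by [].
rewrite patchE diracE; case: ifPn => _; first by rewrite mule1.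
by rewrite mule0.
Qed.

Lemma std_exponential_memoryless (h : R) (f : R -> \bar R) : (0 <= h)%R ->
  measurable_fun setT f -> (forall t, 0 <= f t) ->
  \int[std_exponential]_(t in `[h, +oo[) f t =
  (expR (- h))%:E * \int[std_exponential]_t f (h + t)%R.
Proof.
move=> h0 mf f0.
have mD : measurable `[h, +oo[%classic by exact: measurable_itv.
rewrite integral_mkcond [LHS](@integral_std_exponential (f \_ `[h, +oo[)); last 2 first.
- by apply/(measurable_restrictT _ mD); exact: measurable_funTS.
- by move=> t; exact: erestrict_ge0.
have mfh : measurable_fun setT (fun t => f (h + t)%R).
  by apply: measurableT_comp => //; exact: measurable_funD.
rewrite integral_std_exponential// -ge0_integralZl//; last 2 first.
- by apply: emeasurable_funM => //; exact/measurable_EFinP.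
- by move=> t _; rewrite mule_ge0 ?lee_fin.
rewrite -(@ge0_integral_translation _ h); last 2 first.
- by move=> t; rewrite mule_ge0 ?lee_fin//; exact: erestrict_ge0.
- apply: emeasurable_funM; first exact/measurable_EFinP.
  by apply/(measurable_restrictT _ mD); exact: measurable_funTS.
apply: eq_integral => t _ /=; rewrite patchE mem_setE in_itv/= andbT.
have [t0|t0] := leP 0%R t; last first.
  by rewrite lerDl leNgt t0/= (lt0_exponential_pdf _ t0) mul0e mule0 mule0.
rewrite lerDl t0 !exponential_pdfE ?addr_ge0// !mulN1r !mul1r opprD expRD.
by rewrite EFinM muleA.
Qed.

Lemma std_exponential_tail (h : R) : (0 <= h)%R ->
  std_exponential `[h, +oo[%classic = (expR (- h))%:E.
Proof.
move=> h0; rewrite -[LHS]mul1e -integral_cst//.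
rewrite (std_exponential_memoryless (f := fun=> 1))//.
rewrite integral_cst//; transitivity ((expR (- h))%:E * (1 * 1)); last by rewrite !mule1.
by congr (_ * (_ * _)); exact: (@probability_setT _ _ _ std_exponential).
Qed.

Lemma std_exponential_setT : std_exponential setT = 1.
Proof. exact: (@probability_setT _ _ _ std_exponential). Qed.

(** This exchanges [t] and [Num.max t 0] under the integral, since the law charges only nonnegative
    times. *)
Lemma eq_integral_std_exponential (f g : R -> \bar R) :
  measurable_fun setT f -> (forall t, 0 <= f t) -> measurable_fun setT g -> (forall t, 0 <= g t) ->
  (forall t, (0 <= t)%R -> f t = g t) ->
  \int[std_exponential]_t f t = \int[std_exponential]_t g t.
Proof.
move=> mf f0 mg g0 fg; rewrite !integral_std_exponential//; apply: eq_integral => t _.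
have [t0|t0] := leP 0%R t; first by rewrite fg.
by rewrite lt0_exponential_pdf// !mul0e.
Qed.

(** The law shifted by [h] is [expR h] times the restriction of the original one to [[h, +oo[]. *)
Lemma std_exponential_shift_le (h : R) (f : R -> \bar R) : (0 <= h <= 1)%R ->
  measurable_fun setT f -> (forall t, 0 <= f t) ->
  \int[std_exponential]_t f (h + t)%R <= (expR 1)%:E * \int[std_exponential]_t f t.
Proof.
move=> /andP[h0 h1] mf f0.
have I0 : 0 <= \int[std_exponential]_t f (h + t)%R by exact: integral_ge0.
have -> : \int[std_exponential]_t f (h + t)%R =
    (expR h)%:E * \int[std_exponential]_(t in `[h, +oo[) f t.
  by rewrite std_exponential_memoryless// muleA -EFinM -expRD subrr expR0 mul1e.
apply: lee_pmul => //; first by apply: integral_ge0.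
  by rewrite lee_fin ler_expR.
by apply: ge0_subset_integral.
Qed.

Section primitive.
Variable h : R -> \bar R.
Hypotheses (mh : measurable_fun setT h) (h0 : forall t, 0 <= h t).

Let F (p : R * R) := ((0 <= p.2 <= p.1)%R%:R)%:E * h p.2.

Let mF : measurable_fun setT F.
Proof.
  apply: emeasurable_funM; last exact: measurableT_comp mh measurable_snd.
  rewrite (_ : (fun _ => _) = EFin \o \1_[set q : R * R | 0 <= q.2 <= q.1]%R); last first.
    by apply/funext => q /=; rewrite indicE; congr ((nat_of_bool _)%:R%:E); apply/idP/idP => [/mem_set|/set_mem].
  apply/measurable_EFinP/measurable_indic.
  rewrite (_ : mkset _ = [set q : R * R | 0 <= q.2]%R `&` [set q : R * R | q.2 <= q.1]%R); last first.
    by apply/seteqP; split=> q /= => [/andP[]|[-> ->]].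
  apply: measurableI; rewrite -[X in measurable X]setTI.
    by apply: measurable_fun_ler.
  by apply: measurable_fun_ler.
Qed.

Let F0 p : 0 <= F p. Proof. by rewrite mule_ge0. Qed.

Let primitiveE t : \int[leb]_(s in `[0%R, t]) h s = \int[leb]_s F (t, s).
Proof.
rewrite integral_mkcond; apply: eq_integral => s _.
rewrite patchE /F /= mem_setE in_itv/=; case: ifP => _; first by rewrite mul1e.
by rewrite mul0e.
Qed.

Lemma measurable_primitive : measurable_fun setT (fun t : R => \int[leb]_(s in `[0%R, t]) h s).
Proof.
rewrite (_ : (fun t => _) = fubini_F leb F); last by apply/funext => t; rewrite primitiveE.
by apply: measurable_fun_fubini_tonelli_F; [exact: mF|exact: F0].
Qed.

(** For rate 1 the tail probability at [s] equals the density at [s]; Tonelli's theorem does the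
    rest. *)
Lemma integral_std_exponential_primitive :
  \int[std_exponential]_t \int[leb]_(s in `[0%R, t]) h s = \int[std_exponential]_s h s.
Proof.
under eq_integral do rewrite primitiveE.
transitivity (\int[leb]_s \int[std_exponential]_t F (t, s)).
  by apply: fubini_tonelli; [exact: mF|exact: F0].
rewrite integral_std_exponential//; apply: eq_integral => s _; rewrite /F /=.
have [s0|s0] : (0 <= s)%R \/ (s < 0)%R by case: (leP 0%R s); [left|right].
all: swap 1 2.
  by rewrite lt0_exponential_pdf// mul0e; apply: (@integral0_eq _ _ _ std_exponential) => t _; rewrite leNgt s0 mul0e.
rewrite exponential_pdfE// mulN1r mul1r -std_exponential_tail//.
under eq_integral do rewrite /=.
have -> : std_exponential `[s, +oo[%classic = \int[std_exponential]_t ((s <= t)%R%:R)%:E.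
  rewrite -[in LHS](setIT `[s, +oo[%classic) -integral_indic//.
  by apply: eq_integral => t _; rewrite indicE mem_setE in_itv/= andbT.
rewrite -ge0_integralZr//.
  by apply: (@eq_integral _ _ _ std_exponential) => t _; rewrite s0.
apply/measurable_EFinP.
rewrite (_ : (fun _ => _) = \1_`[s, +oo[%classic); first exact: measurable_indic.
by apply/funext => t; rewrite indicE mem_setE in_itv/= andbT.
Qed.

End primitive.

End standard_exponential.

Lemma measurable_norm_le (R : realType) d (r : R) : measurable [set y : 'rV[R]_d | `|y| <= r].
Proof.
have mn : measurable_fun setT (fun y : 'rV[R]_d => `|y|).
  by apply: continuous_measurable_rV; exact: norm_continuous.
rewrite (_ : mkset _ = (fun y : 'rV[R]_d => `|y|) @^-1` `]-oo, r]%classic).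
  by rewrite -[X in measurable X]setTI; apply: mn => //; exact: measurable_itv.
by apply/seteqP; split=> y /=; rewrite in_itv.
Qed.

(** * Expected occupation times *)

Section occupation.
Local Open Scope ereal_scope.
Variables (R : realType) (d : nat) (dO : measure_display).
Variables (Omega : measurableType dO) (X : R -> Omega -> 'rV[R]_d).
Hypothesis mX : forall t, (0 <= t)%R -> measurable_fun setT (X t).
Hypothesis cX : forall w, cadlag X w.
Variables (h : 'rV[R]_d -> R) (C : R).
Hypotheses (mh : measurable_fun setT h) (h0 : forall x, (0 <= h x)%R).
Hypothesis hC : forall x, (`|h x| <= C)%R.

Local Notation leb := (@lebesgue_measure R).

Lemma path_integral_EFin t w :
  (path_integral X h t w)%:E = \int[leb]_(s in `[0%R, t]) (h (X s w))%:E.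
Proof.
rewrite /path_integral /Rintegral fineK//.
by apply: integrable_fin_num; [exact: measurable_itv|exact: (integrable_path mX cX t w mh hC)].
Qed.

Lemma path_integral_ge0 t w : (0 <= path_integral X h t w)%R.
Proof. by apply: Rintegral_ge0. Qed.

Lemma path_integral_nd s t w : (0 <= s)%R -> (s <= t)%R ->
  (path_integral X h s w <= path_integral X h t w)%R.
Proof.
move=> s0 st; rewrite -subr_ge0; have ih := integrable_path mX cX t w mh hC.
rewrite /path_integral (Rintegral_itvB ih); [|by rewrite bnd_simp|by rewrite bnd_simp].
exact: Rintegral_ge0.
Qed.

Let F t (p : Omega * R) : \bar R := (h (X (Num.max p.2 0) p.1) * \1_(`[0%R, t]%classic) p.2)%:E.

Let mF t : measurable_fun setT (F t).
Proof.
apply/measurable_EFinP; apply: measurable_funM.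
  apply: (measurableT_comp mh).
  apply: (measurableT_comp (g := fun p : Omega * R => (p.2, p.1)) (measurable_path mX cX)).
  by apply/measurable_fun_pair; [exact: measurable_snd|exact: measurable_fst].
apply: (measurableT_comp (f := \1_(`[0%R, t]%classic) : R -> R)) => //.
Qed.

Let F0 t p : 0 <= F t p.
Proof. by rewrite lee_fin mulr_ge0. Qed.

Let path_integralF t w : (path_integral X h t w)%:E = \int[leb]_s F t (w, s).
Proof.
rewrite path_integral_EFin integral_mkcond; apply: eq_integral => s _.
rewrite patchE /F /= indicE; case: ifPn => [|_]; last by rewrite mulr0.
by rewrite mulr1 mem_setE in_itv/= => /andP[s0 _]; rewrite (max_idPl s0).
Qed.

Lemma measurable_path_integral t : measurable_fun setT (path_integral X h t).
Proof.
apply/measurable_EFinP; rewrite (_ : _ \o _ = fubini_F leb (F t)).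
  by apply: measurable_fun_fubini_tonelli_F; [exact: mF|exact: F0].
by apply/funext => w; rewrite /= path_integralF.
Qed.

Lemma expectation_path_integral (Pr : probability Omega R) t :
  \int[Pr]_w (path_integral X h t w)%:E =
  \int[leb]_(s in `[0%R, t]) \int[Pr]_w (h (X (Num.max s 0%R) w))%:E.
Proof.
under eq_integral do rewrite path_integralF.
transitivity (\int[leb]_s \int[Pr]_w F t (w, s)).
  by apply: fubini_tonelli; [exact: mF|exact: F0].
rewrite [RHS]integral_mkcond.
apply: eq_integral => s _; rewrite patchE /F /= indicE; case: ifPn => _.
  by under eq_integral do rewrite mulr1.
by apply: integral0_eq => w _; rewrite mulr0.
Qed.

End occupation.

(** * Exit law and drift of the stable-like process *)

Section stable_like_process.
Local Open Scope ereal_scope.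
Variables (R : realType) (d : nat) (alpha K0 : R) (lam : R -> R).
Variables (b : 'rV[R]_d -> 'rV[R]_d) (k : 'rV[R]_d -> 'rV[R]_d -> R).
Variables (dO : measure_display) (Omega : measurableType dO).
Variables (X : R -> Omega -> 'rV[R]_d).
Variables (P : probability 'rV[R]_d R -> probability Omega R).
Hypotheses (d0 : (0 < d)%N) (alpha12 : (1 < alpha < 2)%R).
Hypothesis lam0 : forall r, (0 <= r)%R -> (0 < lam r)%R.
Hypothesis lam_nd : forall r s, (0 <= r)%R -> (r <= s)%R -> (lam r <= lam s)%R.
Hypotheses (Lbk : class_L lam b k) (growth : growth_condition b k K0).
Hypothesis XP : associated_process X P (generator alpha b k).

Let mX t : (0 <= t)%R -> measurable_fun setT (X t).
Proof. by case: XP => -[+ _ _ _ _] _; exact. Qed.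

Let cX w : cadlag X w.
Proof. by case: XP => -[]. Qed.

Lemma generator_bounded_fun (f : 'rV[R]_d -> R) (r : R) : (0 <= r)%R -> C2 f ->
  (forall x, (r < `|x|)%R -> f x = 0%R) ->
  exists (g : 'rV[R]_d -> R) (C : R), [/\ measurable_fun setT g, forall x, (`|g x| <= C)%R &
    forall x, generator alpha b k f x = (g x)%:E].
Proof.
move=> r0 f2 fr; have [C C0 HC] := generator_bound d0 alpha12 lam0 lam_nd Lbk growth r0 f2 fr.
exists (fun x => fine (generator alpha b k f x)), C; split.
- apply: measurableT_comp => //; apply: (measurable_generator alpha Lbk).
  by case: f2.
- by move=> x; have [g gC ->] := HC x.
- by move=> x; have [g gC ->] := HC x.
Qed.

(** The test function is 1 at [x] and 0 at the exit position if the exit occurs before time 1. Its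
    value at the stopped position is thus at most [sigma] in all cases, and Dynkin's formula gives
    [1 <= (1 + C) * E sigma]. *)
Lemma exit_time_expectation_ge r : (0 <= r)%R -> exists2 c, (0 < c)%R &
  forall x, (`|x| <= r)%R -> c%:E <= \int[P_at P x]_w (exit_time X (r + 1) 1 w)%:E.
Proof.
move=> r0; have r1 : (0 < r + 1)%R by rewrite ltr_wpDl.
have out (x : 'rV[R]_d) : (r + 1 < `|x|)%R -> bump 0 (r + 1) x = 0%R.
  by move=> xr; apply: bump_eq0 => //; rewrite subr0 ltW.
have [g [C [mg gC Hg]]] := generator_bounded_fun (ltW r1) (C2_bump 0 (r + 1)) out.
have C0 : (0 <= C)%R by exact: le_trans (gC 0%R).
have C1 : (0 < 1 + C)%R by rewrite ltr_pwDl.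
have s_itv w := exit_time_itv X (r + 1) ler01 w.
exists (1 + C)^-1%R; first by rewrite invr_gt0.
move=> x xr; rewrite -[X in X <= _]mule1 lee_pdivrMl// -ge0_integralZl//; last 3 first.
- by apply/measurable_EFinP; exact: (measurable_exit_time XP.1).
- by move=> w _; rewrite lee_fin; case/andP: (s_itv w).
- by rewrite lee_fin ltW.
apply: (@le_trans _ _ (bump 0 (r + 1) x)%:E); first by rewrite bump_eq1// subr0 lerD2r.
apply: (@dynkin_ge R d dO Omega X P _ XP _ g C (C2_support_C2b (C2_bump 0 (r + 1)) out)
  mg gC Hg (r + 1)%R 1%R ler01 x (fun w => (1 + C) * exit_time X (r + 1) 1 w)%R).
- by apply: measurable_funM => //; exact: (measurable_exit_time XP.1).
- by move=> w; apply: mulr_ge0; [exact: ltW|case/andP: (s_itv w)].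
- move=> w; have /andP[s0 _] := s_itv w; rewrite /dynkin_term mulrDl mul1r; apply: lerD.
    have [s1|s1] := ltP (exit_time X (r + 1) 1 w) 1%R.
      by rewrite bump_eq0 ?subr0//; apply: (at_exit cX).
    by rewrite (le_trans _ s1)//; case/andP: (bump_itv 0 (r + 1) (X (exit_time X (r + 1) 1 w) w)).
  rewrite (le_trans (ler_norm _))// normrN.
  exact: (path_integral_bound mX cX w mg gC s0).
Qed.

(** Until the exit the generator of [f] is at least [c] times the integral of [f], so Dynkin's
    formula gives this times the mean exit time, itself at least [c1]. Measurable sets follow from
    smooth functions by [measurable_le]. *)
Lemma exit_law_ge (r : R) (a : 'rV[R]_d) : (0 <= r)%R ->
  (forall y, (`|y - a| < 1)%R -> (r + 1 + 1 <= `|y|)%R) ->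
  exists2 c, (0 < c)%R & forall x, (`|x| <= r)%R -> forall A : set 'rV[R]_d, measurable A ->
    c%:E * lebesgue_rV R d (A `&` [set y | (`|y - a| < 1)%R]) <=
    P_at P x ((fun w => X (exit_time X (r + 1) 1 w) w) @^-1` A).
Proof.
move=> r0 ya; have r1 : (0 <= r + 1)%R by rewrite addr_ge0.
have [c1 c10 Hc1] := exit_time_expectation_ge r0.
have [c c0 Hc] := generator_lower_bound d0 alpha12 lam0 lam_nd Lbk r1 ya.
exists (c * c1)%R; first exact: mulr_gt0.
move=> x xr A mA.
pose sigma := exit_time X (r + 1) 1.
have s_itv w : (0 <= sigma w <= 1)%R by exact: exit_time_itv.
have ms : measurable_fun setT sigma by exact: (measurable_exit_time XP.1).
have mpos : measurable_fun setT (fun w => X (sigma w) w).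
  exact: (measurable_exit_position XP.1).
pose Y : {mfun Omega >-> 'rV[R]_d} := mfun_Sub (mem_set mpos).
have cc0 : (0 <= c * c1)%R by rewrite mulr_ge0// ltW.
suff smooth (f : 'rV[R]_d -> R) : C2 f -> (forall x, 0 <= f x <= 1)%R ->
    (forall x, ~ [set y | (`|y - a| < 1)%R] x -> f x = 0%R) ->
    (c * c1)%:E * \int[lebesgue_rV R d]_z (f z)%:E <= \int[distribution (P_at P x) Y]_z (f z)%:E.
  have -> : P_at P x ((fun w => X (exit_time X (r + 1) 1 w) w) @^-1` A) =
    distribution (P_at P x) Y A by [].
  have H := (@measurable_le R d (distribution (P_at P x) Y) (lebesgue_rV R d) (c * c1)%R
    [set y | (`|y - a| < 1)%R] cc0 (@open_norm_lt _ _ a 1%R) smooth A mA).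
  exact: H.
move=> f2 f01 fU.
have mf : measurable_fun setT f.
  by apply: continuous_measurable_rV; case: f2 => -[].
have -> : \int[distribution (P_at P x) Y]_y (f y)%:E = \int[P_at P x]_w (f (X (sigma w) w))%:E.
  rewrite /distribution ge0_integral_pushforward//; first exact/measurable_EFinP.
  by move=> y _; rewrite lee_fin; case/andP: (f01 y).
have out y : (`|a| + 1 < `|y|)%R -> f y = 0%R.
  move=> ay; apply: fU => /=; apply/negP; rewrite -leNgt.
  have h : (`|y| <= `|y - a| + `|a|)%R by rewrite -[in leLHS](subrK a y) ler_normD.
  by lra.
have [g [C [mg gC Hg]]] := generator_bounded_fun (addr_ge0 (normr_ge0 a) ler01) f2 out.
set I := \int[lebesgue_rV R d]_z (f z)%:E.
have I0 : 0 <= I by apply: integral_ge0 => y _; rewrite lee_fin; case/andP: (f01 y).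
(* The generator lower bound at the point 0, where the generator is finite, also bounds the integral
   of [f]. *)
have Ifin : I \is a fin_num.
  rewrite ge0_fin_numE//; have := Hc f f2 f01 fU 0%R; rewrite normr0 => /(_ r1).
  rewrite Hg -lee_pdivlMl// => /le_lt_trans; apply.
  by rewrite -EFinM ltry.
set L := fine I; have IL : I = L%:E by rewrite fineK.
have L0 : (0 <= L)%R by rewrite -lee_fin -IL.
have gL y : (`|y| <= r + 1)%R -> (c * L <= g y)%R.
  by move=> yr; rewrite -lee_fin -Hg EFinM -IL; exact: Hc.
have fb : C2b f := C2_support_C2b f2 out.
pose D := dynkin_term X f g (r + 1) 1.
have iD : (P_at P x).-integrable setT (EFin \o D).
  exact: (@integrable_dynkin_term R d dO Omega X P _ XP f g C fb mg gC Hg (r + 1)%R 1%R ler01 \d_x).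
have iS : (P_at P x).-integrable setT (EFin \o (fun w => c * L * sigma w)%R).
  apply: (@bounded_integrable _ _ _ _ _ (c * L)%R); first exact: measurable_funM.
  move=> w; have /andP[s0 s1] := s_itv w.
  have cL : (0 <= c * L)%R by apply: mulr_ge0; [exact: ltW|].
  by rewrite ger0_norm; [exact: ler_piMr|exact: mulr_ge0].
have pt w : (D w + c * L * sigma w <= f (X (sigma w) w))%R.
  have /andP[s0 _] := s_itv w.
  rewrite /D /dynkin_term -/(sigma w) -addrA gerDl addrC subr_le0.
  rewrite -(path_integral_cst X (c * L) w s0).
  apply: (@path_integral_le _ _ _ _ X mX cX (fun=> c * L)%R g _ w `|c * L|%R C) => //.
  by move=> s /andP[s0' ss]; apply: gL; exact: (before_exit ler01 s0' ss).
apply: (@le_trans _ _ (\int[P_at P x]_w (D w + c * L * sigma w)%R%:E)); last first.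
  apply: le_integral => //.
  - exact: (integrableD measurableT iD iS).
  - apply: (@bounded_integrable _ _ _ _ _ 1%R); first exact: measurableT_comp.
    by move=> w; have /andP[f0 f1] := f01 (X (sigma w) w); rewrite ger0_norm.
  - by move=> w _; rewrite lee_fin pt.
under eq_integral do rewrite EFinD.
rewrite integralD//= (@dynkin_at R d dO Omega X P _ XP f g C fb mg gC Hg (r + 1)%R 1%R ler01 x).
under eq_integral do rewrite EFinM.
rewrite ge0_integralZl//; last 3 first.
- exact/measurable_EFinP.
- by move=> w _; rewrite lee_fin; case/andP: (s_itv w).
- by rewrite lee_fin mulr_ge0// ltW.
apply: (@le_trans _ _ ((c * L)%:E * c1%:E)).
  by rewrite IL -!EFinM lee_fin mulrAC.
apply: (@le_trans _ _ ((c * L)%:E * \int[P_at P x]_w (sigma w)%:E)).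
  by rewrite lee_wpmul2l// ?Hc1// lee_fin mulr_ge0// ltW.
by rewrite leeDr// lee_fin; case/andP: (f01 x).
Qed.

(** Dynkin's formula is applied to truncations of [V] up to the exit from growing balls, and Fatou's
    lemma removes the localization. *)
Lemma transition_drift V r0 eps M : (forall x, 0 <= V x)%R -> C2 V -> (0 <= r0)%R ->
  (0 < eps)%R -> (0 <= M)%R ->
  (forall m : R, (r0 + 2 <= m)%R -> exists f,
    [/\ C2 f, forall x, (m + 1 < `|x|)%R -> f x = 0%R, forall x, (0 <= f x <= V x)%R,
      forall x, (`|x| <= m)%R -> f x = V x &
      forall x, (`|x| < m)%R -> generator alpha b k f x <=
        (M * \1_[set y : 'rV[R]_d | (`|y| <= r0)%R] x - eps)%:E]) ->
  forall x T, (0 <= T)%R ->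
  \int[P_at P x]_w (V (X T w))%:E + (eps * T)%:E <=
  (V x)%:E + M%:E * \int[P_at P x]_w
    (path_integral X \1_[set y : 'rV[R]_d | (`|y| <= r0)%R] T w)%:E.
Proof.
move=> V0 V2 r00 eps0 M0 test x T T0; set h : 'rV[R]_d -> R := \1__.
have mh : measurable_fun setT h by apply: measurable_indic; exact: measurable_norm_le.
have h0 y : (0 <= h y)%R by [].
have h1 y : (`|h y| <= 1)%R by rewrite ger0_norm// /h indicE lern1 leq_b1.
have mV : measurable_fun setT V by apply: continuous_measurable_rV; case: V2 => -[].
(* The truncation is made at radius [rad n + 1], so that the closed ball of radius [rad n], which
   holds the path before [sigma n], lies in the open ball where the generator is controlled. *)
pose rad n : R := (r0 + 2 + n%:R)%R.
have rad0 n : (0 <= rad n)%R by rewrite !addr_ge0.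
have /choice[F HF] n : exists f, [/\ C2 f, forall x, (rad n + 1 + 1 < `|x|)%R -> f x = 0%R,
      forall x, (0 <= f x <= V x)%R, forall x, (`|x| <= rad n + 1)%R -> f x = V x &
      forall x, (`|x| < rad n + 1)%R -> generator alpha b k f x <= (M * h x - eps)%:E].
  by apply: test; rewrite /rad -addrA lerDl addr_ge0.
pose sigma n := exit_time X (rad n) T.
have s_itv n w : (0 <= sigma n w <= T)%R by exact: exit_time_itv.
have ms n : measurable_fun setT (sigma n) by exact: (measurable_exit_time XP.1).
have mF n : measurable_fun setT (F n).
  by apply: continuous_measurable_rV; case: (HF n) => -[[]].
have mFX n : measurable_fun setT (fun w => F n (X (sigma n w) w)).
  by apply: (measurableT_comp (mF n)); exact: (measurable_exit_position XP.1).
have F0 n y : (0 <= F n y)%R by case: (HF n) => _ _ /(_ y)/andP[].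
pose u n w : \bar R := (F n (X (sigma n w) w) + eps * sigma n w)%:E.
have mu n : measurable_fun setT (u n).
  by apply/measurable_EFinP; apply: measurable_funD => //; exact: measurable_funM.
have u0 n w : 0 <= u n w.
  by rewrite lee_fin addr_ge0// mulr_ge0 ?(ltW eps0)//; case/andP: (s_itv n w).
have mO := measurable_path_integral mX cX mh h0 h1 T.
have O0 w := path_integral_ge0 X h0 T w.
set B := (X in _ <= X).
have uB n : \int[P_at P x]_w u n w <= B.
  have [f2 fout fV fE fgen] := HF n.
  have [g [C [mg gC Hg]]] := generator_bounded_fun (addr_ge0 (addr_ge0 (rad0 n) ler01) ler01) f2 fout.
  have fb : C2b (F n) := C2_support_C2b f2 fout.
  pose D := dynkin_term X (F n) g (rad n) T.
  have iD : (P_at P x).-integrable setT (EFin \o D).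
    exact: (@integrable_dynkin_term R d dO Omega X P _ XP (F n) g C fb mg gC Hg (rad n) T T0 \d_x).
  have iO : (P_at P x).-integrable setT (EFin \o (fun w => M * path_integral X h T w)%R).
    apply: (@bounded_integrable _ _ _ _ _ (M * (1 * T))%R); first exact: measurable_funM.
    move=> w; rewrite normrM (ger0_norm M0) ler_wpM2l//.
    exact: (path_integral_bound mX cX w mh h1 T0).
  have pt w : (F n (X (sigma n w) w) + eps * sigma n w <= D w + M * path_integral X h T w)%R.
    have /andP[s0 sT] := s_itv n w.
    rewrite /D /dynkin_term -/(sigma n w) -addrA lerD2l addrC lerBrDr -lerBrDl.
    apply: (@le_trans _ _ (path_integral X (fun y => M * h y + - eps) (sigma n w) w)%R).
      apply: (@path_integral_le _ _ _ _ X mX cX g (fun y => M * h y + - eps)%R _ w C (M + eps)%R) => //.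
      - by apply: measurable_funD => //; exact: measurable_funM.
      - move=> y; rewrite (le_trans (ler_normD _ _))// normrN (gtr0_norm eps0) lerD2r.
        by rewrite normrM (ger0_norm M0) ler_piMr.
      - move=> s /andP[s0' ss]; rewrite -lee_fin -Hg; apply: fgen.
        by rewrite (le_lt_trans (before_exit T0 s0' ss))// ltrDl.
    rewrite (path_integral_affine mX cX M (- eps) w mh h1 s0) mulNr lerD2r ler_wpM2l//.
    exact: (path_integral_nd mX cX mh h0 h1 w s0 sT).
  apply: (@le_trans _ _ (\int[P_at P x]_w (D w + M * path_integral X h T w)%R%:E)).
    apply: ge0_le_integral => //.
    - apply/measurable_EFinP; apply: measurable_funD; last exact: measurable_funM.
      exact: (@measurable_dynkin_term R d dO Omega X P _ XP (F n) g C fb mg gC Hg (rad n) T T0).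
    - by move=> w _; rewrite lee_fin pt.
  under eq_integral do rewrite EFinD.
  rewrite integralD//= (@dynkin_at R d dO Omega X P _ XP (F n) g C fb mg gC Hg (rad n) T T0 x).
  under eq_integral do rewrite EFinM.
  rewrite ge0_integralZl//; [|exact/measurable_EFinP|by move=> w _; rewrite lee_fin].
  by rewrite leeD2r// lee_fin; case/andP: (fV x).
have := @fatou_bound _ _ R (P_at P x) u (fun w => (V (X T w) + eps * T)%:E) B mu u0 _ uB.
under eq_integral do rewrite EFinD.
rewrite ge0_integralD//; last 3 first.
- by move=> w _; rewrite lee_fin.
- by apply/measurable_EFinP; apply: (measurableT_comp mV); exact: mX.
- by move=> w _; rewrite lee_fin mulr_ge0// ltW.
rewrite integral_cst// [X in _ * X](_ : _ = 1) ?mule1; last exact: (@probability_setT _ _ _ (P_at P x)).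
apply => w.
(* A cadlag path is bounded on [[0, T]]: for large [n] it has not left the ball by time [T], and the
   truncation equals [V] there. *)
have [K HK] := cadlag_bounded cX T w.
apply: cvg_near_cst; near=> n.
have Kn : (K <= rad n)%R.
  rewrite /rad (@le_trans _ _ n%:R)//; last by rewrite lerDr addr_ge0.
  by near: n; exact: nbhs_infty_ger.
have sT : sigma n w = T.
  by apply: (exit_timeE T0) => s sT; rewrite (le_trans (HK s sT)).
rewrite /u sT; congr (_ + _)%:E; case: (HF n) => _ _ _ + _; apply.
by rewrite (le_trans (HK T _)) ?T0 ?lexx// (le_trans Kn)// lerDl.
Unshelve. all: end_near. Qed.

End stable_like_process.

(** * Transition kernels and the resolvent *)

Section transition_kernel.
Local Open Scope ereal_scope.
Variables (R : realType) (d : nat) (dO : measure_display).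
Variables (Omega : measurableType dO) (X : R -> Omega -> 'rV[R]_d).
Variable P : probability 'rV[R]_d R -> probability Omega R.
Hypothesis XP : strong_markov_process X P.
Implicit Types (s t : R) (w : Omega) (x : 'rV[R]_d) (B : set 'rV[R]_d).

Let mX t : (0 <= t)%R -> measurable_fun setT (X t).
Proof. by case: XP => + _ _ _ _; exact. Qed.

Let cX w : cadlag X w.
Proof. by case: XP. Qed.

Let max0 t : (0 <= Num.max t 0)%R. Proof. by rewrite le_max lexx orbT. Qed.

Let mX0 t : measurable_fun setT (X (Num.max t 0)%R). Proof. exact: mX. Qed.

Definition transition (p : measurableTypeR R * 'rV[R]_d) : {measure set 'rV[R]_d -> \bar R} :=
  distribution (P_at P p.2) (mfun_Sub (mem_set (mX0 p.1))).

Lemma transitionE t x B : transition (t, x) B = P_at P x (X (Num.max t 0%R) @^-1` B).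
Proof. by []. Qed.

Lemma transition_ge0E t x B : (0 <= t)%R -> transition (t, x) B = P_at P x (X t @^-1` B).
Proof. by move=> t0; rewrite transitionE (max_idPl t0). Qed.

Let transitionT p : transition p setT = 1.
Proof. exact: probability_setT. Qed.

Lemma integral_transition p (f : 'rV[R]_d -> \bar R) : measurable_fun setT f -> (forall x, 0 <= f x) ->
  \int[transition p]_y f y = \int[P_at P p.2]_w f (X (Num.max p.1 0%R) w).
Proof. by move=> mf f0; rewrite /transition /distribution ge0_integral_pushforward. Qed.

Let mtransition_x t (f : 'rV[R]_d -> R) : (0 <= t)%R -> measurable_fun setT f -> (forall x, 0 <= f x)%R ->
  measurable_fun setT (fun x => \int[P_at P x]_w (f (X t w))%:E).
Proof.
move=> t0 mf f0.
have K U : measurable U -> measurable_fun setT (fun x => transition (t, x) U).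
  move=> mU; under eq_fun do rewrite transition_ge0E//.
  by case: XP => _ _ _ + _; exact.
rewrite (_ : (fun x => _) = (fun x => \int[transition (t, x)]_y (f y)%:E)); last first.
  apply/funext => x; rewrite integral_transition//=; first by rewrite (max_idPl t0).
  exact/measurable_EFinP.
apply: (@measurable_fun_integral_kernel _ _ _ _ R (fun x => transition (t, x))) => //.
exact/measurable_EFinP.
Qed.

Let N n (p : measurableTypeR R * 'rV[R]_d) : nat := Num.truncn (n.+1%:R * Num.max p.1 0)%R.

Let mN n j : measurable [set p | N n p = j].
Proof.
have -> : [set p | N n p = j] = [set p : measurableTypeR R * 'rV[R]_d |
    ((j%:R <= n.+1%:R * Num.max p.1 0) && (n.+1%:R * Num.max p.1 0 < j.+1%:R))%R].
  apply/seteqP; split=> p /=; last by move=> ?; exact: truncn_def.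
  by move=> <-; apply: truncn_itv; rewrite mulr_ge0.
have m1 : measurable_fun setT (fun p : measurableTypeR R * 'rV[R]_d => n.+1%:R * Num.max p.1 0)%R.
  by apply: measurable_funM => //; exact: measurable_maxr.
rewrite (_ : mkset _ = (fun p : measurableTypeR R * 'rV[R]_d => n.+1%:R * Num.max p.1 0)%R @^-1` `[j%:R, j.+1%:R[%classic).
  by rewrite -[X in measurable X]setTI; apply: m1 => //; exact: measurable_itv.
by apply/seteqP; split=> p /=; rewrite in_itv.
Qed.

Let mtransition_cont (f : 'rV[R]_d -> R) : continuous f -> (forall x, 0 <= f x <= 1)%R ->
  measurable_fun setT (fun p : measurableTypeR R * 'rV[R]_d => \int[transition p]_y (f y)%:E).
Proof.
move=> cf f01; have f0 x : (0 <= f x)%R by case/andP: (f01 x).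
have mf : measurable_fun setT f by exact: continuous_measurable_rV.
pose Y n j (p : measurableTypeR R * 'rV[R]_d) := \int[P_at P p.2]_w (f (X (j.+1%:R / n.+1%:R) w))%:E.
have mY n j : measurable_fun setT (Y n j).
  apply: (measurableT_comp (mtransition_x _ mf f0)) => //.
apply: (emeasurable_fun_cvg (fun n p => Y n (N n p) p)).
  by move=> n; exact: measurable_fun_countable_index.
move=> [t x] _; rewrite integral_transition//=; last exact/measurable_EFinP.
set tt := Num.max t 0%R; have tt0 : (0 <= tt)%R by exact: max0.
have [|||||_ _] := @dominated_convergence _ _ _ (P_at P x) setT measurableT
  (fun n w => (f (X ((N n (t, x)).+1%:R / n.+1%:R) w))%:E) (fun w => (f (X tt w))%:E) (cst 1).
- by move=> n; apply/measurable_EFinP; apply: (measurableT_comp mf); apply: mX; rewrite divr_ge0.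
- by apply/measurable_EFinP; apply: (measurableT_comp mf); exact: mX.
- apply: aeW => w _; apply: cvg_EFin; first by near=> n.
  have c1 : f (X s w) @[s --> tt^'+] --> f (X tt w).
    by apply: continuous_cvg; [exact: cf|case: (cX w) => + _; exact].
  exact: (cvg_comp _ _ (grid_cvg tt0) c1).
- exact: finite_measure_integrable_cst.
- by apply: aeW => w n _; rewrite /= lee_fin ger0_norm//; case/andP: (f01 (X ((N n (t, x)).+1%:R / n.+1%:R) w)).
- exact.
Unshelve. all: end_near. Qed.

Let mtransition_open O : open O -> measurable_fun setT (fun p => transition p O).
Proof.
move=> oO; have [F [F2 F01 Fout cF]] := open_smooth_approx oO.
have mO := open_measurable_rV oO.
have contF n : continuous (F n) by case: (F2 n) => -[].
apply: (emeasurable_fun_cvg (fun n p => \int[transition p]_y (F n y)%:E)).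
  by move=> n; exact: mtransition_cont.
move=> p _; have -> : transition p O = \int[transition p]_y (\1_O y)%:E.
  by rewrite integral_indic ?setIT.
have [|||||_ _] := @dominated_convergence _ _ _ (transition p) setT measurableT
  (fun n y => (F n y)%:E) (fun y => (\1_O y)%:E) (cst 1).
- by move=> n; apply/measurable_EFinP; exact: continuous_measurable_rV.
- by apply/measurable_EFinP; exact: measurable_indic.
- by apply: aeW => y _; apply: cvg_EFin; [near=> n|exact: cF].
- apply/integrableP; split => //; under eq_integral do rewrite abse1.
  by rewrite integral_cst// transitionT mule1 ltry.
- by apply: aeW => y n _; rewrite /= lee_fin ger0_norm//; case/andP: (F01 n y).
- exact.
Unshelve. all: end_near. Qed.

(** Joint measurability in time and space: continuous functions are handled by right-continuity in
    time along grids, open sets by smooth approximation, and Borel sets by a lambda-system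
    argument. *)
Lemma measurable_transition B : measurable B -> measurable_fun setT (fun p => transition p B).
Proof.
move=> mB.
suff : <<s @open 'rV[R]_d >> `<=` [set A | measurable A /\ measurable_fun setT (fun p => transition p A)].
  by move=> /(_ B mB)[].
apply: lambda_system_subset => //.
- exact: openI.
- split => //.
  + split; first exact: measurableT.
    rewrite (_ : (fun p => _) = cst 1); first exact: measurable_cst.
    by apply/funext => p; exact: transitionT.
  + move=> A1 A2 A21 [mA1 h1] [mA2 h2]; split; first exact: measurableD.
    rewrite (_ : (fun p => _) = (fun p => transition p A1 - transition p A2)).
      exact: emeasurable_funB.
    apply/funext => p; rewrite measureD ?(setIidr A21)//.
    have h : transition p A1 <= 1 by rewrite -(transitionT p) le_measure ?inE.
    exact: le_lt_trans h (ltry 1).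
  + move=> A ndA hA; split; first by apply: bigcupT_measurable => n; case: (hA n).
    apply: (emeasurable_fun_cvg (fun n p => transition p (A n))).
      by move=> n; case: (hA n).
    move=> p _; apply: nondecreasing_cvg_mu => //; first by move=> n; case: (hA n).
    by apply: bigcupT_measurable => n; case: (hA n).
- by move=> O oO; split; [exact: open_measurable_rV|exact: mtransition_open].
Qed.

Let mtransition_t x B : measurable B -> measurable_fun setT (fun t => transition (t, x) B).
Proof.
move=> mB; apply: (measurableT_comp (f := fun p => transition p B)) => //.
exact: measurable_transition.
Qed.

Definition time_kernel x (t : measurableTypeR R) := transition (t, x).

HB.instance Definition _ x :=
  isKernel.Build _ _ _ _ R (time_kernel x) (fun B mB => @mtransition_t x B mB).

Definition resolvent x : {measure set 'rV[R]_d -> \bar R} :=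
  mbind (@std_exponential R) (time_kernel x).

Lemma resolventE x B : resolvent x B = \int[@std_exponential R]_t transition (t, x) B.
Proof. by []. Qed.

Let measurable_resolvent B : measurable B -> measurable_fun setT (resolvent ^~ B).
Proof.
move=> mB; rewrite (_ : resolvent ^~ B =
    fubini_G (@std_exponential R) (fun p => transition p B)).
  by apply: measurable_fun_fubini_tonelli_G; [exact: measurable_transition|].
by [].
Qed.

HB.instance Definition _ := isKernel.Build _ _ _ _ R resolvent measurable_resolvent.

Let resolvent_prob : forall x, resolvent x setT = 1.
Proof.
move=> x; rewrite resolventE; under eq_integral do rewrite transitionT.
by rewrite integral_cst// mul1e; exact: (@probability_setT _ _ _ (@std_exponential R)).
Qed.

HB.instance Definition _ := Kernel_isProbability.Build _ _ _ _ R resolvent resolvent_prob.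

Lemma integral_resolvent x (f : 'rV[R]_d -> \bar R) : measurable_fun setT f -> (forall y, 0 <= f y) ->
  \int[resolvent x]_y f y = \int[@std_exponential R]_t \int[P_at P x]_w f (X (Num.max t 0%R) w).
Proof.
move=> mf f0; rewrite integral_mbind//.
by apply: eq_integral => t _; rewrite integral_transition.
Qed.

End transition_kernel.

Arguments transition : simpl never.
Arguments resolvent : simpl never.

(** * From the resolvent to the semigroup *)

Section invariant_measure.
Local Open Scope ereal_scope.
Variables (R : realType) (d : nat) (dO : measure_display).
Variables (Omega : measurableType dO) (X : R -> Omega -> 'rV[R]_d).
Variable P : probability 'rV[R]_d R -> probability Omega R.
Hypothesis XP : strong_markov_process X P.
Implicit Types (s t : R) (w : Omega) (x : 'rV[R]_d) (B : set 'rV[R]_d).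

Local Notation E := (@std_exponential R).
Local Notation Pt := (transition XP).
Local Notation Q := (resolvent XP).

Let mX t : (0 <= t)%R -> measurable_fun setT (X t).
Proof. by case: XP => + _ _ _ _; exact. Qed.

Let cX w : cadlag X w.
Proof. by case: XP. Qed.

Let mpath : measurable_fun setT (fun p : R * Omega => X (Num.max p.1 0%R) p.2).
Proof. exact: measurable_path. Qed.

Lemma transition_le1 p B : measurable B -> Pt p B <= 1.
Proof.
move=> mB; have <- : Pt p setT = 1 by exact: (@probability_setT _ _ _ (P_at P p.2)).
by rewrite le_measure ?inE.
Qed.

Let mPt t B : measurable B -> measurable_fun setT (fun x => Pt (t, x) B).
Proof.
by move=> mB; exact: (measurableT_comp (measurable_transition XP mB) (pair1_measurable t)).
Qed.

Lemma transition_semigroup s t x B : (0 <= s)%R -> (0 <= t)%R -> measurable B ->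
  Pt ((s + t)%R, x) B = \int[Pt (s, x)]_y Pt (t, y) B.
Proof.
move=> s0 t0 mB; rewrite transition_ge0E ?addr_ge0// /P_at (chapman_kolmogorov XP)//.
rewrite integral_transition//; last exact: mPt.
by rewrite (max_idPl s0); apply: eq_integral => w _; rewrite transition_ge0E.
Qed.

(** By the strong Markov property the left side is the expected occupation of [B] after time
    [sigma], weighted by an exponential clock started at [sigma]. As [sigma <= 1], restarting the
    clock costs a factor at most [e]. *)
Lemma resolvent_stopped (r : R) x B : measurable B ->
  \int[P_at P x]_w Q (X (exit_time X r 1 w) w) B <= (expR 1)%:E * Q x B.
Proof.
move=> mB; set sigma := exit_time X r 1.
have s01 w : (0 <= sigma w <= 1)%R by exact: exit_time_itv.
have ms : measurable_fun setT sigma by exact: (measurable_exit_time XP).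
have mpos : measurable_fun setT (fun w => X (sigma w) w) by exact: (measurable_exit_position XP).
have mIB : measurable_fun setT (\1_B : 'rV[R]_d -> R) by exact: measurable_indic.
pose G (p : Omega * R) := (\1_B (X (Num.max p.2 0) p.1) : R)%:E.
have mG : measurable_fun setT G.
  apply/measurable_EFinP; apply: (measurableT_comp mIB).
  apply: (measurableT_comp (g := fun p : Omega * R => (p.2, p.1)) mpath).
  by apply/measurable_fun_pair; [exact: measurable_snd|exact: measurable_fst].
pose H (p : Omega * R) := (\1_B (X (Num.max (sigma p.1 + Num.max p.2 0) 0) p.1) : R)%:E.
have mH : measurable_fun setT H.
  apply/measurable_EFinP; apply: (measurableT_comp mIB).
  apply: (measurableT_comp (g := fun p : Omega * R => (sigma p.1 + Num.max p.2 0, p.1)%R) mpath).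
  apply/measurable_fun_pair; last exact: measurable_fst.
  apply: measurable_funD; first exact: measurableT_comp ms measurable_fst.
  by apply: measurable_maxr => //; exact: measurable_snd.
have G0 p : 0 <= G p by rewrite lee_fin.
have H0 p : 0 <= H p by rewrite lee_fin.
have mK : measurable_fun setT (fun p : Omega * R => Pt (p.2, X (sigma p.1) p.1) B).
  apply: (measurableT_comp (g := fun p : Omega * R => (p.2, X (sigma p.1) p.1))
    (measurable_transition XP mB)).
  apply/measurable_fun_pair; first exact: measurable_snd.
  exact: measurableT_comp mpos measurable_fst.
have indE (f : Omega -> 'rV[R]_d) : measurable_fun setT f ->
    \int[P_at P x]_w (\1_B (f w) : R)%:E = P_at P x (f @^-1` B).
  move=> mf; rewrite (_ : (fun w => _) = (fun w => (\1_(f @^-1` B) w)%:E))//.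
  by rewrite integral_indic ?setIT// -[X in measurable X]setTI; exact: mf.
have -> : \int[P_at P x]_w Q (X (sigma w) w) B = \int[P_at P x]_w \int[E]_t H (w, t).
  transitivity (\int[E]_t \int[P_at P x]_w Pt (t, X (sigma w) w) B).
    by apply: (@fubini_tonelli _ _ _ _ _ (P_at P x) E (fun p => Pt (p.2, X (sigma p.1) p.1) B)).
  transitivity (\int[E]_t \int[P_at P x]_w H (w, t)); last first.
    by apply/esym; apply: fubini_tonelli.
  apply: eq_integral => t _; have t0 : (0 <= Num.max t 0)%R by rewrite le_max lexx orbT.
  have := strong_markov_set XP (exit_stopping_time cX r ler01) \d_x t0 mB.
  rewrite -/(P_at P x) -indE; last first.
    exact: (measurable_stopped_position XP (exit_stopping_time cX r ler01) t0).
  move=> <-; apply: eq_integral => w _; rewrite /H /=.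
  by rewrite (@max_l _ _ (sigma w + _)%R)// addr_ge0//; case/andP: (s01 w).
have -> : (expR 1)%:E * Q x B = \int[P_at P x]_w ((expR 1)%:E * \int[E]_t G (w, t)).
  rewrite ge0_integralZl//; last 2 first.
  - by apply: measurable_fun_fubini_tonelli_F.
  - by move=> w _; apply: integral_ge0.
  congr (_ * _); transitivity (\int[E]_t \int[P_at P x]_w G (w, t)); last first.
    by apply/esym; apply: fubini_tonelli.
  apply: eq_integral => t _.
  have mt : measurable_fun setT (X (Num.max t 0%R)) by apply: mX; rewrite le_max lexx orbT.
  by rewrite indE//; exact: mt.
apply: ge0_le_integral => //.
- by move=> w _; apply: integral_ge0.
- exact: measurable_fun_fubini_tonelli_F.
- by apply: measurable_funeM; exact: measurable_fun_fubini_tonelli_F.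
- move=> w _; have mGw : measurable_fun setT (fun t => G (w, t)) by exact: measurableT_comp.
  apply: le_trans (std_exponential_shift_le (s01 w) mGw (fun t => G0 (w, t))).
  rewrite le_eqVlt; apply/orP; left; apply/eqP; apply: eq_integral_std_exponential => //.
  + exact: measurableT_comp.
  + by apply: (measurableT_comp mGw); exact: measurable_funD.
  + by move=> t t0; rewrite /H /G /= (max_idPl t0).
Qed.

Section fixed_resolvent.
Variable mu : probability 'rV[R]_d R.
Hypothesis muQ : forall B, measurable B -> \int[mu]_x Q x B = mu B.
Variable B : set 'rV[R]_d.
Hypothesis mB : measurable B.

Let phi t : \bar R := \int[mu]_x Pt (t, x) B.

Let phi0 t : 0 <= phi t. Proof. exact: integral_ge0. Qed.

Let phi1 t : phi t <= 1.
Proof.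
have one : \int[mu]_x cst 1 x = 1 by rewrite integral_cst// mul1e; exact: (@probability_setT _ _ _ mu).
rewrite -one.
by apply: ge0_le_integral => //; [exact: mPt|move=> x _; exact: transition_le1].
Qed.

Let mphi : measurable_fun setT phi.
Proof.
rewrite (_ : phi = fubini_F mu (fun p : measurableTypeR R * 'rV[R]_d => Pt p B))//.
by apply: measurable_fun_fubini_tonelli_F => //; exact: measurable_transition.
Qed.

Let phi_fix t : (0 <= t)%R -> phi t = \int[E]_s phi (t + s)%R.
Proof.
move=> t0; rewrite {1}/phi -(@eq_measure_integral _ _ _ _ mu (mbind mu Q)); last by move=> A mA _; exact: muQ.
rewrite integral_mbind//; last exact: mPt.
have mS : measurable_fun setT (fun p : 'rV[R]_d * R => Pt ((t + Num.max p.2 0)%R, p.1) B).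
  apply: (measurableT_comp (g := fun p : 'rV[R]_d * R => ((t + Num.max p.2 0)%R, p.1))
    (measurable_transition XP mB)).
  apply/measurable_fun_pair; last exact: measurable_fst.
  by apply: measurable_funD => //; apply: measurable_maxr => //; exact: measurable_snd.
transitivity (\int[mu]_x \int[E]_s Pt ((t + Num.max s 0)%R, x) B).
  apply: eq_integral => x _; rewrite integral_mbind//; last exact: mPt.
  have mtk U : measurable U -> measurable_fun setT (fun s : measurableTypeR R => Pt (s, x) U).
    by move=> mU; exact: (measurableT_comp (measurable_transition XP mU) (pair2_measurable x)).
  have mm : measurable_fun setT (fun s : measurableTypeR R => \int[Pt (s, x)]_y Pt (t, y) B).
    by apply: (measurable_fun_integral_kernel mtk) => //; exact: mPt.
  apply: eq_integral_std_exponential => //.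
  - by move=> s; exact: integral_ge0.
  - exact: (measurableT_comp mS (pair1_measurable x)).
  - by move=> s s0; rewrite (max_idPl s0) addrC transition_semigroup.
transitivity (\int[E]_s \int[mu]_x Pt ((t + Num.max s 0)%R, x) B).
  by apply: (@fubini_tonelli _ _ _ _ _ mu E (fun p => Pt ((t + Num.max p.2 0)%R, p.1) B)).
apply: eq_integral_std_exponential => //.
- by apply: (measurableT_comp mphi) (_ : measurable_fun setT (fun s => t + Num.max s 0)%R);
    apply: measurable_funD => //; exact: measurable_maxr.
- by move=> s; exact: integral_ge0.
- by apply: (measurableT_comp mphi); exact: measurable_funD.
- by move=> s s0; rewrite (max_idPl s0).
Qed.

Let psi t : R := fine (phi t).

Let psiE t : phi t = (psi t)%:E.
Proof. by rewrite fineK// ge0_fin_numE// (le_lt_trans (phi1 t))// ltry. Qed.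

Let psi_itv t : (0 <= psi t <= 1)%R.
Proof. by rewrite -!lee_fin -psiE phi0 phi1. Qed.

(** The fixed-point equation is cut at time [h]; by memorylessness the part after [h] is the same
    equation at [t + h], with weight [e^-h]. *)
Let psi_split t h : (0 <= t)%R -> (0 <= h)%R -> exists J : R,
  \int[E]_(s in `[0%R, h[) (psi (t + s))%:E = J%:E /\
  psi t = (J + expR (- h) * psi (t + h))%R.
Proof.
move=> t0 h0.
have mf : measurable_fun setT (fun s => phi (t + s)%R).
  by apply: (measurableT_comp mphi); exact: measurable_funD.
have tail : \int[E]_(s in `[h, +oo[) phi (t + s)%R = (expR (- h) * psi (t + h))%:E.
  rewrite (@std_exponential_memoryless _ h (fun s => phi (t + s)%R) h0 mf (fun s => phi0 (t + s)%R)).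
  rewrite EFinM -(psiE (t + h)%R) (phi_fix (addr_ge0 t0 h0)).
  by congr (_ * _); apply: eq_integral => s _; rewrite addrA.
have full : phi t = \int[E]_(s in `[0%R, +oo[) phi (t + s)%R.
  rewrite (@std_exponential_memoryless _ 0%R (fun s => phi (t + s)%R) (lexx 0%R) mf
    (fun s => phi0 (t + s)%R)) oppr0 expR0 mul1e (phi_fix t0).
  by apply: eq_integral => s _; rewrite add0r.
have U : `[0%R, +oo[%classic = `[0%R, h[%classic `|` `[h, +oo[%classic.
  apply/seteqP; split=> s /=; rewrite !in_itv/= !andbT.
    by move=> s0; case: (ltP s h) => sh; [left; rewrite s0|right].
  by move=> [/andP[]//|]; exact: le_trans.
have split_ : phi t = \int[E]_(s in `[0%R, h[) phi (t + s)%R + (expR (- h) * psi (t + h))%:E.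
  rewrite full U ge0_integral_setU//; first by rewrite tail.
  - exact: measurable_funTS.
  - by apply/disj_setPS => s [/=]; rewrite !in_itv/= andbT => /andP[_ sh]; rewrite leNgt sh.
have J0 : 0 <= \int[E]_(s in `[0%R, h[) phi (t + s)%R by exact: integral_ge0.
have Jfin : \int[E]_(s in `[0%R, h[) phi (t + s)%R \is a fin_num.
  rewrite ge0_fin_numE// (@le_lt_trans _ _ (phi t))//; last by rewrite psiE ltry.
  by rewrite split_ leeDl// lee_fin mulr_ge0// ?expR_ge0//; case/andP: (psi_itv (t + h)).
exists (fine (\int[E]_(s in `[0%R, h[) phi (t + s)%R)); split.
  by rewrite fineK//; apply: eq_integral => s _; rewrite psiE.
by apply: EFin_inj; rewrite -psiE split_ EFinD fineK.
Qed.

Let head h : (0 <= h)%R -> E `[0%R, h[%classic = (1 - expR (- h))%:E.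
Proof.
move=> h0; have U : `[0%R, h[%classic = `[0%R, +oo[%classic `\` `[h, +oo[%classic :> set R.
  apply/seteqP; split=> s /=; rewrite !in_itv/= !andbT.
    by move=> /andP[s0 sh]; split=> //; apply/negP; rewrite -ltNge.
  by move=> [-> /negP]; rewrite -ltNge.
rewrite U measureD//=; last by rewrite std_exponential_tail// ltry.
rewrite (_ : _ `&` _ = `[h, +oo[%classic).
  by rewrite !std_exponential_tail// oppr0 expR0 -EFinB.
apply/setIidPr => s /=; rewrite !in_itv/= !andbT; exact: le_trans.
Qed.

(* The oscillation of psi on intervals of length 1 is contracted by the factor
   1 - e^-1, the mass of the exponential law on [0, 1]. *)
Let oscillation n t h : (0 <= t)%R -> (0 <= h <= 1)%R ->
  (`|psi (t + h) - psi t| <= (1 - expR (-1)) ^+ n)%R.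
Proof.
elim: n t h => [|n IH] t h t0 /andP[h0 h1].
  have := psi_itv t; have := psi_itv (t + h); rewrite expr0 ler_norml => /andP[a1 a2] /andP[b1 b2].
  by apply/andP; split; lra.
set q := (1 - expR (-1))%R in IH *.
have e1 : (expR (-1) <= expR (- h) :> R)%R by rewrite ler_expR lerN2.
have e2 : (expR (- h) <= 1 :> R)%R by rewrite -[leRHS]expR0 ler_expR oppr_le0.
have q0 : (0 <= q)%R by rewrite subr_ge0; apply: le_trans e1 e2.
have qn0 : (0 <= q ^+ n)%R by rewrite exprn_ge0.
have [J [JE tE]] := psi_split t0 h0.
have lag s : `[0%R, h[%classic s -> (`|psi (t + h) - psi (t + s)| <= q ^+ n)%R.
  rewrite /= in_itv/= => /andP[s0 sh].
  rewrite (_ : (t + h = (t + s) + (h - s))%R); last by ring.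
  apply: IH; first exact: addr_ge0.
  by rewrite subr_ge0 (ltW sh)/= (le_trans _ h1)// gerBl.
have mpsi : measurable_fun setT psi by apply: measurableT_comp mphi.
have mf : measurable_fun `[0%R, h[%classic (fun s => (psi (t + s))%:E).
  apply: measurable_funTS; apply/measurable_EFinP; apply: (measurableT_comp mpsi).
  exact: measurable_funD.
(* By [psi_split], [psi (t + h) - psi t] is the integral over [[0, h[] of
   [psi (t + h) - psi (t + s)], whose modulus is at most [q ^+ n], against a law giving this
   interval mass [1 - e^-h <= q]. *)
have J1 : (J <= (psi (t + h) + q ^+ n) * (1 - expR (- h)))%R.
  rewrite -lee_fin -JE EFinM -(head h0) -integral_cst//.
  apply: ge0_le_integral => //.
  - by move=> s _; rewrite lee_fin; case/andP: (psi_itv (t + s)).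
  - by move=> s /lag; rewrite ler_distlC => /andP[h2 h3]; rewrite lee_fin; lra.
have J2 : (psi (t + h) * (1 - expR (- h)) <= J + q ^+ n * (1 - expR (- h)))%R.
  rewrite -lee_fin EFinD -JE !EFinM -(head h0) -!integral_cst//.
  rewrite -ge0_integralD//; last first.
    by move=> s _; rewrite lee_fin; case/andP: (psi_itv (t + s)).
  apply: ge0_le_integral => //.
  - by move=> s _; rewrite lee_fin; case/andP: (psi_itv (t + h)).
  - exact: emeasurable_funD.
  - by move=> s /lag; rewrite ler_distlC => /andP[h2 h3]; rewrite -EFinD lee_fin; lra.
have qm : (q ^+ n * (1 - expR (- h)) <= q ^+ n * q)%R by rewrite ler_wpM2l// lerD2l lerN2.
rewrite exprSr; apply: le_trans qm; rewrite ler_norml; apply/andP; split; lra.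
Qed.

Let psi_step t h : (0 <= t)%R -> (0 <= h <= 1)%R -> psi (t + h) = psi t.
Proof.
move=> t0 h01; apply/eqP; rewrite -subr_eq0 -normr_le0.
have q1 : (`|1 - expR (-1)| < 1 :> R)%R.
  have e0 := expR_gt0 (-1 : R); have e1 : (expR (-1) <= 1 :> R)%R.
    by rewrite -[leRHS]expR0 ler_expR lerN10.
  by rewrite ger0_norm ?subr_ge0// gtrBl.
apply: (cvgr_to_ge (cvg_expr q1)).
by near=> n; exact: oscillation.
Unshelve. all: end_near. Qed.

Lemma resolvent_fixed_invariant t : (0 <= t)%R -> \int[mu]_x P_at P x (X t @^-1` B) = mu B.
Proof.
move=> t0; have m0 : phi 0%R = mu B.
  have indB : \int[mu]_x (\1_B x)%:E = mu B by rewrite integral_indic ?setIT.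
  rewrite /phi -indB.
  apply: eq_integral => x _; rewrite transition_ge0E//.
  by case: XP => _ _ /(_ _ _ mB) -> _ _.
rewrite -m0; transitivity (phi t).
  by apply: eq_integral => x _; rewrite transition_ge0E.
(* Time [t] is reached in [n] steps of length at most 1, as [psi_step] requires. *)
pose n := (Num.truncn t).+1.
have tn : (t < n%:R)%R by have := truncn_itv t0 => /andP[].
have n0 : (0 < n%:R :> R)%R by rewrite ltr0n.
have u01 : (0 <= t / n%:R <= 1)%R.
  by rewrite divr_ge0//= ler_pdivrMr// mul1r ltW.
have u0 : (0 <= t / n%:R)%R by case/andP: u01.
have k_ k : psi (k%:R * (t / n%:R))%R = psi 0.
  elim: k => [|k IH]; first by rewrite mul0r.
  by rewrite -natr1 mulrDl mul1r psi_step// mulr_ge0.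
by rewrite !psiE -(k_ n) mulrCA divff ?mulr1// gt_eqF.
Qed.

End fixed_resolvent.
End invariant_measure.

(** * Drift of the resolvent and existence of an invariant probability *)

Section resolvent_drift.
Local Open Scope ereal_scope.
Variables (R : realType) (d : nat) (dO : measure_display).
Variables (Omega : measurableType dO) (X : R -> Omega -> 'rV[R]_d).
Variable P : probability 'rV[R]_d R -> probability Omega R.
Hypothesis XP : strong_markov_process X P.

Local Notation E := (@std_exponential R).
Local Notation leb := (@lebesgue_measure R).
Local Notation Q := (resolvent XP).

Let mX t : (0 <= t)%R -> measurable_fun setT (X t).
Proof. by case: XP => + _ _ _ _; exact. Qed.

Let cX w : cadlag X w.
Proof. by case: XP. Qed.

Let mmax : measurable_fun setT (fun t : R => Num.max t 0%R).
Proof. exact: measurable_maxr. Qed.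

(** The drift inequality at time [T] is averaged over an exponential [T]: its mean 1 turns [eps * T]
    into [eps], and the mean of the occupation time of [C] up to [T] is [Q x C]. *)
Lemma resolvent_drift (V : 'rV[R]_d -> R) (C : set 'rV[R]_d) (eps M : R) x :
  measurable_fun setT V -> (forall x, 0 <= V x)%R -> measurable C -> (0 <= eps)%R -> (0 <= M)%R ->
  (forall T, (0 <= T)%R ->
    \int[P_at P x]_w (V (X T w))%:E + (eps * T)%:E <=
    (V x)%:E + M%:E * \int[P_at P x]_w (path_integral X \1_C T w)%:E) ->
  \int[Q x]_y (V y)%:E + eps%:E <= (V x)%:E + M%:E * Q x C.
Proof.
move=> mV V0 mC eps0 M0 drift.
pose h s := transition XP (s, x) C.
have h0 s : 0 <= h s by [].
have mh : measurable_fun setT h.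
  exact: (measurableT_comp (measurable_transition XP mC) (pair2_measurable x)).
have mIC : measurable_fun setT (\1_C : 'rV[R]_d -> R) by exact: measurable_indic.
have IC0 y : (0 <= \1_C y :> R)%R by [].
have IC1 y : (`|\1_C y : R| <= 1)%R by rewrite ger0_norm// indicE lern1 leq_b1.
pose H t := \int[leb]_(s in `[0%R, t]) h s.
have mH : measurable_fun setT H by exact: measurable_primitive.
have H0 t : 0 <= H t by exact: integral_ge0.
have occ t : \int[P_at P x]_w (path_integral X \1_C t w)%:E = H t.
  rewrite (expectation_path_integral mX cX mIC IC0 IC1); apply: eq_integral => s _.
  have mXs : measurable_fun setT (X (Num.max s 0%R)) by apply: mX; rewrite le_max lexx orbT.
  rewrite (_ : (fun w => _) = (fun w => (\1_(X (Num.max s 0%R) @^-1` C) w)%:E))//.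
  by rewrite integral_indic ?setIT// -[X in measurable X]setTI; exact: mXs.
pose A t := \int[P_at P x]_w (V (X (Num.max t 0%R) w))%:E.
have A0 t : 0 <= A t by apply: integral_ge0 => w _; rewrite lee_fin.
have mA : measurable_fun setT A.
  have mF : measurable_fun setT (fun p : R * Omega => (V (X (Num.max p.1 0%R) p.2))%:E).
    by apply/measurable_EFinP; apply: (measurableT_comp mV); exact: measurable_path.
  rewrite (_ : A = fubini_F (P_at P x) (fun p : R * Omega => (V (X (Num.max p.1 0%R) p.2))%:E))//.
  by apply: measurable_fun_fubini_tonelli_F => // p; rewrite lee_fin.
have max0 (t : R) : (0 <= Num.max t 0)%R by rewrite le_max lexx orbT.
have meps : measurable_fun setT (fun t : R => (eps * Num.max t 0)%R%:E).
  by apply/measurable_EFinP; exact: measurable_funM.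
(* The mean is computed by writing [t] as the integral of 1 over [[0, t]]. *)
have mean1 : \int[E]_t (Num.max t 0%R)%:E = 1.
  rewrite -(@std_exponential_setT R) -[RHS]mul1e -integral_cst// -(integral_std_exponential_primitive (measurable_cst _))//.
  have m1 : measurable_fun setT (fun t : R => \int[leb]_(s in `[0%R, t]) (cst 1 s : \bar R)).
    exact: (measurable_primitive (measurable_cst _)).
  apply: eq_integral_std_exponential => //.
  - exact/measurable_EFinP.
  - by move=> t; exact: integral_ge0.
  - move=> t t0; rewrite (max_idPl t0) integral_cst//= mul1e lebesgue_measure_itv/= lte_fin.
    case: ifPn; first by rewrite sube0.
    by rewrite -leNgt => t0'; congr _%:E; apply/eqP; rewrite eq_le t0'.
have HE : \int[E]_t H (Num.max t 0%R) = Q x C.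
  transitivity (\int[E]_t H t); last exact: integral_std_exponential_primitive.
  apply: eq_integral_std_exponential => //; first exact: (measurableT_comp mH mmax).
  by move=> t t0; rewrite (max_idPl t0).
have VE : \int[Q x]_y (V y)%:E = \int[E]_t A t.
  by rewrite integral_resolvent//; exact/measurable_EFinP.
have -> : eps%:E = \int[E]_t (eps * Num.max t 0)%R%:E.
  under eq_integral do rewrite EFinM.
  rewrite ge0_integralZl//; [by rewrite mean1 mule1|exact/measurable_EFinP|].
  by move=> t _; rewrite lee_fin.
rewrite VE -ge0_integralD//; last by move=> t _; rewrite lee_fin mulr_ge0.
have -> : (V x)%:E + M%:E * Q x C = \int[E]_t ((V x)%:E + M%:E * H (Num.max t 0%R)).
  have mHm : measurable_fun setT (fun t : R => H (Num.max t 0%R)) by exact: (measurableT_comp mH mmax).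
  rewrite ge0_integralD//; last 3 first.
  - by move=> t _; rewrite lee_fin.
  - by move=> t _; rewrite mule_ge0.
  - exact: measurable_funeM.
  rewrite integral_cst// [X in _ * X + _](@std_exponential_setT R) mule1.
  by rewrite ge0_integralZl// HE.
apply: ge0_le_integral => //.
- by move=> t _; rewrite adde_ge0// lee_fin mulr_ge0.
- exact: emeasurable_funD.
- apply: emeasurable_funD => //; apply: measurable_funeM.
  exact: (measurableT_comp mH mmax).
- by move=> t _; have := drift _ (max0 t); rewrite occ.
Qed.

End resolvent_drift.

(** Normalizing a measure of mass 1 leaves it unchanged and provides the structure of a
    probability. *)
Lemma minorizing_probability (R : realType) d (m : {measure set 'rV[R]_d -> \bar R}) :
  m setT = 1%E -> exists nu : probability 'rV[R]_d R, forall A, nu A = m A.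
Proof.
move=> m1; exists (mnormalize m \d_(0 : 'rV[R]_d)) => A.
by rewrite /= /mnormalize/= m1 onee_eq0/= invr1 mule1.
Qed.

Lemma growth_class_L_invariant (R : realType) (d : nat) (alpha K0 : R) (lam : R -> R)
    (b : 'rV[R]_d -> 'rV[R]_d) (k : 'rV[R]_d -> 'rV[R]_d -> R)
    (dO : measure_display) (Omega : measurableType dO) (X : R -> Omega -> 'rV[R]_d)
    (P : probability 'rV[R]_d R -> probability Omega R) :
  (0 < d)%N -> 1 < alpha < 2 ->
  (forall r, 0 <= r -> 0 < lam r) -> (forall r s, 0 <= r -> r <= s -> lam r <= lam s) ->
  class_L lam b k -> associated_process X P (generator alpha b k) ->
  lyapunov_stable alpha b k -> growth_condition b k K0 ->
  exists mu : probability 'rV[R]_d R, invariant_probability X P mu.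
Proof.
move=> d0 alpha12 lam0 lam_nd Lbk XPg lyap growth.
have XP : strong_markov_process X P := XPg.1.
have [V [r [eps [M [[V2 V0 r0 eps0 M0] test]]]]] := drift_test_functions d0 alpha12 lam0 lam_nd Lbk lyap.
pose C := [set y : 'rV[R]_d | `|y| <= r].
have mC : measurable C := @measurable_norm_le R d r.
have cV : continuous V by case: V2 => -[].
have mV : measurable_fun setT V by exact: continuous_measurable_rV.
have drift x := resolvent_drift XP mV V0 mC (ltW eps0) M0
  (@transition_drift R d alpha K0 lam b k dO Omega X P d0 alpha12 lam0 lam_nd Lbk growth XPg
     V r eps M V0 V2 r0 eps0 M0 test x).
(* The unit ball around [a] keeps distance 1 from the ball of radius [r + 1] that the process exits;
   test functions supported there vanish near every point of the latter. *)
pose a : 'rV[R]_d := const_mx (r + 1 + 1 + 1).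
have na : `|a| = r + 1 + 1 + 1 by rewrite /a norm_const_mx// ger0_norm// !addr_ge0.
have ya y : `|y - a| < 1 -> r + 1 + 1 <= `|y|.
  by move=> h; have := ler_distD y a 0; rewrite !subr0 distrC na; lra.
have [c c0 Hc] := exit_law_ge d0 alpha12 lam0 lam_nd Lbk growth XPg r0 ya.
(* Radius [1 / 2] gives a cube of Lebesgue measure 1 inside the unit ball around [a]. *)
pose W := [set z : 'rV[R]_d | `|- a + z| <= 1 / 2].
have WU : W `<=` [set y | `|y - a| < 1] 
  by move=> z /= zW; rewrite addrC (le_lt_trans zW)// ltr_pdivrMr// mul1r ltr1n.
have mW : measurable W.
  rewrite (_ : W = (fun z => - a + z) @^-1` [set y | `|y| <= 1 / 2])//.
  rewrite -[X in measurable X]setTI; apply: measurable_addl_rV => //.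
  exact: measurable_norm_le.
have W1 : lebesgue_rV R d W = 1%E.
  by rewrite lebesgue_cube ?divr_ge0// mulrCA divff ?mulr1 ?expr1n.
pose lW := mrestr (lebesgue_rV R d) mW.
have lW1 : lW setT = 1%E by rewrite /lW /mrestr setTI.
have mQ B : measurable B -> measurable_fun setT (fun y => resolvent XP y B).
  exact: (measurable_kernel (resolvent XP)).
pose m := mbind lW (resolvent XP).
have m1 : m setT = 1%E.
  rewrite /m /mbind; under eq_integral do rewrite (@prob_kernel _ _ _ _ _ (resolvent XP)).
  by rewrite integral_cst// mul1e.
have [nu nuE] := minorizing_probability m1.
(* [resolvent_stopped] bounds [Q x A] below by [1 / e] times the mean of [Q] at the exit position,
   whose law dominates [c] times Lebesgue measure on [W]. *)
have minor x A : C x -> measurable A -> ((c / expR 1)%:E * nu A <= resolvent XP x A)%E.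
  move=> Cx mA; have := resolvent_stopped XP (r + 1) x mA.
  rewrite nuE mulrC EFinM -muleA -lee_pdivlMl ?expR_gt0// invrK => h.
  have mpos : measurable_fun setT (fun w => X (exit_time X (r + 1) 1 w) w).
    exact: (measurable_exit_position XP).
  pose Y : {mfun Omega >-> 'rV[R]_d} := mfun_Sub (mem_set mpos).
  apply: le_trans h.
  have -> : (\int[P_at P x]_w resolvent XP (X (exit_time X (r + 1) 1 w) w) A =
    \int[distribution (P_at P x) Y]_y resolvent XP y A)%E.
    by rewrite /distribution ge0_integral_pushforward//; exact: mQ.
  pose cn := NngNum (ltW c0).
  apply: (@le_trans _ _ (\int[mscale cn lW]_y resolvent XP y A)%E).
    by rewrite ge0_integral_mscale//; exact: mQ.
  apply: ge0_le_measure_integral => //; last exact: mQ.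
  move=> S mS; apply: le_trans (Hc x Cx S mS).
  suff h : (lebesgue_rV R d (S `&` W) <= lebesgue_rV R d (S `&` [set y | (`|y - a| < 1)%R]))%E.
    by apply: (@lee_wpmul2l _ c%:E) h; rewrite lee_fin ltW.
  apply: le_measure; rewrite ?inE.
  - exact: measurableI.
  - apply: measurableI => //; apply: open_measurable_rV; exact: open_norm_lt.
  - by move=> z [Sz Wz]; split => //; exact: WU.
have ce0 : 0 < c / expR 1 by rewrite divr_gt0// expR_gt0.
have nuV : (\int[nu]_x (V x)%:E < +oo)%E.
  rewrite (@eq_measure_integral _ _ _ _ m); last by move=> A _ _; exact: nuE.
  have mVE : measurable_fun setT (EFin \o V) by exact/measurable_EFinP.
  rewrite integral_mbind//.
  have [K K0' HK] := continuous_bounded_ball (`|a| + 1) cV.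
  have mQV : measurable_fun setT (fun y => \int[resolvent XP y]_z (V z)%:E)%E.
    by apply: (measurable_fun_integral_kernel mQ).
  have mcW : measurable (~` W) by exact: measurableC.
  have QV0 y : (0 <= \int[resolvent XP y]_z (V z)%:E)%E by apply: integral_ge0 => z _; rewrite lee_fin.
  rewrite (@ge0_negligible_integral _ _ _ lW setT (~` W))//; last 2 first.
  - by move=> y _; exact: QV0.
  - transitivity (lebesgue_rV R d (~` W `&` W)); first by [].
    by rewrite setICl measure0.
  apply: (@le_lt_trans _ _ (\int[lW]_(y in setT `\` ~` W) cst (K + M)%:E y)%E).
    apply: ge0_le_integral => //.
    - exact: measurableD.
    - by move=> y _; exact: QV0.
    - exact: measurable_funTS.
    - move=> y [_ /contrapT Wy].
      have QC : (resolvent XP y C <= 1)%E.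
        by rewrite -(@prob_kernel _ _ _ _ _ (resolvent XP) y) le_measure ?inE.
      have QVy : (\int[resolvent XP y]_z (V z)%:E <= (V y)%:E + M%:E)%E.
        apply: (@le_trans _ _ (\int[resolvent XP y]_z (V z)%:E + eps%:E)%E).
          by rewrite leeDl// lee_fin ltW.
        by apply: (le_trans (drift y)); rewrite leeD2l// -[leRHS]mule1 lee_wpmul2l.
      apply: (le_trans QVy); rewrite -EFinD lee_fin lerD2r (le_trans (ler_norm _))// HK//.
      have := WU y Wy => /= h; have := ler_distD a y 0; rewrite !subr0; lra.
  rewrite integral_cst//; last exact: measurableD.
  rewrite (@le_lt_trans _ _ ((K + M)%:E * lW setT)%E)//; last by rewrite lW1 mule1 ltry.
  by rewrite lee_wpmul2l ?lee_fin ?addr_ge0// le_measure ?inE//; exact: measurableD.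
have [mu mu_fix] := drift_minorization_invariant mC ce0 minor V0 mV eps0 M0 drift nuV.
exists mu => t B t0 mB.
by apply: (@resolvent_fixed_invariant R d dO Omega X P XP mu _ B mB t t0) => A mA; exact: mu_fix.
Qed.

Theorem theorem5p2 (R : realType) (d : nat) (alpha theta K0 : R)
    (lam : R -> R)
    (b : 'rV[R]_d -> 'rV[R]_d) (k : 'rV[R]_d -> 'rV[R]_d -> R)
    (dO : measure_display) (Omega : measurableType dO)
    (X : R -> Omega -> 'rV[R]_d)
    (P : probability 'rV[R]_d R -> probability Omega R) :
  (0 < d)%N ->
  1 < alpha < 2 ->
  0 < theta < 1 ->
  (forall r, 0 <= r -> 0 < lam r) ->
  (forall r s, 0 <= r -> r <= s -> lam r <= lam s) ->
  class_L_sym lam b k \/ class_I alpha theta lam b k ->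
  associated_process X P (generator alpha b k) ->
  lyapunov_stable alpha b k ->
  growth_condition b k K0 ->
  exists mu : probability 'rV[R]_d R, invariant_probability X P mu.
Proof.
move=> d0 alpha12 _ lam0 lam_nd Lbk XP lyap growth.
apply: (growth_class_L_invariant d0 alpha12 lam0 lam_nd _ XP lyap growth).
by case: Lbk => -[].
Qed.
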